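(* Let $\beta>0$, $0<\gamma<\frac16$ and $N$ be such that $N-1-\beta-3\gamma>0$. Then the system of four ODEs (ODE1), (ODE2) ($i=1,2$) of the context, complemented by the closure relations defining $\alpha,\rho_1,\rho_2,u_i,\Phi_i$ there, with initial data $r_i(\cdot,0,\epsilon)=r_{i,0}^\epsilon$, $(r_iu_i)(\cdot,0,\epsilon)=r_{i,0}^\epsilon u_{i,0}^\epsilon$, provides a weak asymptotic method for the system of PDEs $$\partial_t r_i+\partial_x(r_iu_i)=0,\qquad \partial_t(r_iu_i)+\partial_x(r_iu_i^2)+r_i\,\partial_x\Phi_i=g\,r_i,\qquad \Phi_i=K_i\log\rho_i,\qquad i=1,2,$$ (with $\rho_1=r_1/\alpha$, $\rho_2=r_2/(1-\alpha)$, $\alpha$ the function of $(r_1,r_2)$ given in the context). That is: for every $\epsilon\in(0,1]$ the Cauchy problem for the ODE system has a unique global solution $t\mapsto (r_1,r_2,r_1u_1,r_2u_2)(\cdot,t,\epsilon)$ of class $\mathcal C^1$ from $[0,\infty)$ to $\mathcal C(\mathbb T)^4$ with $r_1,r_2>0$, and for every $\psi\in\mathcal C_c^\infty(\mathbb R)$, every $t>0$ and $i=1,2$, as $\epsilon\to0$, $$\int \frac{d}{dt}r_i(x,t,\epsilon)\psi(x)\,dx-\int (r_iu_i)(x,t,\epsilon)\psi'(x)\,dx\to0,$$ $$\int \frac{d}{dt}(r_iu_i)(x,t,\epsilon)\psi(x)\,dx-\int (r_iu_i^2)(x,t,\epsilon)\psi'(x)\,dx+\int r_i(x,t,\epsilon)\frac{\partial}{\partial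 x}\Phi_i(x,t,\epsilon)\psi(x)\,dx-g\int r_i(x,t,\epsilon)\psi(x)\,dx\to0,$$ $$\int\Phi_i(x,t,\epsilon)\psi(x)\,dx-K_i\int\log[\rho_i(x,t,\epsilon)]\psi(x)\,dx\to0.$$
   Context: Constants: $K_1>0$, $K_2>0$, $b_1,b_2\in\mathbb R$ with $b_1-b_2>0$, $g\in\mathbb R$. Functions on the torus $\mathbb T=\mathbb R/(2\pi\mathbb Z)$ are identified with $2\pi$-periodic functions on $\mathbb R$; $\mathcal C(\mathbb T)$ carries the sup norm; integrals against $\psi\in\mathcal C_c^\infty(\mathbb R)$ are over $\mathbb R$. The index $i$ ranges over $\{1,2\}$, and $\epsilon\in(0,1]$ is a small parameter. Closure relations. For $r_1,r_2>0$, $$\alpha=\frac{K_1r_1+K_2r_2+b_1-b_2-\sqrt{\Delta}}{2(b_1-b_2)},\qquad \Delta=(K_1r_1+K_2r_2+b_1-b_2)^2-4(b_1-b_2)K_1r_1;$$ this is the unique root in $(0,1)$ of $X^2(b_1-b_2)+X(-K_1r_1-b_1-K_2r_2+b_2)+K_1r_1$. Put $\rho_1=\frac{r_1}{\alpha}$ and $\rho_2=\frac{r_2}{1-\alpha}=\frac{-b_1+b_2+K_1\rho_1}{K_2}$. The velocity is $u_i=\frac{r_iu_i}{r_i}$, with $u_i^+=\frac{|u_i|+u_i}{2}$ and $u_i^-=\frac{|u_i|-u_i}{2}$. Fix $\phi\in\mathcal C_c^\infty(\mathbb R)$ with $\phi\ge0$, $\int\phi=1$, let $\phi_{\eta}(x)=\frac1\eta\phi(\frac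 x\eta)$, and set $$\Phi_i(x,t,\epsilon)=K_i\big[\log(\rho_i(\cdot,t,\epsilon)+\epsilon^N)*\phi_{\epsilon^\gamma}\big](x).$$ ODE system, with unknowns $r_i$ and $r_iu_i$ ($i=1,2$): $$\text{(ODE1)}\quad \frac{d}{dt}r_i(x,t,\epsilon)=\frac1\epsilon\big[(r_iu_i^+)(x-\epsilon,t,\epsilon)-(r_i|u_i|)(x,t,\epsilon)+(r_iu_i^-)(x+\epsilon,t,\epsilon)\big]+\epsilon^\beta,$$ $$\text{(ODE2)}\quad \frac{d}{dt}(r_iu_i)(x,t,\epsilon)=\frac1\epsilon\big[(r_iu_iu_i^+)(x-\epsilon,t,\epsilon)-(r_iu_i|u_i|)(x,t,\epsilon)+(r_iu_iu_i^-)(x+\epsilon,t,\epsilon)\big]-r_i(x,t,\epsilon)\frac{\partial}{\partial x}\Phi_i(x,t,\epsilon)+g\,r_i(x,t,\epsilon).$$ Initial data: $r_{i,0}\in L^1(\mathbb T)$ and $u_{i,0}\in L^\infty(\mathbb T)$ are given; $r_{i,0}^\epsilon$ and $u_{i,0}^\epsilon$ are regularizations of them, i.e. continuous functions on $\mathbb T$ converging to $r_{i,0}$ and $u_{i,0}$ in $L^1(\mathbb T)$ as $\epsilon\to0$, with $\sup_\epsilon\|r_{i,0}^\epsilon\|_{L^1}<\infty$, $\sup_\epsilon\|u_{i,0}^\epsilon\|_{L^\infty}<\infty$, and $r_{i,0}^\epsilon(x)>0$ for all $x$. *)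

(* Defs.v *)
From HB Require Import structures.
From mathcomp Require Import all_boot all_order all_algebra.
From mathcomp Require Import all_classical all_reals all_analysis.

Set Implicit Arguments.
Unset Strict Implicit.
Unset Printing Implicit Defensive.

Import Order.TTheory GRing.Theory Num.Theory.
Import numFieldNormedType.Exports.

Local Open Scope classical_set_scope.
Local Open Scope ring_scope.

(* The indices 1 and 2 are the elements ord0 and ord_max of 'I_2. *)

Definition torus_measure (R : realType) : {measure set _ -> \bar R} :=
  mrestr (@lebesgue_measure R) (measurable_itv `[0 : R, 2 * pi[).

(* p should be 1 or +oo; the elements are functions, not classes modulo a.e.
   equality. *)
Definition Lp_torus (R : realType) (p : \bar R) (f : R -> R) : Prop :=
  periodic f (2 * pi) /\ f \in Lfun (torus_measure R) p.

Definition norm_torus (R : realType) (p : \bar R) (f : R -> R) : \bar R :=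
  'N[torus_measure R]_p [EFin \o f]%E.

Definition continuous_torus (R : realType) (f : R -> R) : Prop :=
  periodic f (2 * pi) /\ continuous f.

(* C^1 maps from [0, +oo[ to C(T), with derivative dF. For continuous periodic
   functions, convergence in sup norm is uniform convergence on R; at t = 0 the
   difference quotient is one-sided. Nothing is required at t < 0. *)
Definition C1_torus (R : realType) (F dF : R -> R -> R) : Prop :=
  forall t : R, 0 <= t ->
  [/\ continuous_torus (F t), continuous_torus (dF t),
      {uniform, (fun h x => h^-1 * (F (t + h) x - F t x)) @
                  within [set h | 0 <= t + h] 0^' --> dF t} &
      {uniform, dF @ within [set s | 0 <= s] (nbhs t) --> dF t}].

Definition test_function (R : realType) (psi : R -> R) : Prop :=
  (forall (n : nat) (x : R), derivable (derive1n n psi) x 1) /\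
  compact (closure [set x | psi x != 0]).

Section closure_relations.
Variables (R : realType) (K b : 'I_2 -> R).

Definition alpha (s : 'I_2 -> R) : R :=
  let B := b ord0 - b ord_max in
  let S := K ord0 * s ord0 + K ord_max * s ord_max + B in
  let Delta := S ^+ 2 - 4 * B * (K ord0 * s ord0) in
  (S - Num.sqrt Delta) / (2 * B).

Definition rho (s : 'I_2 -> R) (i : 'I_2) : R :=
  if i == ord0 then s ord0 / alpha s else s ord_max / (1 - alpha s).

Definition mollifier (phi : R -> R) (eta x : R) : R := eta^-1 * phi (x / eta).

Definition convolution (f h : R -> R) (x : R) : R :=
  (\int[lebesgue_measure]_y (f y * h (x - y)))%R.

(* r j x is the value of r_j at x, at a fixed time. *)
Definition Phi (phi : R -> R) (gamma N eps : R) (r : 'I_2 -> R -> R)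
    (i : 'I_2) (x : R) : R :=
  K i * convolution (fun y => ln (rho (r ^~ y) i + eps `^ N))
                    (mollifier phi (eps `^ gamma)) x.

End closure_relations.

Definition velocity (R : realType) (r q : R -> R) (x : R) : R := q x / r x.

(* The transport term of the ODEs, factor 1/eps included, for the transported
   quantity w and the velocity u. *)
Definition upwind (R : realType) (eps : R) (w u : R -> R) (x : R) : R :=
  let up y := (`|u y| + u y) / 2 in
  let um y := (`|u y| - u y) / 2 in
  eps^-1 * (w (x - eps) * up (x - eps) - w x * `|u x|
            + w (x + eps) * um (x + eps)).

(* r i t x, q i t x stand for r_i(x,t), (r_i u_i)(x,t); dr and dq are their
   time derivatives. *)
Definition ode_solution (R : realType) (K b : 'I_2 -> R) (g : R)
    (phi : R -> R) (beta gamma N eps : R) (rinit uinit : 'I_2 -> R -> R)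
    (r q dr dq : 'I_2 -> R -> R -> R) : Prop :=
  [/\ forall i, C1_torus (r i) (dr i) /\ C1_torus (q i) (dq i),
      forall i (t x : R), 0 <= t -> 0 < r i t x,
      forall i (t x : R), 0 <= t ->
        dr i t x = upwind eps (r i t) (velocity (r i t) (q i t)) x
                   + eps `^ beta,
      forall i (t x : R), 0 <= t ->
        dq i t x = upwind eps (q i t) (velocity (r i t) (q i t)) x
                   - r i t x * derive1 (Phi K b phi gamma N eps (r ^~ t) i) x
                   + g * r i t x &
      forall i x, r i 0 x = rinit i x /\ q i 0 x = rinit i x * uinit i x].

(* Main.v *)
Require Import Defs.
From HB Require Import structures.
From mathcomp Require Import all_boot all_order all_algebra.
From mathcomp Require Import all_classical all_reals all_analysis.
From mathcomp Require Import measurable_realfun ess_sup_inf.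
From mathcomp Require Import ring lra.

Set Implicit Arguments.
Unset Strict Implicit.
Unset Printing Implicit Defensive.

Import Order.TTheory GRing.Theory Num.Theory.
Import numFieldNormedType.Exports.

Local Open Scope classical_set_scope.
Local Open Scope ring_scope.

(** For fixed eps the system is an ODE in C(T)^4.  The transport equation
    z_t = upwind z + s with a bounded velocity and s >= 0 preserves positivity;
    applied to w(t) r_i - q_i and w(t) r_i + q_i, where q_i = r_i u_i and
    w' >= |g| + sup |dPhi_i/dx|, it gives |u_i| <= w.  Since
    |log (rho + eps^N)| <= rho + N |log eps| and the masses of r_1 and r_2 grow
    at most linearly in time, |dPhi_i/dx| = O(eps^(- 3 gamma)), whence
    |u_i| = O(eps^(- 3 gamma)) and r_i >= c eps^(1 + beta + 3 gamma) at every
    positive time.  The vector field is Lipschitz on boxes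
    1/l <= r_i <= l, |q_i| <= l: Picard iteration solves the ODE with the state
    clipped to a box depending on time, and the a priori bounds keep the solution
    inside the box.  By Taylor expansion of the test function, the consistency
    errors are of order eps w + eps^beta, eps w^2, and
    eps^gamma |log eps| + eps^N / min r_i; they vanish because
    1 - 6 gamma > 0 and N - 1 - beta - 3 gamma > 0. *)

(** The estimates close without circularity because the force is controlled by the masses alone, and
    the masses are known exactly whatever the velocities are: upwind fluxes cancel over a period, so
    only the source [eps^beta] contributes. In [3 * gamma], a share of [2 * gamma] comes from the
    sup norm of the derivative of the mollifier, and the last [gamma] is spent on absorbing
    [|log eps|] into a power of [eps]. The lower bound on [r_i] is the equilibrium between the
    source [eps^beta] and an outflow at rate [w / eps]. It has to come from the source, since the
    regularized initial densities have no positive lower bound uniform in [eps]; it degenerates as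
    the time tends to 0. Two devices stand in for the maximum principle and Gronwall's lemma: a
    crude bound that improves itself to half, iterated under an exponential weight, and the
    comparison of derivatives with those of an explicit function. *)

Lemma continuousP_eps (R : realType) (f : R -> R) :
  continuous f <-> (forall x e, 0 < e -> exists2 d, 0 < d &
    forall y, `|y - x| < d -> `|f y - f x| <= e).
Proof.
split=> [cf x e e0|H x].
  have /cvgrPdist_le /(_ e e0) /nbhs_normP[d /= d0 Hd] := cf x.
  exists d => // y yx; rewrite distrC; apply: Hd => /=.
  by rewrite /ball_ /= distrC.
apply/cvgrPdist_le => e e0; have [d d0 Hd] := H x e e0.
apply/nbhs_normP; exists d => //= y /=; rewrite distrC => yx.
by rewrite distrC; exact: Hd.
Qed.

Lemma is_derive_epsP (R : realType) (f : R -> R) (x l : R) :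
  is_derive x 1 f l <-> (forall e, 0 < e -> exists2 d, 0 < d &
    forall k, `|k| < d -> `|f (x + k) - f x - k * l| <= e * `|k|).
Proof.
have E (m k : R) : k != 0 ->
    `|f (x + k) - f x - k * m| = `|m - k^-1 *: (f (k *: 1 + x) - f x)| * `|k|.
  move=> k0; rewrite -normrM distrC; congr `|_|.
  rewrite [k *: 1]mulr1 (addrC k) /GRing.scale /=.
  by rewrite mulrBl (mulrC k^-1) mulfVK// mulrC.
split=> [[df <-] e e0|H].
  move: df; rewrite /derivable => /cvgrPdist_le /(_ e e0).
  move=> /nbhs_ballP[d /= d0 Hd].
  exists d => // k kd; have [->|k0] := eqVneq k 0.
    by rewrite addr0 subrr mul0r subr0 normr0 mulr0.
  have := Hd k; rewrite /ball /= sub0r normrN => /(_ kd k0).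
  rewrite -/(derive f x 1) => Hk.
  by rewrite E// ler_pM2r ?normr_gt0//; exact: Hk.
suff Hc : (fun k => k^-1 *: (f (k *: 1 + x) - f x)) @ 0^' --> l.
  split; first by apply/cvg_ex; exists l.
  exact: cvg_lim.
apply/cvgrPdist_le => e e0; have [d d0 Hd] := H e e0.
apply/nbhs_ballP; exists d => //= k; rewrite /ball /= sub0r normrN => kd k0.
by rewrite -(@ler_pM2r _ `|k|) ?normr_gt0// -E//; exact: Hd.
Qed.

Lemma is_derive1_continuous (R : realType) (f f' : R -> R) :
  (forall x : R, is_derive x 1 f (f' x)) -> continuous f.
Proof.
by move=> df x; apply/differentiable_continuous/derivable1_diffP; case: (df x).
Qed.

(** Mean value theorem. Derivatives are asked for only inside the interval because solutions will be
    differentiated at positive times only. *)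
Lemma le_of_derive (R : realType) (f f' : R -> R) (a b : R) : a <= b ->
  continuous f -> (forall x, a < x < b -> is_derive x 1 f (f' x)) ->
  (forall x, a < x < b -> 0 <= f' x) -> f a <= f b.
Proof.
rewrite le_eqVlt => /orP[/eqP -> //|ab] cf df f0.
have df' x : x \in `]a, b[%R -> is_derive x 1 f (f' x).
  by rewrite in_itv/=; exact: df.
have [c cab E] := MVT ab df' (continuous_subspaceT cf).
rewrite -subr_ge0 E; apply: mulr_ge0; last by rewrite subr_ge0 ltW.
by apply: f0; move: cab; rewrite in_itv.
Qed.

(** Both [g + f] and [g - f] are nondecreasing. Bounds on integrals, Taylor remainders and
    exponential comparisons all reduce to this. *)
Lemma le_norm_of_derive (R : realType) (f f' g g' : R -> R) (a b : R) : a <= b ->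
  continuous f -> continuous g ->
  (forall x, a < x < b -> is_derive x 1 f (f' x)) ->
  (forall x, a < x < b -> is_derive x 1 g (g' x)) ->
  (forall x, a < x < b -> `|f' x| <= g' x) -> `|f b - f a| <= g b - g a.
Proof.
move=> ab cf cg df dg fg; rewrite ler_norml; apply/andP; split.
  rewrite -subr_ge0 (_ : _ - _ = (f b + g b) - (f a + g a)); last by ring.
  rewrite subr_ge0; apply: (@le_of_derive R (f + g) (fun x => f' x + g' x)) => //.
  - by move=> x; apply: cvgD; [exact: cf|exact: cg].
  - by move=> x xab; have := df x xab; have := dg x xab; move=> *; apply: is_deriveD.
  - by move=> x /fg; rewrite ler_norml => /andP[+ _]; rewrite -subr_ge0 opprK.
rewrite -subr_ge0 (_ : _ - _ = (g b - f b) - (g a - f a)); last by ring.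
rewrite subr_ge0; apply: (@le_of_derive R (g - f) (fun x => g' x - f' x)) => //.
- by move=> x; apply: cvgB; [exact: cg|exact: cf].
- by move=> x xab; have := df x xab; have := dg x xab; move=> *; apply: is_deriveB.
- by move=> x /fg; rewrite ler_norml subr_ge0 => /andP[_].
Qed.

Lemma eq_of_derive0 (R : realType) (f : R -> R) (a b : R) :
  (forall x : R, is_derive x 1 f 0) -> f a = f b.
Proof. by move=> df; apply: is_derive_0_is_cst. Qed.

(** * Signed integrals of continuous functions *)

(** The antiderivative that vanishes at 0, signed so that it lives on the whole line. Rules of
    integration then follow from uniqueness of antiderivatives, with no condition on the order of
    the endpoints. *)
Definition prim (R : realType) (f : R -> R) (x : R) : R :=
  (if 0 <= x then \int[lebesgue_measure]_(t in `]0%R, x]) f t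
   else - \int[lebesgue_measure]_(t in `]x, 0%R]) f t)%R.

Lemma continuous_integrable_itv (R : realType) (f : R -> R) (a b : R) :
  continuous f -> (@lebesgue_measure R).-integrable `[a, b] (EFin \o f).
Proof.
move=> cf; apply: continuous_compact_integrable; first exact: segment_compact.
exact: continuous_subspaceT.
Qed.

(** A base point to the left of both 0 and [x] merges the two cases of [prim], so that the one-sided
    fundamental theorem of calculus applies. *)
Lemma primE (R : realType) (f : R -> R) (a x : R) : continuous f ->
  a <= 0 -> a <= x -> prim f x =
  (\int[lebesgue_measure]_(t in `[a, x]) f t - \int[lebesgue_measure]_(t in `[a, 0%R]) f t)%R.
Proof.
move=> cf a0 ax; rewrite /prim; case: leP => [x0|/ltW x0].
  by rewrite Rintegral_itvB//; exact: continuous_integrable_itv.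
rewrite -(@Rintegral_itvB _ _ (BLeft a) (BRight 0) x) ?opprB//.
exact: continuous_integrable_itv.
Qed.

Lemma is_derive_derive1 (R : realType) (F : R -> R) (x l : R) :
  derivable F x 1 -> derive1 F x = l -> is_derive x 1 F l.
Proof. by move=> dF <-; rewrite derive1E; exact: derivableP. Qed.

Lemma is_derive_prim (R : realType) (f : R -> R) (x : R) : continuous f ->
  is_derive x 1 (prim f) (f x).
Proof.
move=> cf; pose a := - (`|x| + 1).
have a0 : a < 0 by rewrite oppr_lt0 ltr_wpDl.
have ax : a < x by rewrite /a; have := ler_norm (- x); rewrite normrN; lra.
have xx1 : x < x + 1 by rewrite ltrDl.
have [] := @continuous_FTC1_closed R f a x (x + 1) xx1
  (continuous_integrable_itv _ _ cf) ax (cf x).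
set F := (fun y => _) => dF F'.
pose G := F - cst (\int[lebesgue_measure]_(t in `[a, 0%R]) f t)%R.
have dG : is_derive x 1 G (f x).
  have dF' := is_derive_derive1 dF F'.
  by apply: is_derive_eq; rewrite subr0.
apply: near_eq_is_derive dG.
near=> y; rewrite /G /F (@primE _ _ a)//; first exact: ltW.
suff : a < y by move/ltW.
by near: y; exact: lt_nbhsr.
Unshelve. all: by end_near. Qed.

Definition Int (R : realType) (f : R -> R) (a b : R) : R := prim f b - prim f a.

Section Int_theory.
Variable R : realType.
Implicit Types (f g F : R -> R) (a b c : R).

(** [prim f - F] has zero derivative. Linearity, translation, reflection and scaling below each
    amount to exhibiting an antiderivative [F]. *)
Lemma Int_eq f F a b : continuous f -> (forall x : R, is_derive x 1 F (f x)) ->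
  Int f a b = F b - F a.
Proof.
move=> cf dF; apply/eqP; rewrite -subr_eq0; apply/eqP.
rewrite (_ : _ - _ = (prim f b - F b) - (prim f a - F a)); last by rewrite /Int; ring.
apply/eqP; rewrite subr_eq0; apply/eqP; apply: (@eq_of_derive0 R (prim f - F)) => x.
by have := is_derive_prim x cf; move=> df; apply: is_derive_eq; rewrite subrr.
Qed.

Lemma Int_itv f a b : continuous f -> a <= b ->
  Int f a b = (\int[lebesgue_measure]_(t in `[a, b]) f t)%R.
Proof.
move=> cf ab; pose c := - (`|a| + 1).
have c0 : c <= 0 by rewrite oppr_le0 addr_ge0.
have ca : c <= a by rewrite /c; have := ler_norm (- a); rewrite normrN; lra.
have cb := le_trans ca ab.
rewrite /Int !(@primE _ _ c)// opprB addrA subrK.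
rewrite Rintegral_itvB//; last exact: continuous_integrable_itv.
rewrite Rintegral_itv_obnd_cbnd//.
apply: integrableS (continuous_integrable_itv a b cf) => //.
by move=> x /=; rewrite !in_itv/= => /andP[/ltW -> ->].
Qed.

Lemma is_derive_Int f a (x : R) : continuous f -> is_derive x 1 (Int f a) (f x).
Proof.
move=> cf; have := is_derive_prim x cf => ?.
rewrite (_ : Int f a = prim f - cst (prim f a)); last by [].
by apply: is_derive_eq; rewrite subr0.
Qed.

Lemma continuous_Int f a : continuous f -> continuous (Int f a).
Proof. by move=> cf; apply: (@is_derive1_continuous R _ f) => x; exact: is_derive_Int. Qed.

Lemma Int_xx f a : Int f a a = 0. Proof. exact: subrr. Qed.

Lemma Int_chasles f a b c : Int f a b + Int f b c = Int f a c.
Proof. by rewrite /Int; ring. Qed.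

Lemma eq_Int f g a b : f =1 g -> Int f a b = Int g a b.
Proof. by move=> /funext ->. Qed.

Lemma IntD f g a b : continuous f -> continuous g ->
  Int (fun x => f x + g x) a b = Int f a b + Int g a b.
Proof.
move=> cf cg.
have cfg : continuous (fun x => f x + g x).
  by move=> x; apply: cvgD; [exact: cf|exact: cg].
have dfg (x : R) : is_derive x 1 (prim f + prim g) (f x + g x).
  have ? := is_derive_prim x cf; have ? := is_derive_prim x cg.
  exact: is_deriveD.
by rewrite (Int_eq a b cfg dfg) /Int !fctE; ring.
Qed.

Lemma IntZ f c a b : continuous f -> Int (fun x => c * f x) a b = c * Int f a b.
Proof.
move=> cf.
have cg : continuous (fun x => c * f x).
  by move=> x; apply: cvgM; [exact: cvg_cst|exact: cf].
have dg (x : R) : is_derive x 1 (c \*: prim f) (c * f x).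
  by have ? := is_derive_prim x cf; apply: is_deriveZ.
by rewrite (Int_eq a b cg dg) /Int mulrBr.
Qed.

Lemma IntB f g a b : continuous f -> continuous g ->
  Int (fun x => f x - g x) a b = Int f a b - Int g a b.
Proof.
move=> cf cg; have cg' : continuous (fun x => -1 * g x).
  by move=> x; apply: cvgM; [exact: cvg_cst|exact: cg].
rewrite -[- Int g a b]mulN1r -IntZ// -IntD//.
by apply: eq_Int => x; rewrite mulN1r.
Qed.

Lemma Int_cst c a b : Int (cst c) a b = c * (b - a).
Proof.
have cc : continuous (cst c : R -> R) by move=> x; exact: cvg_cst.
have dc (x : R) : is_derive x 1 (c \*: (@id R)) (cst c x).
  by apply: is_derive_eq; exact: mulr1.
by rewrite (Int_eq a b cc dc) mulrBr.
Qed.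

Lemma le_Int f g a b : continuous f -> continuous g -> a <= b ->
  (forall x, a <= x <= b -> f x <= g x) -> Int f a b <= Int g a b.
Proof.
move=> cf cg ab fg; rewrite -subr_ge0 -IntB//.
rewrite -(Int_xx (fun x => g x - f x) a).
have cgf : continuous (fun x => g x - f x).
  by move=> x; apply: cvgB; [exact: cg|exact: cf].
apply: (@le_of_derive R _ (fun x => g x - f x)) => //.
- exact: continuous_Int.
- by move=> x _; exact: is_derive_Int.
- by move=> x /andP[/ltW ax /ltW xb]; rewrite subr_ge0 fg// ax.
Qed.

Lemma Int_ge0 f a b : continuous f -> a <= b ->
  (forall x, a <= x <= b -> 0 <= f x) -> 0 <= Int f a b.
Proof.
move=> cf ab f0; rewrite -(mul0r (b - a)) -Int_cst; apply: le_Int => //.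
by move=> x; exact: cvg_cst.
Qed.

Lemma continuous_norm f : continuous f -> continuous (fun x => `|f x|).
Proof. by move=> cf x; apply: cvg_norm; exact: cf. Qed.

Lemma le_norm_Int f g a b : continuous f -> continuous g -> a <= b ->
  (forall x, a <= x <= b -> `|f x| <= g x) -> `|Int f a b| <= Int g a b.
Proof.
move=> cf cg ab fg; have := @le_norm_of_derive R (Int f a) f (Int g a) g a b ab.
rewrite !Int_xx !subr0; apply.
- exact: continuous_Int.
- exact: continuous_Int.
- by move=> x _; exact: is_derive_Int.
- by move=> x _; exact: is_derive_Int.
- by move=> x /andP[/ltW ax /ltW xb]; rewrite fg// ax.
Qed.

Lemma continuous_translate f c : continuous f -> continuous (fun x => f (x + c)).
Proof.
move=> cf x; apply: (@continuous_comp _ _ _ (fun x => x + c) f); last exact: cf.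
by apply: cvgD; [exact: cvg_id|exact: cvg_cst].
Qed.

Lemma continuous_reflect f c : continuous f -> continuous (fun x => f (c - x)).
Proof.
move=> cf x; apply: (@continuous_comp _ _ _ (fun x => c - x) f); last exact: cf.
by apply: cvgB; [exact: cvg_cst|exact: cvg_id].
Qed.

Lemma is_derive_reflect (F : R -> R) (c x l : R) : is_derive (c - x) 1 F l ->
  is_derive x 1 (fun x => F (c - x)) (- l).
Proof.
move=> dF; have d1 : is_derive x 1 (fun x => c - x) (-1).
  by apply: (is_derive_eq (is_deriveB (is_derive_cst c x 1) (is_derive_id x 1))); rewrite sub0r.
by have := @is_derive1_comp R F (fun x => c - x) x l (-1) dF d1; rewrite mulrN1.
Qed.

Lemma is_derive_translate (F : R -> R) (c x l : R) : is_derive (x + c) 1 F l ->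
  is_derive x 1 (fun x => F (x + c)) l.
Proof.
move=> dF; have d1 : is_derive x 1 (fun x => x + c) 1.
  by apply: (is_derive_eq (is_deriveD (is_derive_id x 1) (is_derive_cst c x 1))); rewrite addr0.
by have := @is_derive1_comp R F (fun x => x + c) x l 1 dF d1; rewrite mulr1.
Qed.

Lemma Int_shift f c a b : continuous f ->
  Int (fun x => f (x + c)) a b = Int f (a + c) (b + c).
Proof.
move=> cf.
have dg (x : R) : is_derive x 1 (fun x => prim f (x + c)) (f (x + c)).
  by apply: is_derive_translate; exact: is_derive_prim.
by rewrite (Int_eq a b (continuous_translate (c := c) cf) dg).
Qed.

Lemma Int_reflect f c a b : continuous f ->
  Int (fun x => f (c - x)) a b = Int f (c - b) (c - a).
Proof.
move=> cf.
have dg (x : R) : is_derive x 1 (- (fun x => prim f (c - x))) (f (c - x)).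
  have := is_derive_reflect (is_derive_prim (c - x) cf) => d.
  by apply: (is_derive_eq (is_deriveN d)); rewrite opprK.
by rewrite (Int_eq a b (continuous_reflect (c := c) cf) dg) /Int !fctE; ring.
Qed.

(** The bridge from the Lebesgue integrals over the line, in which the theorem is stated, to the
    signed integral [Int]. *)
Lemma Rintegral_support f a b : continuous f -> a <= b ->
  (forall x, ~~ (a <= x <= b) -> f x = 0) ->
  (\int[lebesgue_measure]_x f x)%R = Int f a b.
Proof.
move=> cf ab f0; rewrite Int_itv// [RHS]Rintegral_mkcond; apply: eq_Rintegral => x _.
rewrite patchE; case: ifPn => // xab; apply: f0.
by apply: contra xab => xab; rewrite inE/= in_itv.
Qed.

End Int_theory.

(** * Sup-norm continuous curves *)

(** Cousin's lemma, used as the compactness of [[a, b]]. Let [s] be the supremum of the points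
    reached from [a]: a local interval around [s] joins a reached point to one beyond [s], unless
    [s] is already [b]. *)
Lemma itv_cousin (R : realType) (P : R -> R -> Prop) (a b : R) : a <= b ->
  (forall x y z, a <= x -> x <= y -> y <= z -> z <= b -> P x y -> P y z -> P x z) ->
  (forall t, a <= t <= b -> exists2 d, 0 < d &
     forall x y, a <= x -> y <= b -> x <= t <= y -> t - d < x -> y < t + d -> P x y) ->
  P a b.
Proof.
move=> ab Padd Ploc; pose A := [set x | a <= x <= b /\ P a x].
have Aa : A a.
  split; first by rewrite lexx.
  have [|d d0] := Ploc a; first by rewrite lexx.
  by apply; rewrite ?lexx// ?gtrBl ?ltrDl.
have Ab : ubound A b by move=> x [/andP[]].
have sA : has_sup A by split; [exists a|exists b].
pose s := sup A.
have sb : s <= b by apply: ge_sup => //; exists a.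
have as_ : a <= s by apply: ub_le_sup => //; exists b.
have [|d d0 Hd] := Ploc s; first by rewrite as_.
have [x [/andP[ax xb] Pax] sx] := sup_adherent d0 sA.
have xs : x <= s by apply: ub_le_sup => //; [exists b|split=> //; rewrite ax].
pose y := Num.min b (s + d / 2).
have sy : s <= y by rewrite le_min sb lerDl divr_ge0// ltW.
have yb : y <= b by rewrite ge_min lexx.
have yd : y < s + d.
  by apply: (@le_lt_trans _ _ (s + d / 2)); [rewrite ge_min lexx orbT|lra].
have Pay : P a y.
  apply: (Padd a x y) => //; first exact: le_trans sy.
  by apply: Hd => //; rewrite xs.
have ys : y <= s.
  by apply: ub_le_sup; [exists b|split=> //; rewrite yb andbT (le_trans as_)].
have : y = b.
  by rewrite /y; case: leP => // ?; move: ys; rewrite ge_min => /orP[]; lra.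
by move=> <-.
Qed.

(* Curves that are continuous for the sup norm over X. *)
Definition ucurve (R : realType) (X : Type) (y : R -> X -> R) : Prop :=
  forall t e, 0 < e -> exists2 d, 0 < d &
    forall s, `|s - t| < d -> forall x, `|y s x - y t x| <= e.

Section ucurve_theory.
Variable R : realType.

Lemma ucurve_continuous (X : Type) (y : R -> X -> R) (x : X) :
  ucurve y -> continuous (y ^~ x).
Proof.
move=> uy; apply/continuousP_eps => t e e0; have [d d0 Hd] := uy t e e0.
by exists d => // s st; exact: Hd.
Qed.

(** Boundedness is additive in the time interval and holds near each time by sup-norm continuity.
    Only time is compact here; [X] is arbitrary. The next two lemmas follow the same scheme. *)
Lemma ucurve_bounded (X : Type) (y : R -> X -> R) (a b : R) : a <= b -> ucurve y ->
  (forall t, a <= t <= b -> exists C, forall x, `|y t x| <= C) ->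
  exists C, forall t, a <= t <= b -> forall x, `|y t x| <= C.
Proof.
move=> ab uy yb; apply: (@itv_cousin R
  (fun a b => exists C, forall t, a <= t <= b -> forall x, `|y t x| <= C) a b ab).
  move=> u v w _ uv vw _ [C HC] [D HD]; exists (Num.max C D) => t /andP[ut tw] x.
  rewrite le_max; case: (leP t v) => tv; first by rewrite HC ?ut.
  by rewrite HD ?orbT// (ltW tv).
move=> t /yb[C HC]; have [d d0 Hd] := uy t 1 ltr01.
exists d => // u v _ _ _ td vd; exists (C + 1) => s /andP[us sv] x.
have -> : y s x = y t x + (y s x - y t x) by ring.
apply: le_trans (ler_normD _ _) _; apply: lerD => //; apply: Hd.
by rewrite ltr_norml; apply/andP; split; lra.
Qed.

Lemma ucurve_lower_bound (X : Type) (y : R -> X -> R) (a b : R) : a <= b -> ucurve y ->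
  (forall t, a <= t <= b -> exists2 c, 0 < c & forall x, c <= y t x) ->
  exists2 c, 0 < c & forall t, a <= t <= b -> forall x, c <= y t x.
Proof.
move=> ab uy yb; apply: (@itv_cousin R (fun a b =>
  exists2 c, 0 < c & forall t, a <= t <= b -> forall x, c <= y t x) a b ab).
  move=> u v w _ uv vw _ [C C0 HC] [D D0 HD].
  exists (Num.min C D); first by rewrite lt_min C0.
  move=> t /andP[ut tw] x.
  rewrite ge_min; case: (leP t v) => tv; first by rewrite HC ?ut.
  by rewrite HD ?orbT// (ltW tv).
move=> t /yb[C C0 HC]; have [|d d0 Hd] := uy t (C / 2); first by rewrite divr_gt0.
exists d => // u v _ _ _ td vd; exists (C / 2); first by rewrite divr_gt0.
move=> s /andP[us sv] x; have := Hd s _ x; rewrite ler_norml ltr_norml => H.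
have /H/andP[] : - d < s - t < d by apply/andP; split; lra.
have := HC x; lra.
Qed.

Lemma ucurve_equicontinuous (y : R -> R -> R) (a b x0 e : R) : a <= b -> ucurve y ->
  (forall t, continuous (y t)) -> 0 < e -> exists2 d, 0 < d &
    forall x, `|x - x0| < d -> forall t, a <= t <= b -> `|y t x - y t x0| <= e.
Proof.
move=> ab uy cy e0; apply: (@itv_cousin R (fun a b => exists2 d, 0 < d &
  forall x, `|x - x0| < d -> forall t, a <= t <= b -> `|y t x - y t x0| <= e) a b ab).
  move=> u v w _ uv vw _ [C C0 HC] [D D0 HD].
  exists (Num.min C D); first by rewrite lt_min C0.
  move=> x; rewrite lt_min => /andP[xC xD] t /andP[ut tw].
  by case: (leP t v) => tv; [rewrite HC ?ut|rewrite HD ?(ltW tv)].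
move=> t _; have e30 : 0 < e / 3 by rewrite divr_gt0.
have [d d0 Hd] := uy t _ e30; exists d => // u v _ _ _ td vd.
have [d' d'0 Hd'] := (continuousP_eps (y t)).1 (cy t) x0 _ e30.
exists d' => // x /Hd' H s /andP[us sv].
have st : `|s - t| < d by rewrite ltr_norml; apply/andP; split; lra.
have := Hd s st x; have := Hd s st x0; move: H; rewrite !ler_norml; lra.
Qed.

Lemma IntN (f : R -> R) a b : Int f b a = - Int f a b.
Proof. by rewrite /Int opprB. Qed.

Lemma le_norm_Int_cst (f : R -> R) a b C : continuous f -> a <= b ->
  (forall x, a <= x <= b -> `|f x| <= C) -> `|Int f a b| <= C * (b - a).
Proof.
by move=> cf ab H; rewrite -Int_cst; apply: le_norm_Int => // x; exact: cvg_cst.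
Qed.

Lemma le_norm_Int_div (f : R -> R) a b e : continuous f -> 0 <= e -> a <= b ->
  (forall x, a <= x <= b -> `|f x| <= e / (b - a + 1)) -> `|Int f a b| <= e.
Proof.
move=> cf e0 ab H; apply: le_trans (le_norm_Int_cst cf ab H) _.
rewrite -mulrA ler_piMr// mulrC ler_pdivrMr; last by rewrite ltr_wpDl// subr_ge0.
by rewrite mul1r lerDl.
Qed.

Lemma continuous_Int_param (y : R -> R -> R) (a b : R) : ucurve y ->
  (forall t, continuous (y t)) -> continuous (fun x => Int (y ^~ x) a b).
Proof.
move=> uy cy; wlog ab : a b / a <= b.
  move=> H; have [/H //|/ltW/H {}H] := leP a b => x.
  rewrite (_ : (fun x => _) = - (fun x => Int (y^~ x) b a)).
    by apply: cvgN; exact: H.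
  by apply/funext => z; rewrite fctE IntN.
apply/continuousP_eps => x0 e e0.
have e'0 : 0 < e / (b - a + 1) by rewrite divr_gt0// ltr_wpDl// subr_ge0.
have [d d0 Hd] := ucurve_equicontinuous x0 ab uy cy e'0.
exists d => // x /Hd Hx; rewrite -IntB; try exact: ucurve_continuous.
apply: le_norm_Int_div (ltW e0) ab Hx.
by move=> t; apply: cvgB; exact: ucurve_continuous.
Qed.

(** Turns derivatives taken pointwise in [x] into a derivative in sup norm: the mean value
    inequality for [y s x - s * dy t x] involves only [dy s x - dy t x], which is small uniformly in
    [x]. *)
Lemma ucurve_taylor (X : Type) (y dy : R -> X -> R) (t delta e : R) : ucurve y -> ucurve dy ->
  0 < delta -> (forall s x, `|s - t| < delta -> is_derive s 1 (y ^~ x) (dy s x)) ->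
  0 < e -> exists2 d, 0 < d & forall k, `|k| < d -> forall x,
    `|y (t + k) x - y t x - k * dy t x| <= e * `|k|.
Proof.
move=> uy udy de0 dery e0; have [d' d'0 Hd'] := udy t e e0.
exists (Num.min d' delta); first by rewrite lt_min d'0.
move=> k; rewrite lt_min => /andP[kd' kde] x.
pose f s := y s x - s * dy t x.
have cf : continuous f.
  move=> s; apply: cvgB; first exact: ucurve_continuous.
  by apply: cvgM; [exact: cvg_id|exact: cvg_cst].
have cg : continuous (fun s : R => e * s).
  by move=> s; apply: cvgM; [exact: cvg_cst|exact: cvg_id].
have df s : `|s - t| < delta -> is_derive s 1 f (dy s x - dy t x).
  move=> st; have ds := dery s x st; rewrite (_ : f = (y ^~ x) - (dy t x \*: id)); last first.
    by apply/funext => z; rewrite /f !fctE mulrC.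
  by apply: is_derive_eq; rewrite /GRing.scale /= mulr1.
have dg (s : R) : is_derive s 1 (fun s : R => e * s) e.
  rewrite (_ : (fun s : R => e * s) = e \*: id)//.
  by apply: is_derive_eq; rewrite /GRing.scale /= mulr1.
have -> : y (t + k) x - y t x - k * dy t x = f (t + k) - f t by rewrite /f; ring.
have [k0|k0] := leP 0 k.
  rewrite (_ : e * _ = e * (t + k) - e * t); last by rewrite ger0_norm//; ring.
  have st s : t < s < t + k -> `|s - t| < Num.min d' delta.
    move=> /andP[ts sk]; rewrite ger0_norm; last by lra.
    rewrite lt_min; rewrite ger0_norm// in kd'; rewrite ger0_norm// in kde.
    by apply/andP; split; lra.
  apply: (@le_norm_of_derive R f (fun s => dy s x - dy t x) (fun s => e * s) (fun=> e)) => //.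
  - by rewrite lerDl.
  - by move=> s /st; rewrite lt_min => /andP[_]; exact: df.
  - by move=> s /st; rewrite lt_min => /andP[+ _] => /Hd' /(_ x).
rewrite distrC (_ : e * _ = e * t - e * (t + k)); last by rewrite ltr0_norm//; ring.
have st s : t + k < s < t -> `|s - t| < Num.min d' delta.
  move=> /andP[ts sk]; rewrite ler0_norm; last by lra.
  rewrite lt_min; rewrite ltr0_norm// in kd'; rewrite ltr0_norm// in kde.
  by apply/andP; split; lra.
apply: (@le_norm_of_derive R f (fun s => dy s x - dy t x) (fun s => e * s) (fun=> e)) => //.
- by rewrite gerDl ltW.
- by move=> s /st; rewrite lt_min => /andP[_]; exact: df.
- by move=> s /st; rewrite lt_min => /andP[+ _] => /Hd' /(_ x).
Qed.

(** Differentiation under the integral sign: the expansion of [ucurve_taylor] is uniform in [x], so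
    it can be integrated over the bounded interval. Derivatives near [t] suffice, which allows [t]
    close to 0. *)
Lemma is_derive_Int_param (y dy : R -> R -> R) (a b t delta : R) :
  ucurve y -> ucurve dy -> (forall t, continuous (y t)) -> (forall t, continuous (dy t)) ->
  0 < delta -> (forall s x, `|s - t| < delta -> is_derive s 1 (y ^~ x) (dy s x)) ->
  a <= b -> is_derive t 1 (fun s => Int (y s) a b) (Int (dy t) a b).
Proof.
move=> uy udy cy cdy de0 dery ab; apply/is_derive_epsP => e e0.
have e'0 : 0 < e / (b - a + 1) by rewrite divr_gt0// ltr_wpDl// subr_ge0.
have [d d0 Hd] := ucurve_taylor uy udy de0 dery e'0.
exists d => // k kd; have H := Hd k kd.
have c1 : continuous (fun x => y (t + k) x - y t x).
  by move=> x; apply: cvgB; exact: cy.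
have c2 : continuous (fun x => k * dy t x).
  by move=> x; apply: cvgM; [exact: cvg_cst|exact: cdy].
rewrite -IntZ// -IntB// -IntB//.
apply: le_norm_Int_div => //; first by move=> x; apply: cvgB; [exact: c1|exact: c2].
  by apply: mulr_ge0 => //; exact: ltW.
by move=> x _; rewrite mulrAC.
Qed.

Lemma continuous_Int_ucurve (y : R -> R -> R) (a b : R) : ucurve y ->
  (forall t, continuous (y t)) -> a <= b -> continuous (fun t => Int (y t) a b).
Proof.
move=> uy cy ab; apply/continuousP_eps => t e e0.
have e'0 : 0 < e / (b - a + 1) by rewrite divr_gt0// ltr_wpDl// subr_ge0.
have [d d0 Hd] := uy t _ e'0; exists d => // s /Hd Hs.
rewrite -IntB//; apply: le_norm_Int_div (ltW e0) ab _ => //.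
by move=> x; apply: cvgB; exact: cy.
Qed.

Lemma ucurve_Int (X : Type) (y : R -> X -> R) (a : R) : ucurve y ->
  (forall t, exists C, forall x, `|y t x| <= C) -> ucurve (fun t x => Int (y ^~ x) a t).
Proof.
move=> uy yb t e e0; have t11 : t - 1 <= t + 1 by lra.
have [C HC] := ucurve_bounded t11 uy (fun s _ => yb s).
have C1 : 0 < `|C| + 1 by rewrite ltr_wpDl.
exists (Num.min 1 (e / (`|C| + 1))); first by rewrite lt_min ltr01 divr_gt0.
move=> s; rewrite lt_min => /andP[st1 ste] x.
rewrite (_ : _ - _ = Int (y ^~ x) t s); last by rewrite /Int; ring.
have H u v : u <= v -> t - 1 <= u -> v <= t + 1 -> v - u <= e / (`|C| + 1) ->
    `|Int (y^~ x) u v| <= e.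
  move=> uv tu vt uve.
  apply: (@le_trans _ _ ((`|C| + 1) * (v - u))).
    apply: le_norm_Int_cst => //; first exact: ucurve_continuous.
    move=> z /andP[uz zv]; apply: le_trans (HC z _ x) _; first by lra.
    by apply: le_trans (ler_norm _) _; rewrite lerDl.
  by rewrite mulrC -ler_pdivlMr.
have [ts|st] := leP t s.
  by apply: H => //; move: st1 ste; rewrite ger0_norm ?subr_ge0//; lra.
by rewrite IntN normrN; apply: H; move: st1 ste; rewrite ltr0_norm ?subr_lt0//; lra.
Qed.

(** Fubini by differentiation: as functions of [d], both sides have derivative [Int (y d) a b] and
    vanish at [d = c]. *)
Lemma Int_swap (y : R -> R -> R) (a b c d : R) : ucurve y -> (forall t, continuous (y t)) ->
  (forall t, exists C, forall x, `|y t x| <= C) -> a <= b ->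
  Int (fun t => Int (y t) a b) c d = Int (fun x => Int (y ^~ x) c d) a b.
Proof.
move=> uy cy yb ab.
have uI := ucurve_Int c uy yb.
have dF (t : R) : is_derive t 1 (fun t => Int (fun x => Int (y ^~ x) c t) a b) (Int (y t) a b).
  apply: (@is_derive_Int_param (fun t x => Int (y ^~ x) c t) y _ _ t 1) => //.
    by move=> s; exact: continuous_Int_param.
  by move=> s x _; apply: is_derive_Int; exact: ucurve_continuous.
rewrite (Int_eq c d (continuous_Int_ucurve uy cy ab) dF).
rewrite [X in _ - X](_ : _ = 0) ?subr0//.
rewrite (@eq_Int R _ (cst 0)); last by move=> x; rewrite Int_xx.
by rewrite Int_cst mul0r.
Qed.

End ucurve_theory.

(** * Functions on the torus and test functions *)

Section periodic_functions.
Variable R : realType.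
Implicit Types f g : R -> R.
Local Notation period := (2 * pi : R).

Lemma period_gt0 : 0 < period. Proof. by rewrite mulr_gt0// pi_gt0. Qed.
Hint Resolve period_gt0 : core.

Lemma period_reduce (x : R) : exists2 y, 0 <= y <= period &
  forall f, periodic f period -> f x = f y.
Proof.
pose k := Num.floor (x / period); pose y := x - k%:~R * period.
exists y.
  have := floor_itv (x / period); rewrite -/k => /andP[].
  rewrite ler_pdivlMr// ltr_pdivrMr// => kx; rewrite intrD mulrDl mul1r => xk.
  by rewrite /y; apply/andP; split; lra.
move=> f pf; rewrite /y; case: k {y} => n.
  rewrite -[in LHS](subrK (n%:~R * period) x).
  rewrite (_ : n%:~R * period = period *+ n) ?periodicn//.
  by rewrite -[RHS]mulr_natl.
rewrite NegzE intrN mulNr opprK (_ : n.+1%:~R * period = period *+ n.+1) ?periodicn//.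
by rewrite -[RHS]mulr_natl.
Qed.

Lemma torus_bounded f : continuous_torus f -> exists2 C, 0 <= C & forall x, `|f x| <= C.
Proof.
move=> [pf cf]; have cn := continuous_norm cf.
have [c _ Hc] := EVT_max (ltW period_gt0) (continuous_subspaceT cn).
exists `|f c| => // x; have [y yp E] := period_reduce x.
by rewrite (E f)// Hc// in_itv.
Qed.

Lemma torus_gt0 f : continuous_torus f -> (forall x, 0 < f x) ->
  exists2 c, 0 < c & forall x, c <= f x.
Proof.
move=> [pf cf] f0.
have [c _ Hc] := EVT_min (ltW period_gt0) (continuous_subspaceT cf).
exists (f c) => // x; have [y yp E] := period_reduce x.
by rewrite (E f)// Hc// in_itv.
Qed.

Lemma Int_period f a : continuous_torus f -> Int f a (a + period) = Int f 0 period.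
Proof.
move=> [pf cf]; have := Int_shift period 0 a cf; rewrite add0r.
rewrite (_ : (fun x => f (x + period)) = f) => [E|].
  by rewrite -(Int_chasles f a 0) -(Int_chasles f 0 period) -E (IntN f a 0); ring.
by apply/funext => x; exact: pf.
Qed.

Lemma Int_periods f a n : continuous_torus f ->
  Int f a (a + period *+ n) = n%:R * Int f 0 period.
Proof.
move=> tf; elim: n => [|n IHn]; first by rewrite mulr0n addr0 mul0r Int_xx.
rewrite mulrSr addrA -(Int_chasles f a (a + period *+ n)) IHn Int_period//.
by rewrite -(natr1 n) [RHS]mulrDl mul1r.
Qed.

Lemma Int_le_periods f a b n : continuous_torus f -> (forall x, 0 <= f x) ->
  b <= a + period *+ n -> Int f a b <= n%:R * Int f 0 period.
Proof.
move=> tf f0 bn; rewrite -(Int_periods a)// -(Int_chasles f a b (a + period *+ n)) lerDl.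
by apply: Int_ge0 => //; exact: tf.2.
Qed.

Lemma Int_torus_shift f c : continuous_torus f ->
  Int (fun x => f (x + c)) 0 period = Int f 0 period.
Proof. by move=> tf; rewrite Int_shift ?add0r 1?addrC ?Int_period//; exact: tf.2. Qed.

Lemma torus_cst (c : R) : continuous_torus (fun=> c).
Proof. by split=> // x; exact: cvg_cst. Qed.

Lemma torusD f g : continuous_torus f -> continuous_torus g ->
  continuous_torus (fun x => f x + g x).
Proof.
move=> [pf cf] [pg cg]; split=> [x|x]; first by rewrite pf pg.
by apply: cvgD; [exact: cf|exact: cg].
Qed.

Lemma torusN f : continuous_torus f -> continuous_torus (fun x => - f x).
Proof.
move=> [pf cf]; split=> [x|x]; first by rewrite pf.
by apply: cvgN; exact: cf.
Qed.

Lemma torusB f g : continuous_torus f -> continuous_torus g ->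
  continuous_torus (fun x => f x - g x).
Proof. by move=> tf tg; apply: torusD => //; exact: torusN. Qed.

Lemma torusM f g : continuous_torus f -> continuous_torus g ->
  continuous_torus (fun x => f x * g x).
Proof.
move=> [pf cf] [pg cg]; split=> [x|x]; first by rewrite pf pg.
by apply: cvgM; [exact: cf|exact: cg].
Qed.

Lemma torus_shift f c : continuous_torus f -> continuous_torus (fun x => f (x + c)).
Proof.
by move=> [pf cf]; split=> [x|]; [rewrite addrAC pf|exact: continuous_translate].
Qed.

Lemma torus_norm f : continuous_torus f -> continuous_torus (fun x => `|f x|).
Proof. by move=> [pf cf]; split=> [x|]; [rewrite pf|exact: continuous_norm]. Qed.

(** The Lipschitz bound is asked for only on the half-line above [l]. The map [h] will be a
    clipping, composed here with a function bounded below. *)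
Lemma torus_lipschitz f (h : R -> R) (l L : R) : continuous_torus f ->
  (forall x, l <= f x) ->
  (forall u v, l <= u -> l <= v -> `|h u - h v| <= L * `|u - v|) ->
  continuous_torus (fun x => h (f x)).
Proof.
move=> [pf cf] lf hL; split=> [x|]; first by rewrite pf.
apply/continuousP_eps => x e e0; have L1 : 0 < `|L| + 1 by rewrite ltr_wpDl.
have [|d d0 Hd] := (continuousP_eps f).1 cf x (e / (`|L| + 1)); first by rewrite divr_gt0.
exists d => // y /Hd Hy; apply: le_trans (hL _ _ (lf _) (lf _)) _.
apply: (@le_trans _ _ ((`|L| + 1) * `|f y - f x|)).
  by apply: ler_wpM2r => //; apply: le_trans (ler_norm L) _; rewrite lerDl.
by rewrite mulrC -ler_pdivlMr.
Qed.

End periodic_functions.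

(** * Smooth functions supported in an explicit interval *)

Section bump_functions.
Variable R : realType.
Implicit Types f h psi : R -> R.

(** A test function with an explicit radius of support. The radius is kept by derivatives and scales
    with the argument, so integrals can be taken over intervals chosen in advance. *)
Definition bump (A : R) psi : Prop :=
  (forall (n : nat) (x : R), derivable (derive1n n psi) x 1) /\
  (forall x, A < `|x| -> psi x = 0).

Lemma derive1Sn f n : derive1n n.+1 f = derive1n n (derive1 f).
Proof. exact: iterSr. Qed.

Lemma test_function_bump psi : test_function psi -> exists2 A, 0 < A & bump A psi.
Proof.
move=> [dpsi cpt]; have [M [_ HM]] := compact_bounded cpt.
exists (`|M| + 1); first by rewrite ltr_wpDl.
split=> // x Mx; apply: contrapT => /eqP px.
suff : `|x| <= `|M| + 1 by rewrite leNgt Mx.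
apply: (HM (`|M| + 1)); first by rewrite (le_lt_trans (ler_norm _))// ltrDl.
exact: subset_closure.
Qed.

Lemma bump_is_derive A psi (x : R) : bump A psi -> is_derive x 1 psi (derive1 psi x).
Proof. by move=> [d _]; rewrite derive1E; apply: derivableP; exact: (d 0). Qed.

Lemma bump_derive A psi : bump A psi -> bump A (derive1 psi).
Proof.
move=> bp; have [d p0] := bp; split=> [n x|x Ax].
  by rewrite -derive1Sn; exact: (d n.+1).
rewrite derive1E; apply: derive_val; apply: (@near_eq_is_derive _ _ _ (cst 0)).
  have xA : 0 < `|x| - A by rewrite subr_gt0.
  apply/nbhs_normP; exists (`|x| - A) => //= y; rewrite /ball_/= => xy.
  rewrite p0//; have := ler_distD y x 0; rewrite !subr0; lra.
Qed.

Lemma bump_continuous A psi : bump A psi -> continuous psi.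
Proof. by move=> bp; apply: is_derive1_continuous => x; exact: bump_is_derive bp. Qed.

Lemma bump_bounded A psi : bump A psi -> exists2 C, 0 <= C & forall x, `|psi x| <= C.
Proof.
move=> bp; have cn := continuous_norm (bump_continuous bp).
have AA : - `|A| <= `|A| by rewrite (@le_trans _ _ 0)// oppr_le0.
have [c _ Hc] := EVT_max AA (continuous_subspaceT cn).
exists `|psi c| => // x; have [xA|Ax] := leP `|x| `|A|.
  by apply: Hc; rewrite in_itv/= -ler_norml.
by rewrite bp.2 ?normr0// (le_lt_trans (ler_norm A)).
Qed.

Lemma norm_sub_le_of_derive (f f' : R -> R) (C x y : R) :
  (forall z : R, is_derive z 1 f (f' z)) ->
  (forall z, `|z - x| <= `|y - x| -> `|f' z| <= C) -> `|f y - f x| <= C * `|y - x|.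
Proof.
move=> df H; have cf := is_derive1_continuous df.
have cg : continuous (fun s : R => C * s).
  by move=> s; apply: cvgM; [exact: cvg_cst|exact: cvg_id].
have dg (s : R) : is_derive s 1 (fun s : R => C * s) C.
  rewrite (_ : (fun s : R => C * s) = C \*: id)//.
  by apply: is_derive_eq; rewrite /GRing.scale /= mulr1.
have [xy|/ltW yx] := leP x y.
  rewrite [in leRHS]ger0_norm ?subr_ge0// mulrBr.
  apply: (@le_norm_of_derive R f f' (fun s => C * s) (fun=> C)) => // z /andP[xz zy].
  by apply: H; rewrite !ger0_norm; lra.
rewrite distrC [in leRHS]ler0_norm ?subr_le0// opprB mulrBr.
apply: (@le_norm_of_derive R f f' (fun s => C * s) (fun=> C)) => // z /andP[xz zy].
by apply: H; rewrite !ler0_norm; lra.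
Qed.

Lemma bump_lipschitz A psi : bump A psi ->
  exists2 C, 0 <= C & forall x y, `|psi y - psi x| <= C * `|y - x|.
Proof.
move=> bp; have [C C0 HC] := bump_bounded (bump_derive bp).
exists C => // x y; apply: (@norm_sub_le_of_derive psi (derive1 psi)) => // z.
exact: bump_is_derive bp.
Qed.

(** Mean value inequality for [psi z - z * derive1 psi x]. The constant is the Lipschitz constant of
    [derive1 psi], without the sharp factor one half. *)
Lemma bump_taylor A psi : bump A psi -> exists2 C, 0 <= C &
  forall x k, `|psi (x + k) - psi x - k * derive1 psi x| <= C * k ^+ 2.
Proof.
move=> bp; have [C C0 HC] := bump_lipschitz (bump_derive bp).
exists C => // x k; pose f z := psi z - z * derive1 psi x.
have df (z : R) : is_derive z 1 f (derive1 psi z - derive1 psi x).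
  rewrite (_ : f = psi - (derive1 psi x \*: id)); last first.
    by apply/funext => u; rewrite /f !fctE mulrC.
  have := bump_is_derive z bp => ?.
  by apply: is_derive_eq; rewrite /GRing.scale /= mulr1.
have -> : psi (x + k) - psi x - k * derive1 psi x = f (x + k) - f x by rewrite /f; ring.
have E : C * k ^+ 2 = (C * `|k|) * `|x + k - x|.
  by rewrite addrAC subrr add0r -mulrA -expr2 real_normK// num_real.
rewrite E; apply: norm_sub_le_of_derive df _ => z.
rewrite addrAC subrr add0r => zk; apply: le_trans (HC _ _) _.
exact: ler_wpM2l.
Qed.

Lemma derive1_scale A psi (c eta : R) : bump A psi ->
  derive1 (fun x => c * psi (x / eta)) = (fun x => (c / eta) * derive1 psi (x / eta)).
Proof.
move=> bp; apply/funext => x; rewrite derive1E; apply: derive_val.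
have d1 : is_derive x 1 (fun x => x / eta) eta^-1.
  rewrite (_ : (fun x => _) = eta^-1 \*: id); last by apply/funext => y; rewrite mulrC.
  by apply: is_derive_eq; rewrite /GRing.scale /= mulr1.
have d2 := @is_derive1_comp R psi (fun x => x / eta) x _ _ (bump_is_derive _ bp) d1.
apply: (is_derive_eq (is_deriveZ c d2)).
by rewrite /GRing.scale /= [_ * eta^-1]mulrC mulrA.
Qed.

Lemma bump_scale A psi (c eta : R) : bump A psi -> 0 < eta ->
  bump (A * eta) (fun x => c * psi (x / eta)).
Proof.
move=> bp eta0; split=> [n|x Ax]; last first.
  by rewrite bp.2 ?mulr0// normrM normfV (gtr0_norm eta0) ltr_pdivlMr.
(* The induction generalizes [c] and [psi]: the derivative of a rescaled bump is again a rescaled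
   bump, built on [derive1 psi] with another factor. *)
elim: n => [|n IHn] in c psi bp *; last first.
  move=> x; rewrite derive1Sn (derive1_scale _ _ bp); apply: IHn.
  exact: bump_derive.
move=> x /=; have d1 : is_derive x 1 (fun x => x / eta) eta^-1.
  rewrite (_ : (fun x => _) = eta^-1 \*: id); last by apply/funext => y; rewrite mulrC.
  by apply: is_derive_eq; rewrite /GRing.scale /= mulr1.
have d2 := @is_derive1_comp R psi (fun x => x / eta) x _ _ (bump_is_derive _ bp) d1.
by have [] := is_deriveZ c d2.
Qed.

End bump_functions.

(** * Convolutions and mollifiers *)

Section convolution_theory.
Variable R : realType.
Implicit Types f g h psi : R -> R.
Local Notation period := (2 * pi : R).

Lemma continuous_mul f g : continuous f -> continuous g -> continuous (fun x => f x * g x).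
Proof. by move=> cf cg x; apply: cvgM; [exact: cf|exact: cg]. Qed.

Lemma continuous_const (c : R) : continuous (fun _ : R => c).
Proof. by move=> x; exact: cvg_cst. Qed.

Lemma ucurve_lipschitz (X : Type) (y : R -> X -> R) (K : R) : 0 <= K ->
  (forall s t x, `|y s x - y t x| <= K * `|s - t|) -> ucurve y.
Proof.
move=> K0 HK t e e0; have K1 : 0 < K + 1 by rewrite ltr_wpDl.
exists (e / (K + 1)); first by rewrite divr_gt0.
move=> s st x; apply: (le_trans (HK s t x)).
apply: (@le_trans _ _ ((K + 1) * `|s - t|)).
  by apply: ler_wpM2r => //; rewrite lerDl.
by rewrite mulrC -ler_pdivlMr// ltW.
Qed.

Lemma bump_reflect A h (x y : R) : bump A h -> ~~ (x - A <= y <= x + A) -> h (x - y) = 0.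
Proof.
move=> bh xy; apply: bh.2; rewrite ltNge; apply: contra xy.
by rewrite ler_norml => /andP[? ?]; apply/andP; split; lra.
Qed.

Lemma continuous_conv_integrand A f h (x : R) : continuous f -> bump A h ->
  continuous (fun y => f y * h (x - y)).
Proof.
move=> cf bh; apply: continuous_mul => //.
by apply: continuous_reflect; exact: bump_continuous bh.
Qed.

(** The endpoints are free as long as they cover the support, so that convolutions at different
    points can be compared over one interval. *)
Lemma convolution_Int A f h (x a b : R) : continuous f -> bump A h -> 0 <= A ->
  a <= x - A -> x + A <= b -> convolution f h x = Int (fun y => f y * h (x - y)) a b.
Proof.
move=> cf bh A0 ax xb; apply: Rintegral_support.
- exact: continuous_conv_integrand bh.
- by lra.
- move=> y xy; rewrite (bump_reflect bh) ?mulr0//; apply: contra xy => /andP[? ?].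
  by apply/andP; split; lra.
Qed.

(** With [x] moved into the argument of [f], periodicity of [f] passes to the convolution. *)
Lemma convolution_Int_sym A f h (x : R) : continuous f -> bump A h -> 0 <= A ->
  convolution f h x = Int (fun z => f (x - z) * h z) (- A) A.
Proof.
move=> cf bh A0; rewrite (convolution_Int cf bh A0 (lexx _) (lexx _)).
pose g z := f (x - z) * h z.
have cg : continuous g.
  by apply: continuous_mul; [exact: continuous_reflect|exact: bump_continuous bh].
have -> : Int (fun y => f y * h (x - y)) (x - A) (x + A) =
   Int (fun y => g (x - y)) (x - A) (x + A).
  by apply: eq_Int => y; rewrite /g subKr.
by rewrite Int_reflect//; congr (Int _ _ _); ring.
Qed.

(** The derivative falls on [h], whose second-order expansion is uniform; [f] is only continuous. *)
Lemma is_derive_convolution A f h (x : R) : continuous_torus f -> bump A h -> 0 <= A ->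
  is_derive x 1 (convolution f h) (convolution f (derive1 h) x).
Proof.
move=> tf bh A0; have cf := tf.2; have bh' := bump_derive bh.
have [B B0 HB] := torus_bounded tf; have [C C0 HC] := bump_taylor bh.
(* The extra unit on each side covers the support of the integrand at [x + k] for every
   [|k| < 1]. *)
pose a := x - A - 1; pose b := x + A + 1.
have ab : a <= b by rewrite /a /b; lra.
apply/is_derive_epsP => e e0.
pose M := B * C * (b - a) + 1.
have M0 : 0 < M by rewrite ltr_wpDl// mulr_ge0 ?mulr_ge0 ?subr_ge0.
exists (Num.min 1 (e / M)); first by rewrite lt_min ltr01 divr_gt0.
move=> k; rewrite lt_min => /andP[k1 ke].
have [k1l k1r] : - 1 < k /\ k < 1 by move: k1; rewrite ltr_norml => /andP[].
rewrite (@convolution_Int A f h (x + k) a b)//; [|rewrite /a; lra|rewrite /b; lra].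
rewrite (@convolution_Int A f h x a b)//; [|rewrite /a; lra|rewrite /b; lra].
rewrite (@convolution_Int A f (derive1 h) x a b)//; [|rewrite /a; lra|rewrite /b; lra].
have c1 y := continuous_conv_integrand (x := y) cf bh.
have c2 := continuous_conv_integrand (x := x) cf bh'.
have c3 : continuous (fun y => k * (f y * derive1 h (x - y))).
  by apply: continuous_mul => //; exact: continuous_const.
have c4 : continuous (fun y => f y * h (x + k - y) - f y * h (x - y)).
  by move=> y; apply: cvgB; exact: c1.
rewrite -IntZ// -IntB// -IntB//.
apply: (@le_trans _ _ (B * (C * k ^+ 2) * (b - a))).
  apply: le_norm_Int_cst => //; first by move=> y; apply: cvgB; [exact: c4|exact: c3].
  move=> y _; rewrite -mulrBr mulrCA -mulrBr normrM; apply: ler_pM => //.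
  by rewrite (_ : x + k - y = x - y + k); [exact: HC|ring].
have -> : B * (C * k ^+ 2) * (b - a) = B * C * (b - a) * `|k| * `|k|.
  by rewrite -(real_normK (num_real k)); ring.
apply: ler_wpM2r => //; apply: (@le_trans _ _ (M * `|k|)).
  by apply: ler_wpM2r => //; rewrite /M lerDl.
by rewrite mulrC -ler_pdivlMr// ltW.
Qed.

Lemma torus_convolution A f h : continuous_torus f -> bump A h -> 0 <= A ->
  continuous_torus (convolution f h).
Proof.
move=> tf bh A0; split=> [x|]; last first.
  by apply: is_derive1_continuous => x; exact: is_derive_convolution bh A0.
rewrite !(convolution_Int_sym _ tf.2 bh A0); apply: eq_Int => z.
by rewrite addrAC tf.1.
Qed.

Lemma convolutionB A f g h x : continuous f -> continuous g -> bump A h -> 0 <= A ->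
  convolution f h x - convolution g h x = convolution (fun y => f y - g y) h x.
Proof.
move=> cf cg bh A0.
have cfg : continuous (fun y => f y - g y) by move=> y; apply: cvgB; [exact: cf|exact: cg].
rewrite !(convolution_Int _ bh A0 (lexx _) (lexx _))//.
rewrite -IntB; try exact: continuous_conv_integrand bh.
by apply: eq_Int => y; rewrite mulrBl.
Qed.

Lemma norm_convolution_le A f h C x : continuous f -> bump A h -> 0 <= A ->
  (forall y, `|h y| <= C) ->
  `|convolution f h x| <= C * Int (fun y => `|f y|) (x - A) (x + A).
Proof.
move=> cf bh A0 HC; rewrite (convolution_Int cf bh A0 (lexx _) (lexx _)).
have cn := continuous_norm cf.
rewrite -IntZ//; apply: le_norm_Int => //.
- exact: continuous_conv_integrand bh.
- by apply: continuous_mul => //; exact: continuous_const.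
- by lra.
- by move=> y _; rewrite normrM mulrC; apply: ler_wpM2r.
Qed.

Lemma norm_convolution_le_cst A f h B C x : continuous f -> bump A h -> 0 <= A ->
  (forall y, `|f y| <= B) -> (forall y, `|h y| <= C) ->
  `|convolution f h x| <= C * (B * (2 * A)).
Proof.
move=> cf bh A0 HB HC; apply: le_trans (norm_convolution_le _ cf bh A0 HC) _.
have C0 : 0 <= C by apply: le_trans (HC 0).
apply: ler_wpM2l => //; rewrite (_ : 2 * A = x + A - (x - A)); last by ring.
rewrite -Int_cst; apply: le_Int => //; [exact: continuous_norm|exact: continuous_const|lra].
Qed.

Lemma Int_support f a b c d : continuous f -> a <= b -> c <= d ->
  (forall x, ~~ (a <= x <= b) -> f x = 0) -> (forall x, ~~ (c <= x <= d) -> f x = 0) ->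
  Int f a b = Int f c d.
Proof. by move=> cf ab cd H1 H2; rewrite -Rintegral_support// -Rintegral_support. Qed.

Lemma bump_itv A B psi x : bump A psi -> A <= B -> ~~ (- B <= x <= B) -> psi x = 0.
Proof.
by move=> bp AB; rewrite -ler_norml -ltNge => Bx; apply: bp.2; exact: le_lt_trans Bx.
Qed.

(** An average of [psi] over points within [A] of [y], with weights of total mass 1, is within
    [C * A] of [psi y]. *)
Lemma bump_Int_mollify A B h psi C y : bump A h -> 0 <= A -> (forall x, 0 <= h x) ->
  Int h (- A) A = 1 -> bump B psi -> 0 <= B ->
  (forall x y, `|psi y - psi x| <= C * `|y - x|) -> 0 <= C ->
  `|Int (fun x => psi x * h (x - y)) (- B) B - psi y| <= C * A.
Proof.
move=> bh A0 h0 h1 bp B0 HC C0.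
have ch := bump_continuous bh; have cp := bump_continuous bp.
have chy : continuous (fun x => h (x - y)) by exact: continuous_translate.
have hy0 x : ~~ (y - A <= x <= y + A) -> h (x - y) = 0.
  move=> xy; apply: bh.2; rewrite ltNge; apply: contra xy.
  by rewrite ler_norml => /andP[? ?]; apply/andP; split; lra.
have E : Int (fun x => h (x - y)) (y - A) (y + A) = 1.
  by rewrite Int_shift// -h1; congr (Int _ _ _); ring.
rewrite (@Int_support _ _ _ (y - A) (y + A)); last 5 first.
- exact: continuous_mul.
- by lra.
- by lra.
- by move=> x xB; rewrite (bump_itv bp _ xB) ?mul0r.
- by move=> x /hy0 ->; rewrite mulr0.
rewrite -[psi y]mulr1 -E -IntZ// -IntB; try exact: continuous_mul; last first.
  by apply: continuous_mul => //; exact: continuous_const.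
rewrite -[C * A]mulr1 -E -IntZ//; apply: le_norm_Int.
- move=> x; apply: cvgB; first exact: continuous_mul.
  by apply: continuous_mul => //; exact: continuous_const.
- by apply: continuous_mul => //; exact: continuous_const.
- by lra.
- move=> x xy; rewrite -mulrBl normrM (ger0_norm (h0 _)); apply: ler_wpM2r => //.
  apply: le_trans (HC y x) _; apply: ler_wpM2l => //; rewrite ler_norml.
  by move: xy => /andP[? ?]; apply/andP; split; lra.
Qed.

(** Fubini moves the mollification from [f] onto [psi]. The error thus involves only the local [L^1]
    norm of [f]: no modulus of continuity of [f] uniform in [eps] would be available for the
    logarithm of the density. *)
Lemma convolution_weak A B f h psi C : continuous_torus f -> bump A h -> 0 <= A ->
  (forall x, 0 <= h x) -> Int h (- A) A = 1 -> bump B psi -> 0 <= B ->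
  (forall x y, `|psi y - psi x| <= C * `|y - x|) -> 0 <= C ->
  `|Int (fun x => convolution f h x * psi x) (- B) B -
    Int (fun x => f x * psi x) (- B) B|
  <= C * A * Int (fun x => `|f x|) (- (A + B)) (A + B).
Proof.
move=> tf bh A0 h0 h1 bp B0 HC C0; have cf := tf.2.
have ch := bump_continuous bh; have cp := bump_continuous bp.
pose D := A + B; have D0 : 0 <= D by rewrite addr_ge0.
have BB : - B <= B by lra.
have DD : - D <= D by lra.
(* Seen as a curve in [x] with values in functions of [y], [F] is Lipschitz in sup norm because
   [psi] and [h] are Lipschitz and bounded and [f] is bounded; this is what [Int_swap] requires. *)
pose F x y := psi x * (f y * h (x - y)).
have [Mf Mf0 HMf] := torus_bounded tf.
have [Mh Mh0 HMh] := bump_bounded bh; have [Lh Lh0 HLh] := bump_lipschitz bh.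
have [Mp Mp0 HMp] := bump_bounded bp.
have cF x : continuous (F x).
  by apply: continuous_mul; [exact: continuous_const|exact: continuous_conv_integrand bh].
have bF x : exists K, forall y, `|F x y| <= K.
  exists (Mp * (Mf * Mh)) => y; rewrite !normrM.
  by apply: ler_pM => //; apply: ler_pM.
have K0 : 0 <= C * Mh + Mp * Lh by rewrite addr_ge0// mulr_ge0.
have Hy x x' y : `|psi x' * h (x' - y) - psi x * h (x - y)| <=
    (C * Mh + Mp * Lh) * `|x' - x|.
  rewrite (_ : _ - _ =
    ((psi x' - psi x) * h (x' - y) + psi x * (h (x' - y) - h (x - y)))); last by ring.
  apply: le_trans (ler_normD _ _) _.
  rewrite [leRHS]mulrDl; apply: lerD; rewrite normrM.
    by rewrite mulrAC; apply: ler_pM.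
  rewrite -mulrA; apply: ler_pM => //; apply: le_trans (HLh _ _) _.
  by rewrite (_ : x' - y - (x - y) = x' - x)//; ring.
have uy := ucurve_lipschitz K0 (fun s t => Hy t s).
have uF : ucurve F.
  apply: (@ucurve_lipschitz _ _ (Mf * (C * Mh + Mp * Lh))); first exact: mulr_ge0.
  move=> x' x y; rewrite (_ : F x' y - F x y =
    f y * (psi x' * h (x' - y) - psi x * h (x - y))); last by rewrite /F; ring.
  by rewrite normrM -mulrA; apply: ler_pM.
rewrite (@Int_support (fun x => f x * psi x) _ _ (- D) D); last 5 first.
- exact: continuous_mul.
- by [].
- by [].
- by move=> x xB; rewrite (bump_itv bp _ xB) ?mulr0.
- by move=> x xB; rewrite (bump_itv bp _ xB) ?mulr0// /D lerDr.
have -> : Int (fun x => convolution f h x * psi x) (- B) B =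
    Int (fun x => Int (F x) (- D) D) (- B) B.
  apply: eq_Int => x; have [xB|Bx] := leP `|x| B; last first.
    rewrite bp.2// mulr0 (@eq_Int _ _ (cst 0)) ?Int_cst ?mul0r// => y.
    by rewrite /F bp.2// mul0r.
  move: xB; rewrite ler_norml => /andP[xB Bx].
  rewrite (convolution_Int cf bh A0 (a := - D) (b := D)); [|rewrite /D; lra|rewrite /D; lra].
  by rewrite mulrC -IntZ//; exact: continuous_conv_integrand bh.
rewrite Int_swap//.
pose G y := Int (fun x => psi x * h (x - y)) (- B) B.
have -> : Int (fun y => Int (F ^~ y) (- B) B) (- D) D =
    Int (fun y => f y * G y) (- D) D.
  apply: eq_Int => y; rewrite -IntZ; last first.
    by apply: continuous_mul => //; exact: continuous_translate.
  by apply: eq_Int => x; rewrite /F; ring.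
have cG : continuous G.
  apply: continuous_Int_param => // x.
  by apply: continuous_mul; [exact: continuous_const|exact: continuous_reflect].
rewrite -IntB; try exact: continuous_mul.
rewrite -IntZ; last exact: continuous_norm.
apply: le_norm_Int => //.
- by move=> y; apply: cvgB; exact: continuous_mul.
- by apply: continuous_mul; [exact: continuous_const|exact: continuous_norm].
- move=> y _; rewrite -mulrBr normrM mulrC; apply: ler_wpM2r => //.
  exact: (bump_Int_mollify _ bh).
Qed.

Lemma Int_scale f (eta a b : R) : continuous f -> 0 < eta ->
  Int (fun x => eta^-1 * f (x / eta)) (a * eta) (b * eta) = Int f a b.
Proof.
move=> cf eta0.
have d1 (x : R) : is_derive x 1 (fun x => x / eta) eta^-1.
  rewrite (_ : (fun x => _) = eta^-1 \*: id); last by apply/funext => y; rewrite mulrC.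
  by apply: is_derive_eq; rewrite /GRing.scale /= mulr1.
have dF (x : R) : is_derive x 1 (fun x => prim f (x / eta)) (eta^-1 * f (x / eta)).
  rewrite mulrC; exact: (@is_derive1_comp R (prim f) (fun x => x / eta) x _ _
    (is_derive_prim _ cf) (d1 x)).
have cg : continuous (fun x : R => eta^-1 * f (x / eta)).
  apply: continuous_mul; first exact: continuous_const.
  move=> x; apply: (@continuous_comp R R R (fun x : R => x / eta) f); last exact: cf.
  by apply: cvgM; [exact: cvg_id|exact: cvg_cst].
by rewrite (Int_eq _ _ cg dF) !mulfK ?gt_eqF.
Qed.

Lemma mollifier_bump A (phi : R -> R) eta : bump A phi -> 0 < eta ->
  bump (A * eta) (mollifier phi eta).
Proof. by move=> bp eta0; exact: (bump_scale _ bp). Qed.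

Lemma derive1_mollifier A (phi : R -> R) eta : bump A phi ->
  derive1 (mollifier phi eta) = (fun x => eta^-1 / eta * derive1 phi (x / eta)).
Proof. exact: derive1_scale. Qed.

End convolution_theory.

(** * Sequences with geometric increments *)

Section geometric_limits.
Variable R : realType.

Lemma geometric_small (A e : R) : 0 < e -> exists n, A / 2 ^+ n <= e.
Proof.
move=> e0; exists (Num.bound (`|A| / e)).
have := archi_boundP (divr_ge0 (normr_ge0 A) (ltW e0)).
set n := Num.bound _ => An; rewrite ler_pdivrMr ?exprn_gt0//.
apply: le_trans (ler_norm A) _; rewrite mulrC -ler_pdivrMr//.
apply: le_trans (ltW An) _; rewrite -natrX ler_nat ltnW//.
exact: ltn_expl.
Qed.

Lemma le_geometric (x y A : R) : (forall n, x <= y + A / 2 ^+ n) -> x <= y.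
Proof.
move=> H; apply/ler_addgt0Pr => e e0; have [n Hn] := geometric_small A e0.
by apply: le_trans (H n) _; rewrite lerD2l.
Qed.

Lemma geometric_cauchy (u : nat -> R) A : 0 <= A ->
  (forall n, `|u n.+1 - u n| <= A / 2 ^+ n) ->
  forall n k, `|u (n + k)%N - u n| <= 2 * A / 2 ^+ n.
Proof.
move=> A0 Hu n k; apply: (@le_trans _ _ (2 * A / 2 ^+ n * (1 - (2 ^+ k)^-1))).
  elim: k => [|k IHk]; first by rewrite addn0 expr0 invr1 !subrr normr0 mulr0.
  rewrite addnS (_ : _ - _ = (u (n + k).+1 - u (n + k)%N) + (u (n + k)%N - u n)); last by ring.
  apply: le_trans (ler_normD _ _) _.
  apply: le_trans (lerD (Hu _) IHk) _.
  rewrite exprD exprS le_eqVlt; apply/orP; left; apply/eqP; field.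
  by rewrite !expf_neq0.
apply: ler_piMr; first by rewrite divr_ge0// mulr_ge0.
by rewrite gerBl invr_ge0 exprn_ge0.
Qed.

(** The limit is chosen before any rate, and exists by convention even without convergence. It can
    therefore be picked at each point first, and shown afterwards to converge at a rate uniform on
    bounded time intervals. *)
Lemma geometric_limit (u : nat -> R) : exists l, forall A, 0 <= A ->
  (forall n, `|u n.+1 - u n| <= A / 2 ^+ n) -> forall n, `|u n - l| <= 2 * A / 2 ^+ n.
Proof.
have [[A0 [A00 HA0]]|N] := pselect (exists A, 0 <= A /\
    forall n, `|u n.+1 - u n| <= A / 2 ^+ n); last first.
  by exists 0 => A A0 HA; exfalso; apply: N; exists A.
pose E := [set x | exists n, x = u n - 2 * A0 / 2 ^+ n].
have ubE n : ubound E (u n + 2 * A0 / 2 ^+ n).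
  move=> x [m ->]; have [nm|/ltnW mn] := leqP n m.
    have := geometric_cauchy A00 HA0 n (m - n); rewrite subnKC// ler_norml => /andP[_].
    have : 0 <= 2 * A0 / 2 ^+ m by rewrite divr_ge0 ?mulr_ge0 ?exprn_ge0.
    by move=> ? ?; lra.
  have := geometric_cauchy A00 HA0 m (n - m); rewrite subnKC// ler_norml => /andP[+ _].
  have : 0 <= 2 * A0 / 2 ^+ n by rewrite divr_ge0 ?mulr_ge0 ?exprn_ge0.
  by move=> ? ?; lra.
have H0 n : `|u n - sup E| <= 2 * A0 / 2 ^+ n.
  have h1 : sup E <= u n + 2 * A0 / 2 ^+ n.
    by apply: ge_sup => //; exists (u 0%N - 2 * A0 / 2 ^+ 0); exists 0%N.
  have h2 : u n - 2 * A0 / 2 ^+ n <= sup E.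
    by apply: ub_le_sup; [exists (u 0%N + 2 * A0 / 2 ^+ 0)|exists n].
  by rewrite ler_norml; apply/andP; split; lra.
(* The supremum was built with the rate [A0]. For another rate [A], go through the term of index
   [n + k] and let [k] tend to infinity, which removes the contribution of [A0]. *)
exists (sup E) => A A1 HA n; apply: (@le_geometric _ _ (2 * A0)) => k.
rewrite (_ : _ - _ = (u (n + k)%N - sup E) - (u (n + k)%N - u n)); last by ring.
apply: le_trans (ler_normB _ _) _; rewrite addrC; apply: lerD.
  exact: geometric_cauchy.
apply: le_trans (H0 _) _; apply: ler_wpM2l; first by rewrite mulr_ge0.
rewrite lef_pV2 ?posrE ?exprn_gt0// exprD; apply: ler_peMl; first exact: exprn_ge0.
by apply: exprn_ege1; lra.
Qed.

Lemma halving_eq0 (x A : R) : (forall n, x <= A / 2 ^+ n) -> x <= 0.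
Proof. by move=> H; apply: (@le_geometric _ _ A) => n; rewrite add0r. Qed.

End geometric_limits.

(** * Comparison with exponentials *)

Section exponential_comparison.
Variable R : realType.

Lemma is_derive_expRM (c k x : R) : is_derive x 1 (fun s => c * expR (k * s)) (c * k * expR (k * x)).
Proof.
have d1 : is_derive x 1 (fun s : R => k * s) k.
  rewrite (_ : (fun s : R => k * s) = k \*: id)//.
  by apply: is_derive_eq; rewrite /GRing.scale /= mulr1.
have d2 := @is_derive1_comp R expR (fun s => k * s) x _ _ (is_derive_expR _) d1.
apply: (is_derive_eq (is_deriveZ c d2)).
by rewrite /GRing.scale /=; ring.
Qed.

Lemma continuous_expRM (c k : R) : continuous (fun s => c * expR (k * s)).
Proof. by apply: is_derive1_continuous => x; exact: is_derive_expRM. Qed.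

(** The Bielecki form of Gronwall's lemma: integrating a bound with weight [e^(k t)] gains a factor
    [1 / k], so a Lipschitz constant [L] with [k = 2 * L] halves the bound. *)
Lemma exp_increment_le (f f' : R -> R) (c k T : R) : 0 <= T -> 0 <= c -> continuous f ->
  (forall t, 0 < t < T -> is_derive t 1 f (f' t)) ->
  (forall t, 0 < t < T -> `|f' t| <= c * k * expR (k * t)) ->
  `|f T - f 0| <= c * expR (k * T).
Proof.
move=> T0 c0 cf df Hf; apply: (@le_trans _ _ (c * expR (k * T) - c * expR (k * 0))).
  apply: (@le_norm_of_derive R f f' (fun s => c * expR (k * s)) (fun s => c * k * expR (k * s))) => //.
    exact: continuous_expRM.
  by move=> x _; exact: is_derive_expRM.
by rewrite gerBl mulr_ge0// expR_ge0.
Qed.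

End exponential_comparison.

(** * The Cauchy problem in sup norm *)

Lemma max0_lipschitz (R : realType) (s t : R) : `|Num.max 0 s - Num.max 0 t| <= `|s - t|.
Proof.
case: (leP 0 s) => s0; case: (leP 0 t) => t0 //.
- by rewrite subr0 !ger0_norm//; lra.
- by rewrite sub0r normrN (ger0_norm t0) ler0_norm; lra.
- by rewrite subrr normr0.
Qed.

Section picard.
Variables (R : realType) (X : Type) (S : (X -> R) -> Prop) (G : R -> (X -> R) -> X -> R).
Hypothesis S_closed : forall y, (forall e : R, 0 < e -> exists2 u, S u & forall x, `|u x - y x| <= e) -> S y.
Hypothesis S_Int : forall (h : R -> X -> R) y0 t, ucurve h -> (forall s, S (h s)) -> S y0 ->
  S (fun x => y0 x + Int (h ^~ x) 0 t).
Hypothesis S_G : forall (t : R) y, 0 <= t -> S y -> S (G t y).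
Hypothesis G_lipschitz : forall T : R, 0 <= T -> exists2 L : R, 0 < L &
  forall (t : R) y z C, 0 <= t <= T -> S y -> S z -> (forall x, `|y x - z x| <= C) ->
  forall x, `|G t y x - G t z x| <= L * C.
Hypothesis G_bounded : forall T : R, 0 <= T -> exists2 C : R, 0 <= C &
  forall (t : R) y, 0 <= t <= T -> S y -> forall x, `|G t y x| <= C.
Hypothesis G_continuous : forall (t : R) y (e : R), 0 <= t -> S y -> 0 < e -> exists2 d : R, 0 < d &
  forall s : R, 0 <= s -> `|s - t| < d -> forall x, `|G s y x - G t y x| <= e.

Let pos (t : R) : R := Num.max 0 t.

Let pos_ge0 t : 0 <= pos t. Proof. by rewrite /pos le_max lexx. Qed.

Let pos_id (t : R) : 0 <= t -> pos t = t. Proof. by move=> t0; rewrite /pos max_r. Qed.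

Let pos_lip s t : `|pos s - pos t| <= `|s - t|. Proof. exact: max0_lipschitz. Qed.

(** The increment splits into a change of state, handled by the Lipschitz bound up to one unit of
    time later, and a change of time at a fixed state. Clamping is needed because [G] is controlled
    only at nonnegative times. *)
Lemma ucurve_vector_field (y : R -> X -> R) : ucurve y -> (forall t, S (y t)) ->
  ucurve (fun t => G (Num.max 0 t) (y (Num.max 0 t))).
Proof.
rewrite -/pos => uy Sy t e e0; have e20 : 0 < e / 2 by rewrite divr_gt0.
have T0 : 0 <= pos t + 1 by rewrite addr_ge0.
have [L L0 HL] := G_lipschitz T0.
have [d1 d10 H1] := uy (pos t) (e / 2 / L) (divr_gt0 e20 L0).
have [d2 d20 H2] := G_continuous (pos_ge0 t) (Sy (pos t)) e20.
exists (Num.min 1 (Num.min d1 d2)); first by rewrite !lt_min ltr01 d10.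
move=> s; rewrite !lt_min => /and3P[s1 sd1 sd2] x.
have ps := pos_lip s t.
rewrite (_ : _ - _ = (G (pos s) (y (pos s)) x - G (pos s) (y (pos t)) x) +
  (G (pos s) (y (pos t)) x - G (pos t) (y (pos t)) x)); last by rewrite /pos; ring.
apply: le_trans (ler_normD _ _) _; rewrite [leRHS](splitr e); apply: lerD; last first.
  by apply: H2 => //; exact: le_lt_trans sd2.
rewrite -[leRHS](@mulfVK _ L) ?gt_eqF// mulrC; apply: (HL (pos s)) => //.
  rewrite pos_ge0/=; have := le_lt_trans ps s1; rewrite ltr_norml => /andP[_]; lra.
by apply: H1; exact: le_lt_trans sd1.
Qed.

Let step (y0 : X -> R) (y : R -> X -> R) (t : R) (x : X) : R :=
  y0 x + Int (fun s => G (pos s) (y (pos s)) x) 0 t.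

Let step_prop y0 y : S y0 -> ucurve y -> (forall t, S (y t)) ->
  ucurve (step y0 y) /\ forall t, S (step y0 y t).
Proof.
move=> S0 uy Sy; have uG := ucurve_vector_field uy Sy.
have SG s : S (G (pos s) (y (pos s))) by exact: S_G.
split=> [|t]; last exact: S_Int.
have : ucurve (fun t x => Int (fun s => G (pos s) (y (pos s)) x) 0 t).
  apply: ucurve_Int => // s; have [C C0 HC] := G_bounded (pos_ge0 s).
  by exists C; apply: HC => //; rewrite pos_ge0 lexx.
move=> u t e e0; have [d d0 Hd] := u t e e0; exists d => // s st x.
by rewrite /step opprD addrACA subrr add0r; exact: Hd.
Qed.

(* Time is clamped to [0, +oo[, so that solutions are two-sided differentiable at 0. *)
Theorem picard (y0 : X -> R) : S y0 -> exists y : R -> X -> R,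
  [/\ ucurve y, (forall t, S (y t)), (forall x, y 0 x = y0 x) &
   forall (t : R) x, is_derive t 1 (y ^~ x) (G (Num.max 0 t) (y (Num.max 0 t)) x)].
Proof.
rewrite -/pos => S0; pose yn := fix yn n : R -> X -> R :=
  if n is n'.+1 then step y0 (yn n') else fun _ => y0.
have yn_prop n : ucurve (yn n) /\ forall t, S (yn n t).
  elim: n => [|n [IH1 IH2]] /=; last exact: step_prop.
  by split=> // t e e0; exists 1 => // s _ x; rewrite subrr normr0 ltW.
have yn_u n : ucurve (yn n) by exact: (yn_prop n).1.
have yn_S n t : S (yn n t) by exact: (yn_prop n).2.
have cG y x : ucurve y -> (forall t, S (y t)) -> continuous (fun s => G (pos s) (y (pos s)) x).
  by move=> uy Sy; exact: (@ucurve_continuous R X _ x (ucurve_vector_field uy Sy)).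
have dstep y x (t : R) : ucurve y -> (forall t, S (y t)) ->
    is_derive t 1 (step y0 y ^~ x) (G (pos t) (y (pos t)) x).
  move=> uy Sy; have d := is_derive_Int 0 t (cG y x uy Sy).
  by apply: (is_derive_eq (is_deriveD (is_derive_cst (y0 x) t 1) d)); rewrite add0r.
have contract T : 0 <= T -> exists2 A, 0 <= A &
    forall n t x, 0 <= t <= T -> `|yn n.+1 t x - yn n t x| <= A / 2 ^+ n.
  move=> T0; have [L L0 HL] := G_lipschitz T0; have [C C0 HC] := G_bounded T0.
  (* Under the weight [e^(k t)] each Picard step contracts by [L / k = 1 / 2], on all of [[0, T]] at
     once. The first increment has derivative at most [C], hence the constant [C / k]. *)
  pose k := 2 * L; have k0 : 0 < k by rewrite mulr_gt0.
  exists (C / k * expR (k * T)); first by rewrite mulr_ge0 ?expR_ge0// divr_ge0// ltW.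
  suff H n t x : 0 <= t <= T -> `|yn n.+1 t x - yn n t x| <= C / k / 2 ^+ n * expR (k * t).
    move=> n t x tT; apply: le_trans (H n t x tT) _; rewrite [leRHS]mulrAC.
    apply: ler_wpM2l; first by rewrite !divr_ge0 ?exprn_ge0// ltW.
    by rewrite ler_expR ler_wpM2l ?(ltW k0)//; case/andP: tT.
  elim: n t x => [|n IHn] t x /andP[t0 tT].
    have E : (yn 1%N ^~ x) 0 = y0 x by rewrite /= /step Int_xx addr0.
    rewrite expr0 divr1 -[X in _ - X]E.
    apply: (@exp_increment_le R (yn 1%N ^~ x) (fun s => G (pos s) y0 x)) => //.
    - by rewrite divr_ge0// ltW.
    - exact: (@ucurve_continuous R X (yn 1%N) x (yn_u 1%N)).
    - by move=> s _; apply: dstep; [exact: (yn_u 0%N)|].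
    - move=> s /andP[/ltW s0 /ltW st]; rewrite mulfVK ?gt_eqF// pos_id//.
      apply: le_trans (HC s y0 _ S0 x) _; first by rewrite s0 (le_trans st).
      by rewrite ler_peMr// -expR0 ler_expR mulr_ge0// ltW.
  pose f s := yn n.+2 s x - yn n.+1 s x.
  have E : f 0 = 0 by rewrite /f /= /step !Int_xx subrr.
  rewrite -[_ - _]/(f t) -[f t]subr0 -E.
  apply: (@exp_increment_le R f (fun s => G (pos s) (yn n.+1 (pos s)) x -
      G (pos s) (yn n (pos s)) x)) => //.
  - by rewrite !divr_ge0 ?exprn_ge0// ltW.
  - by move=> s; apply: cvgB; [exact: (@ucurve_continuous R X (yn n.+2) x (yn_u n.+2))|
      exact: (@ucurve_continuous R X (yn n.+1) x (yn_u n.+1))].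
  - move=> s _; have d1 := dstep (yn n.+1) x s (yn_u n.+1) (yn_S n.+1).
    by have d2 := dstep (yn n) x s (yn_u n) (yn_S n); exact: is_deriveB d1 d2.
  - move=> s /andP[/ltW s0 /ltW st]; rewrite pos_id//.
    have sT : 0 <= s <= T by rewrite s0 (le_trans st).
    apply: le_trans (HL s _ _ _ sT (yn_S n.+1 s) (yn_S n s) (fun z => IHn s z sT) x) _.
    rewrite /k exprS le_eqVlt; apply/orP; left; apply/eqP; field.
    by rewrite expf_neq0//= gt_eqF.
pose Y t x := projT1 (cid (geometric_limit (fun n => yn n (pos t) x))).
have HY T : 0 <= T -> exists2 A, 0 <= A &
    forall n t x, 0 <= t <= T -> `|yn n t x - Y t x| <= A / 2 ^+ n.
  move=> T0; have [A A0 HA] := contract T T0; exists (2 * A); first by rewrite mulr_ge0.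
  move=> n t x tT; rewrite /Y; case: cid => l /= Hl.
  have t0 : 0 <= t by case/andP: tT.
  by have := Hl A A0 _ n; rewrite pos_id//; apply => m; exact: HA.
have Ypos t : Y (pos t) = Y t by apply/funext => x; rewrite /Y (pos_id (pos_ge0 t)).
have SY t : S (Y t).
  apply: S_closed => e e0; have [A A0 HA] := HY _ (pos_ge0 t).
  have [n An] := geometric_small A e0; exists (yn n (pos t)); first exact: (yn_S n).
  by move=> x; rewrite -Ypos; apply: le_trans An; apply: HA; rewrite pos_ge0 lexx.
have uY : ucurve Y.
  move=> t e e0; have e3 : 0 < e / 3 by rewrite divr_gt0.
  have T0 : 0 <= pos t + 1 by rewrite addr_ge0.
  have [A A0 HA] := HY _ T0; have [n An] := geometric_small A e3.
  have [d d0 Hd] := (yn_u n) (pos t) _ e3.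
  exists (Num.min 1 d); first by rewrite lt_min ltr01.
  move=> s; rewrite lt_min => /andP[s1 sd] x; rewrite -(Ypos s) -(Ypos t).
  have ps := pos_lip s t.
  have sT : 0 <= pos s <= pos t + 1.
    by rewrite pos_ge0/=; have := le_lt_trans ps s1; rewrite ltr_norml => /andP[_]; lra.
  have tT : 0 <= pos t <= pos t + 1 by rewrite pos_ge0/=; lra.
  have h1 := le_trans (HA n _ x sT) An; have h2 := le_trans (HA n _ x tT) An.
  have := Hd _ (le_lt_trans ps sd) x; move: h1 h2.
  by rewrite !ler_norml => /andP[? ?] /andP[? ?] /andP[? ?]; apply/andP; split; lra.
have YE t x : 0 <= t -> Y t x = step y0 Y t x.
  move=> t0; apply/eqP; rewrite -subr_eq0 -normr_le0.
  have [A A0 HA] := HY _ t0; have [L L0 HL] := G_lipschitz t0.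
  (* Both sides are compared with the iterate [n + 1]: it is within [A / 2^n] of the limit, and
     within [L * A * t / 2^n] of [step y0 Y]. *)
  apply: (@halving_eq0 _ _ (A + L * A * t)) => n.
  have h1 : `|Y t x - yn n.+1 t x| <= A / 2 ^+ n.
    rewrite distrC; apply: le_trans (HA n.+1 t x _) _; first by rewrite t0 lexx.
    apply: ler_wpM2l => //; rewrite lef_pV2 ?posrE ?exprn_gt0// exprS.
    by apply: ler_peMl; [exact: exprn_ge0|lra].
  have h2 : `|yn n.+1 t x - step y0 Y t x| <= L * (A / 2 ^+ n) * t.
    rewrite /= /step opprD addrACA subrr add0r -IntB; last 2 first.
    - exact: (cG _ x (yn_u n) (yn_S n)).
    - exact: (cG _ x uY SY).
    rewrite -[X in _ * X]subr0; apply: le_norm_Int_cst => //.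
      have c1 := cG _ x (yn_u n) (yn_S n); have c2 := cG _ x uY SY.
      by move=> s; apply: cvgB; [exact: c1|exact: c2].
    move=> s /andP[s0 st]; rewrite pos_id//; have sT : 0 <= s <= t by rewrite s0.
    by apply: (HL s _ _ _ sT ((yn_S n) s) (SY s)) => z; exact: HA.
  rewrite (_ : _ - _ = (Y t x - yn n.+1 t x) + (yn n.+1 t x - step y0 Y t x)); last by ring.
  apply: le_trans (ler_normD _ _) _; apply: le_trans (lerD h1 h2) _.
  by rewrite mulrDl lerD2l le_eqVlt; apply/orP; left; apply/eqP; ring.
have [ust Sst] := step_prop S0 uY SY.
(* [Y] itself is frozen at negative times and would in general have only a one-sided derivative at
   0. [step y0 Y] agrees with it for [t >= 0] and is differentiable everywhere. *)
exists (step y0 Y); split=> // [x|t x]; first by rewrite /step Int_xx addr0.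
have -> : step y0 Y (pos t) = Y (pos t) by apply/funext => z; rewrite -YE.
exact: dstep.
Qed.

End picard.

(** * The upwind transport operator *)

Section upwind_theory.
Variables (R : realType) (eps : R).
Hypothesis eps_gt0 : 0 < eps.
Implicit Types w u : R -> R.

Lemma upwind_parts (a V : R) : `|a| <= V ->
  [/\ 0 <= (`|a| + a) / 2, (`|a| + a) / 2 <= V, 0 <= (`|a| - a) / 2 & (`|a| - a) / 2 <= V].
Proof.
move=> aV; have := ler_norm a; have := ler_norm (- a); rewrite normrN => ? ?.
by split; lra.
Qed.

(** Adding [V / eps * w] makes the coefficients of the three values of [w] nonnegative and at most
    [V / eps], and each costs at most [V / eps * C]; hence the 3. With [C = 0] this is the
    monotonicity of the scheme. *)
Lemma upwind_ge w u x V C : (forall y, `|u y| <= V) -> (forall y, - C <= w y) -> 0 <= C ->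
  - (3 * (V / eps) * C) <= V / eps * w x + upwind eps w u x.
Proof.
move=> Hu Hw C0.
have [a0 aV _ _] := upwind_parts (Hu (x - eps)).
have [_ _ b0 bV] := upwind_parts (Hu (x + eps)).
have V0 : 0 <= V by apply: le_trans (Hu x).
have H p m : 0 <= p -> p <= V -> - C <= m -> - (V * C) <= m * p.
  move=> p0 pV mC; apply: (@le_trans _ _ (- C * p)); last exact: ler_wpM2r.
  by rewrite mulNr lerN2 mulrC; apply: ler_wpM2r.
have h1 := H _ _ a0 aV (Hw (x - eps)); have h2 := H _ _ b0 bV (Hw (x + eps)).
have h3 : - (V * C) <= w x * (V - `|u x|).
  by apply: H; rewrite ?subr_ge0// gerBl.
rewrite (_ : - _ = eps^-1 * (- (V * C) + - (V * C) + - (V * C))); last by ring.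
rewrite (_ : V / eps * w x + _ = eps^-1 *
  (w (x - eps) * ((`|u (x - eps)| + u (x - eps)) / 2) + w (x + eps) *
   ((`|u (x + eps)| - u (x + eps)) / 2) + w x * (V - `|u x|))); last by rewrite /upwind; ring.
by apply: ler_wpM2l; [rewrite invr_ge0 ltW|rewrite lerD// lerD].
Qed.

Lemma upwind_cst_le u x V c : (forall y, `|u y| <= V) -> 0 <= c ->
  upwind eps (fun=> c) u x <= 2 * (V / eps) * c.
Proof.
move=> Hu c0.
have [_ aV _ _] := upwind_parts (Hu (x - eps)).
have [_ _ _ bV] := upwind_parts (Hu (x + eps)).
rewrite (_ : 2 * _ * c = eps^-1 * (c * V + c * V)); last by ring.
rewrite /upwind; apply: ler_wpM2l; first by rewrite invr_ge0 ltW.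
have h1 : c * ((`|u (x - eps)| + u (x - eps)) / 2) <= c * V by apply: ler_wpM2l.
have h2 : c * ((`|u (x + eps)| - u (x + eps)) / 2) <= c * V by apply: ler_wpM2l.
by apply: lerD => //; rewrite lerBlDr; apply: ler_wpDr => //; rewrite mulr_ge0.
Qed.

Lemma is_derive_expRMl (k a : R) (z z' : R -> R) (t : R) : is_derive t 1 z (z' t) ->
  is_derive t 1 (fun s => a * expR (k * s) * z s) (a * expR (k * t) * (k * z t + z' t)).
Proof.
move=> dz; apply: (is_derive_eq (is_deriveM (is_derive_expRM a k t) dz)).
by rewrite /GRing.scale /=; ring.
Qed.

(* A lower bound - C e^(5 k t), with k = V / eps, improves itself to half of it. *)
Lemma upwind_positivity (z v s : R -> R -> R) (T V C : R) : 0 <= T -> 0 < V -> 0 <= C ->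
  (forall x, continuous (z ^~ x)) ->
  (forall (t : R) x, 0 < t < T -> is_derive t 1 (z ^~ x) (upwind eps (z t) (v t) x + s t x)) ->
  (forall t x, 0 < t < T -> 0 <= s t x) ->
  (forall t x, 0 < t < T -> `|v t x| <= V) ->
  (forall x, 0 <= z 0 x) ->
  (forall t x, 0 <= t <= T -> - C <= z t x) ->
  forall t x, 0 <= t <= T -> 0 <= z t x.
Proof.
move=> T0 V0 C0 cz dz s0 vV z0 zC.
have [k kE] : exists k, k = V / eps by exists (V / eps).
have k0 : 0 < k by rewrite kE divr_gt0.
suff H n t x : 0 <= t <= T -> - (C / 2 ^+ n * expR (5 * k * t)) <= z t x.
  move=> t x tT; rewrite -oppr_le0; apply: (@halving_eq0 _ _ (C * expR (5 * k * t))) => n.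
  by rewrite lerNl mulrAC; exact: H.
elim: n t x => [|n IHn] t x tT.
  rewrite expr0 divr1; apply: le_trans (zC t x tT); rewrite lerN2 ler_peMr//.
  have t0 : 0 <= t by case/andP: tT.
  by rewrite -[leLHS]expR0 ler_expR mulr_ge0// mulr_ge0// ltW.
have [D DE] : exists D, D = C / 2 ^+ n.+1 by exists (C / 2 ^+ n.+1).
have D0 : 0 <= D by rewrite DE divr_ge0// exprn_ge0.
have DE2 : C / 2 ^+ n = 2 * D by rewrite DE exprS; field; rewrite expf_neq0.
rewrite -DE.
(* The inherited bound is [z >= - 2 * D * e^(5 k t)], so by [upwind_ge] the loss is at most
   [3 * k * 2 * D * e^(5 k t)]. Multiplied by [e^(k t)], it is exactly the derivative of
   [D * e^(6 k t)]. So [y] is nondecreasing from [y 0 >= 0], and division by [e^(k t)] returns the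
   exponent 5 with the constant [D]. *)
pose y s := 1 * expR (k * s) * z s x + D * expR (6 * k * s).
pose y' s' := 1 * expR (k * s') * (k * z s' x + (upwind eps (z s') (v s') x + s s' x)) +
  D * (6 * k) * expR (6 * k * s').
case/andP: tT => t0 tT.
have cy : continuous y.
  move=> q; apply: cvgD; last exact: continuous_expRM.
  by apply: cvgM; [exact: continuous_expRM|exact: cz].
have dy (q : R) : 0 < q < t -> is_derive q 1 y (y' q).
  move=> /andP[q0 qt]; have qT : 0 < q < T by rewrite q0 (lt_le_trans qt tT).
  have d1 := is_derive_expRMl k 1 (z := z ^~ x)
        (z' := fun s' => upwind eps (z s') (v s') x + s s' x) (dz q x qT).
  exact: is_deriveD d1 (is_derive_expRM D (6 * k) q).
have y'0 q : 0 < q < t -> 0 <= y' q.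
  move=> /andP[q0 qt].
  have qT : 0 < q < T by rewrite q0 (lt_le_trans qt tT).
  have qT' : 0 <= q <= T by rewrite !ltW//; case/andP: qT.
  have Cn : 0 <= 2 * D * expR (5 * k * q).
    by apply: mulr_ge0; [exact: mulr_ge0|exact: expR_ge0].
  have Hz x' : - (2 * D * expR (5 * k * q)) <= z q x' by rewrite -DE2; exact: IHn.
  have Hu := upwind_ge x (fun x => vV q x qT) Hz Cn; rewrite -kE in Hu.
  have sq := s0 q x qT.
  have -> : y' q = expR (k * q) * (k * z q x + (upwind eps (z q) (v q) x + s q x) +
       6 * k * D * expR (5 * k * q)).
    rewrite /y' (_ : expR (6 * k * q) = expR (k * q) * expR (5 * k * q)); first by ring.
    by rewrite -expRD; congr expR; ring.
  apply: mulr_ge0; first exact: expR_ge0; move: Hu.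
  have -> : 3 * k * (2 * D * expR (5 * k * q)) = 6 * k * D * expR (5 * k * q) by ring.
  by lra.
have := le_of_derive t0 cy dy y'0.
have y0 : 0 <= y 0 by rewrite /y !mulr0 expR0 !mul1r mulr1 addr_ge0.
move=> /(le_trans y0); rewrite /y mul1r.
rewrite (_ : expR (6 * k * t) = expR (k * t) * expR (5 * k * t)); last first.
  by rewrite -expRD; congr expR; ring.
rewrite mulrCA -mulrDr pmulr_rge0 ?expR_gt0//; lra.
Qed.

(* The right-hand side solves y' = - (V / eps) y + c. *)
Lemma upwind_lower (r v : R -> R -> R) (T V c : R) x : 0 <= T -> 0 < V ->
  continuous (r ^~ x) ->
  (forall t : R, 0 < t < T -> is_derive t 1 (r ^~ x) (upwind eps (r t) (v t) x + c)) ->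
  (forall t x, 0 < t < T -> `|v t x| <= V) ->
  (forall t x, 0 <= t <= T -> 0 <= r t x) ->
  c / (V / eps) + (r 0 x - c / (V / eps)) * expR (- (V / eps * T)) <= r T x.
Proof.
move=> T0 V0 cr dr vV r0.
have [k kE] : exists k, k = V / eps by exists (V / eps).
rewrite -kE; have k0 : 0 < k by rewrite kE divr_gt0.
(* The integrating factor: [y] is nondecreasing because [k * r + upwind r >= 0] for nonnegative
   [r]. *)
pose y s := 1 * expR (k * s) * (r s x - c / k).
pose y' s := 1 * expR (k * s) * (k * (r s x - c / k) + (upwind eps (r s) (v s) x + c)).
have cy : continuous y.
  move=> q; apply: cvgM; first exact: continuous_expRM.
  by apply: cvgB; [exact: cr|exact: cvg_cst].
have dy (q : R) : 0 < q < T -> is_derive q 1 y (y' q).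
  move=> qT; apply: (is_derive_expRMl k 1 (z := fun s => r s x - c / k)
      (z' := fun s => upwind eps (r s) (v s) x + c)).
  have d := dr q qT.
  by apply: (is_derive_eq (is_deriveB d (is_derive_cst (c / k) q 1))); rewrite subr0.
have y'0 q : 0 < q < T -> 0 <= y' q.
  move=> qT; have qT' : 0 <= q <= T by case/andP: qT => ? ?; rewrite !ltW.
  have Hr x' : - 0 <= r q x' by rewrite oppr0; exact: r0.
  have := upwind_ge x (fun x => vV q x qT) Hr (lexx _).
  rewrite -kE mulr0 oppr0 => H; rewrite /y' mul1r; apply: mulr_ge0; first exact: expR_ge0.
  by rewrite mulrBr (mulrC k (c / k)) mulfVK ?gt_eqF//; lra.
have := le_of_derive T0 cy dy y'0.
rewrite /y mulr0 expR0 !mul1r -(@ler_pM2l _ (expR (- (k * T)))) ?expR_gt0//.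
by rewrite mulrA -expRD addNr expR0 mul1r lerBrDl [X in _ + X <= _]mulrC.
Qed.

(** With [m t = M * e^((2 k + 1) t)] and [k = V / eps], the difference [m - r] solves the transport
    equation with source [(2 k + 1) m - c - upwind m]. This is nonnegative since [upwind m <= 2 k m]
    and [c <= 1 <= m], so [upwind_positivity] applies. *)
Lemma upwind_upper (r v : R -> R -> R) (T V c M C : R) : 0 <= T -> 0 < V -> c <= 1 -> 1 <= M ->
  0 <= C -> (forall x, continuous (r ^~ x)) ->
  (forall (t : R) x, 0 < t < T -> is_derive t 1 (r ^~ x) (upwind eps (r t) (v t) x + c)) ->
  (forall t x, 0 < t < T -> `|v t x| <= V) ->
  (forall t x, 0 <= t <= T -> r t x <= C) ->
  (forall x, r 0 x <= M) ->
  forall x, r T x <= M * expR ((2 * (V / eps) + 1) * T).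
Proof.
move=> T0 V0 c1 M1 C0 cr dr vV rC r0 x.
have [k kE] : exists k, k = V / eps by exists (V / eps).
rewrite -kE; have k0 : 0 < k by rewrite kE divr_gt0.
have M0 : 0 <= M by lra.
pose m t := M * expR ((2 * k + 1) * t).
have m1 t : 0 <= t -> 1 <= m t.
  move=> t0; apply: (le_trans M1); rewrite ler_peMr// -[leLHS]expR0 ler_expR.
  by apply: mulr_ge0 => //; lra.
pose s t x := (2 * k + 1) * m t - c - upwind eps (fun=> m t) (v t) x.
have cz x' : continuous (fun t => m t - r t x').
  by move=> t; apply: cvgB; [exact: continuous_expRM|exact: cr].
have dz (t : R) x' : 0 < t < T -> is_derive t 1 (fun t => m t - r t x')
    (upwind eps (fun x => m t - r t x) (v t) x' + s t x').
  move=> tT; have d := dr t x' tT; have dm := is_derive_expRM M (2 * k + 1) t.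
  by apply: (is_derive_eq (is_deriveB dm d)); rewrite /s /upwind /m; ring.
have s0 t x' : 0 < t < T -> 0 <= s t x'.
  move=> tT; have t0 : 0 <= t by case/andP: tT => /ltW.
  have := upwind_cst_le x' (fun x => vV t x tT) (le_trans ler01 (m1 t t0)).
  by rewrite -kE /s; have := m1 t t0; lra.
have z0 x' : 0 <= m 0 - r 0 x' by rewrite /m mulr0 expR0 mulr1 subr_ge0.
have zC t x' : 0 <= t <= T -> - C <= m t - r t x'.
  move=> tT; have t0 : 0 <= t by case/andP: tT.
  by have := rC t x' tT; have := m1 t t0; lra.
have TT : 0 <= T <= T by rewrite T0 lexx.
have := upwind_positivity T0 V0 C0 cz dz s0 vV z0 zC x TT.
by rewrite subr_ge0.
Qed.

End upwind_theory.

(** * The closure relations *)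

Section closure_estimates.
Variables (R : realType) (K b : 'I_2 -> R).
Hypothesis K_gt0 : forall i, 0 < K i.
Hypothesis b_gt0 : 0 < b ord0 - b ord_max.
Implicit Types s : 'I_2 -> R.

(* The discriminant Delta of the closure relation, as a sum of terms that are
   nonnegative for s > 0. *)
Definition disc s : R := (K ord0 * s ord0 + K ord_max * s ord_max - (b ord0 - b ord_max)) ^+ 2
  + 4 * (b ord0 - b ord_max) * (K ord_max * s ord_max).

Lemma ord2P (i : 'I_2) : i = ord0 \/ i = ord_max.
Proof. by case: i => -[|[|//]] p; [left|right]; apply/val_inj. Qed.

(** The sign of [b ord0 - b ord_max] keeps the discriminant away from 0 when the second density is,
    so that its square root is Lipschitz on boxes. *)
Lemma disc_ge s l : (forall i, 0 < s i) -> l <= s ord_max ->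
  4 * (b ord0 - b ord_max) * (K ord_max * l) <= disc s.
Proof.
move=> s0 ls; rewrite /disc; apply: ler_wpDl; first exact: sqr_ge0.
apply: ler_wpM2l; first by apply: mulr_ge0 => //; exact: ltW.
by apply: ler_wpM2l => //; exact: ltW.
Qed.

(* Rationalizing the denominators alpha and 1 - alpha. *)
Lemma rhoE s i : (forall i, 0 < s i) -> rho K b s i =
  (K ord0 * s ord0 + K ord_max * s ord_max +
   (if i == ord0 then 1 else -1) * (b ord0 - b ord_max) + Num.sqrt (disc s)) / (2 * K i).
Proof.
move=> s0; have a0 := mulr_gt0 (K_gt0 ord0) (s0 ord0).
have c0 := mulr_gt0 (K_gt0 ord_max) (s0 ord_max).
have -> : rho K b s i = if i == ord0 then s ord0 / alpha K b s else s ord_max / (1 - alpha K b s) by [].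
rewrite /alpha /=.
have B0' := b_gt0; set B := b ord0 - b ord_max in B0' *.
rewrite (_ : _ ^+ 2 - 4 * B * _ = disc s); last by rewrite /disc -/B; ring.
have dE : Num.sqrt (disc s) ^+ 2 = disc s.
  rewrite sqr_sqrtr// (le_trans _ (disc_ge s0 (lexx _)))// mulr_ge0 ?(ltW c0)//.
  by rewrite mulr_ge0// ltW.
have q0 := sqrtr_ge0 (disc s); move: dE q0; rewrite {2}/disc -/B.
set q := Num.sqrt (disc s); move=> dE q0.
have k0 := K_gt0 ord0; have k1 := K_gt0 ord_max.
have s00 := s0 ord0; have s11 := s0 ord_max.
set a := K ord0 * s ord0 in a0 dE *; set c := K ord_max * s ord_max in c0 dE *.
have e1 : (a + c + B - q) * (a + c + B + q) = 4 * B * a by rewrite -subr_sqr dE; ring.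
have e2 : (2 * B - (a + c + B - q)) * (a + c - B + q) = 4 * B * c.
  by transitivity (q ^+ 2 - (a + c - B) ^+ 2); [ring|rewrite dE; ring].
have n1 : a + c + B - q != 0.
  apply/eqP => E; have : 0 < 4 * B * a by rewrite !mulr_gt0.
  by rewrite -e1 E mul0r ltxx.
have n2 : 2 * B - (a + c + B - q) != 0.
  apply/eqP => E; have : 0 < 4 * B * c by rewrite !mulr_gt0.
  by rewrite -e2 E mul0r ltxx.
have B0 : B != 0 by rewrite gt_eqF.
case: (ord2P i) => -> /=.
  rewrite mul1r; apply/eqP; rewrite eqr_div; first last.
  - by rewrite mulf_neq0// gt_eqF.
  - by rewrite mulf_neq0// invr_neq0// mulf_neq0.
  apply/eqP; rewrite [RHS]mulrC mulrAC e1 /a; field.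
  by rewrite B0.
rewrite mulN1r; have -> : 1 - (a + c + B - q) / (2 * B) = (2 * B - (a + c + B - q)) / (2 * B).
  by field.
apply/eqP; rewrite eqr_div; first last.
- by rewrite mulf_neq0// gt_eqF.
- by rewrite mulf_neq0// invr_neq0// mulf_neq0.
apply/eqP; rewrite [RHS]mulrC mulrAC e2 /c; field.
by rewrite B0.
Qed.

(** With [a], [c] for [K_j r_j] and [B] for the difference of the [b]'s, the discriminant is both
    [(a - c - B)^2 + 4 a c] and [(a + c + B)^2 - 4 a B]; taking roots gives the two bounds. The
    lower one controls [eps^N / rho], the linear upper one bounds logarithms by masses. *)
Lemma rho_bounds s i : (forall i, 0 < s i) ->
  s i <= rho K b s i /\
  K i * rho K b s i <= K ord0 * s ord0 + K ord_max * s ord_max + (b ord0 - b ord_max).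
Proof.
move=> s0; rewrite rhoE//.
have a0 := mulr_gt0 (K_gt0 ord0) (s0 ord0).
have c0 := mulr_gt0 (K_gt0 ord_max) (s0 ord_max).
have d0 := disc_ge s0 (lexx _).
have q0 := sqrtr_ge0 (disc s).
have dE : Num.sqrt (disc s) ^+ 2 = disc s.
  rewrite sqr_sqrtr// (le_trans _ d0)// mulr_ge0 ?(ltW c0)//.
  by rewrite mulr_ge0// ltW.
have KK : K i * s i = K i * s i by [].
have k0 := K_gt0 i.
have key : 2 * (K i * s i) <= K ord0 * s ord0 + K ord_max * s ord_max +
   (if i == ord0 then 1 else -1) * (b ord0 - b ord_max) + Num.sqrt (disc s) /\
   Num.sqrt (disc s) <= K ord0 * s ord0 + K ord_max * s ord_max + (b ord0 - b ord_max).
  move: dE q0; rewrite {2}/disc.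
  set a := K ord0 * s ord0 in a0 *; set c := K ord_max * s ord_max in c0 *.
  have B0 := b_gt0; set B := b ord0 - b ord_max in B0 *; set q := Num.sqrt _ => dE q0.
  have ac := mulr_gt0 a0 c0; have aB := mulr_gt0 a0 B0; have cB := mulr_gt0 c0 B0.
  have H x : x ^+ 2 <= q ^+ 2 -> x <= q.
    move=> xq; have [x0|x0] := leP 0 x; first by rewrite -(@ler_pXn2r _ 2)// nnegrE.
    by rewrite (le_trans (ltW x0)).
  split.
    case: (ord2P i) => -> /=.
      have : a - c - B <= q by apply: H; rewrite dE; nra.
      by rewrite -/a; lra.
    have : c - a + B <= q by apply: H; rewrite dE; nra.
    by rewrite -/c; lra.
  rewrite -(@ler_pXn2r _ 2)// ?nnegrE//; last by lra.
  by rewrite dE; nra.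
case: key => key1 key2; split.
  rewrite ler_pdivlMr; last by rewrite mulr_gt0.
  by apply: le_trans key1; rewrite le_eqVlt; apply/orP; left; apply/eqP; ring.
rewrite mulrA ler_pdivrMr ?mulr_gt0//.
have : (if i == ord0 then 1 else -1) * (b ord0 - b ord_max) <= b ord0 - b ord_max.
  have B0 := b_gt0; case: ifP => _; rewrite ?mul1r ?mulN1r; lra.
move: key2; set X := K ord0 * _ + _; set Y := Num.sqrt _; set Z := (if _ then _ else _) * _.
move=> h1 h2; rewrite -(subr_ge0 (K i * _)).
rewrite (_ : _ - _ = K i * (2 * (X + (b ord0 - b ord_max)) - (X + Z + Y))); last by ring.
by apply: mulr_ge0; [exact: ltW|lra].
Qed.

Lemma rho_gt0 s i : (forall i, 0 < s i) -> 0 < rho K b s i.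
Proof. by move=> s0; apply: lt_le_trans (s0 i) (rho_bounds i s0).1. Qed.

End closure_estimates.

(** * Growth and Lipschitz bounds for scalar functions *)

Section logarithm_estimates.
Variable R : realType.

Lemma ln_le_sub1 (x : R) : 0 < x -> ln x <= x - 1.
Proof. by move=> x0; have := @le_ln1Dx R (x - 1); rewrite addrCA subrr addr0; apply; lra. Qed.

Lemma powR_le1 (e p : R) : 0 < e <= 1 -> 0 <= p -> e `^ p <= 1.
Proof. by move=> e01 p0; rewrite -(powRr0 e); apply: ger_powR. Qed.

Lemma neg_ln_le (e p : R) : 0 < e <= 1 -> 0 < p -> - ln e <= e `^ (- p) / p.
Proof.
move=> /andP[e0 e1] p0; rewrite ler_pdivlMr// mulNr mulrC -mulNr -ln_powR.
by apply: ltW; apply: ln_sublinear; exact: powR_gt0.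
Qed.

(** The shift bounds the logarithm below by [p * ln e], and [|ln e|] costs any small power
    [e^(- g) / g]. The exponent is left free: [gamma] is used for the force and [gamma / 2] for
    consistency. *)
Lemma ln_shift_le (e p x g : R) : 0 < e <= 1 -> 0 <= p -> 0 < x -> 0 < g ->
  `|ln (x + e `^ p)| <= x + p / g * e `^ (- g).
Proof.
move=> e01 p0 x0 g0; have e0 : 0 < e by case/andP: e01.
have ep0 : 0 < e `^ p by exact: powR_gt0.
have h1 : ln (x + e `^ p) <= x.
  apply: le_trans (ln_le_sub1 _) _; first by rewrite addr_gt0.
  by have := powR_le1 e01 p0; lra.
have h2 : - ln (x + e `^ p) <= p / g * e `^ (- g).
  apply: (@le_trans _ _ (- ln (e `^ p))).
    by rewrite lerN2 ler_ln ?posrE ?addr_gt0// lerDr ltW.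
  rewrite ln_powR -mulrN (_ : p / g * _ = p * (e `^ (- g) / g)); last by ring.
  by apply: ler_wpM2l => //; exact: neg_ln_le.
have h3 : 0 <= p / g * e `^ (- g) by apply: mulr_ge0; [rewrite divr_ge0// ltW|exact: powR_ge0].
by rewrite ler_norml; apply/andP; split; lra.
Qed.

Lemma sqrt_lipschitz (l u v : R) : 0 < l -> l <= u -> l <= v ->
  `|Num.sqrt u - Num.sqrt v| <= (Num.sqrt l)^-1 * `|u - v|.
Proof.
move=> l0 lu lv; have u0 := lt_le_trans l0 lu; have v0 := lt_le_trans l0 lv.
have sl : 0 < Num.sqrt l by rewrite sqrtr_gt0.
rewrite mulrC ler_pdivlMr// -[in leRHS](sqr_sqrtr (ltW u0)) -[in leRHS](sqr_sqrtr (ltW v0)).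
rewrite subr_sqr normrM; apply: ler_wpM2l => //.
rewrite ger0_norm ?addr_ge0 ?sqrtr_ge0//; apply: ler_wpDr; first exact: sqrtr_ge0.
exact: ler_wsqrtr.
Qed.

Lemma ln_lipschitz (l u v : R) : 0 < l -> l <= u -> l <= v ->
  `|ln u - ln v| <= l^-1 * `|u - v|.
Proof.
move=> l0; have H x y : l <= x -> l <= y -> ln x - ln y <= l^-1 * `|x - y|.
  move=> lx ly; have x0 := lt_le_trans l0 lx; have y0 := lt_le_trans l0 ly.
  rewrite -ln_div ?posrE//; apply: le_trans (ln_le_sub1 _) _; first by rewrite divr_gt0.
  rewrite (_ : x / y - 1 = y^-1 * (x - y)); last by field; rewrite gt_eqF.
  apply: (@le_trans _ _ (y^-1 * `|x - y|)).
    by apply: ler_wpM2l; [rewrite invr_ge0 ltW|exact: ler_norm].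
  by apply: ler_wpM2r => //; rewrite lef_pV2.
move=> lu lv; rewrite ler_norml; apply/andP; split; last exact: H.
by rewrite lerNl opprB distrC; exact: H.
Qed.

Lemma inv_lipschitz (l u v : R) : 0 < l -> l <= u -> l <= v ->
  `|u^-1 - v^-1| <= l ^- 2 * `|u - v|.
Proof.
move=> l0 lu lv; have u0 := lt_le_trans l0 lu; have v0 := lt_le_trans l0 lv.
rewrite (_ : u^-1 - v^-1 = (u * v)^-1 * (v - u)); last by field; rewrite !gt_eqF.
rewrite normrM distrC; apply: ler_wpM2r => //.
rewrite ger0_norm; last by rewrite invr_ge0 mulr_ge0// ltW.
by rewrite lef_pV2 ?posrE ?mulr_gt0 ?exprn_gt0// expr2; apply: ler_pM => //; exact: ltW.
Qed.

End logarithm_estimates.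

(** * The vector field on boxes *)

Section box_functionals.
Variable R : realType.
Local Notation state := (bool * 'I_2 * R -> R).
Implicit Types y z : state.

(* y (false, i, x) and y (true, i, x) stand for r_i(x) and (r_i u_i)(x). *)
Definition torus_state (y : state) : Prop := forall c i, continuous_torus (fun x => y (c, i, x)).

Definition in_box (l : R) (y : state) : Prop := forall i x,
  l^-1 <= y (false, i, x) <= l /\ `|y (true, i, x)| <= l.

Definition box_state l y := torus_state y /\ in_box l y.

(** A map from the box to [C(T)] that is bounded and Lipschitz in sup norm. The three properties are
    bundled so that they survive products; the vector field is then assembled operation by
    operation. *)
Definition box_functional (l : R) (f : state -> R -> R) : Prop :=
  [/\ forall y, box_state l y -> continuous_torus (f y),
      exists2 B, 0 <= B & forall y, box_state l y -> forall x, `|f y x| <= B &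
      exists2 L, 0 <= L & forall y z C, box_state l y -> box_state l z ->
        (forall p, `|y p - z p| <= C) -> forall x, `|f y x - f z x| <= L * C].

Variable l : R.
Hypothesis l_gt0 : 0 < l.

Lemma close_ge0 y z C : (forall p, `|y p - z p| <= C) -> 0 <= C.
Proof. by move=> /(_ (true, ord0, 0)); exact: le_trans. Qed.

Lemma box_functional_ext f f' : (forall y, box_state l y -> f y =1 f' y) ->
  box_functional l f -> box_functional l f'.
Proof.
move=> E [tf [B B0 HB] [L L0 HL]]; split.
- move=> y by_; have <- : f y = f' y by apply/funext => x; exact: E.
  exact: tf.
- by exists B => // y by_ x; rewrite -E//; exact: HB.
- by exists L => // y z C by_ bz yz x; rewrite -!E//; exact: HL.
Qed.

Lemma box_functional_cst (c : R) : box_functional l (fun _ _ => c).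
Proof.
split; first by move=> y _; exact: torus_cst.
  by exists `|c|.
by exists 0 => // y z C _ _ _ x; rewrite subrr normr0 mul0r.
Qed.

Lemma box_functional_proj c i : box_functional l (fun y x => y (c, i, x)).
Proof.
split; first by move=> y [ty _]; exact: ty.
  exists l; first exact: ltW.
  move=> y [_ by_] x; have [/andP[h1 h2] h3] := by_ i x; case: c => //.
  by rewrite ger0_norm// (le_trans _ h1)// invr_ge0 ltW.
by exists 1 => // y z C _ _ yz x; rewrite mul1r; exact: yz.
Qed.

Lemma box_functionalD f f' : box_functional l f -> box_functional l f' ->
  box_functional l (fun y x => f y x + f' y x).
Proof.
move=> [tf [B B0 HB] [L L0 HL]] [tf' [B' B'0 HB'] [L' L'0 HL']]; split.
- by move=> y by_; apply: torusD; [exact: tf|exact: tf'].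
- exists (B + B'); first exact: addr_ge0.
  by move=> y by_ x; apply: le_trans (ler_normD _ _) _; apply: lerD; [exact: HB|exact: HB'].
- exists (L + L'); first exact: addr_ge0.
  move=> y z C by_ bz yz x; rewrite opprD addrACA mulrDl.
  by apply: le_trans (ler_normD _ _) _; apply: lerD; [exact: HL|exact: HL'].
Qed.

Lemma box_functionalM f f' : box_functional l f -> box_functional l f' ->
  box_functional l (fun y x => f y x * f' y x).
Proof.
move=> [tf [B B0 HB] [L L0 HL]] [tf' [B' B'0 HB'] [L' L'0 HL']]; split.
- by move=> y by_; apply: torusM; [exact: tf|exact: tf'].
- exists (B * B'); first exact: mulr_ge0.
  by move=> y by_ x; rewrite normrM; apply: ler_pM => //; [exact: HB|exact: HB'].
- exists (L * B' + B * L'); first by rewrite addr_ge0// mulr_ge0.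
  move=> y z C by_ bz yz x; have C0 := close_ge0 yz.
  rewrite (_ : _ - _ = (f y x - f z x) * f' y x + f z x * (f' y x - f' z x)); last by ring.
  apply: le_trans (ler_normD _ _) _; rewrite !normrM.
  rewrite (_ : _ * C = L * C * B' + B * (L' * C)); last by ring.
  by apply: lerD; apply: ler_pM => //; [exact: HL|exact: HB'|exact: HB|exact: HL'].
Qed.

Lemma box_functionalZ (c : R) f : box_functional l f -> box_functional l (fun y x => c * f y x).
Proof. by move=> bf; apply: box_functionalM => //; exact: box_functional_cst. Qed.

Lemma box_functionalB f f' : box_functional l f -> box_functional l f' ->
  box_functional l (fun y x => f y x - f' y x).
Proof.
move=> bf bf'; apply: box_functional_ext (box_functionalD bf (box_functionalZ (-1) bf')).
by move=> y _ x; rewrite mulN1r.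
Qed.

Lemma box_functional_translate (c : R) f : box_functional l f ->
  box_functional l (fun y x => f y (x + c)).
Proof.
move=> [tf [B B0 HB] [L L0 HL]]; split.
- by move=> y by_; apply: torus_shift; exact: tf.
- by exists B => // y by_ x; exact: HB.
- by exists L => // y z C by_ bz yz x; exact: HL.
Qed.

Lemma box_functional_norm f : box_functional l f -> box_functional l (fun y x => `|f y x|).
Proof.
move=> [tf [B B0 HB] [L L0 HL]]; split.
- by move=> y by_; apply: torus_norm; exact: tf.
- by exists B => // y by_ x; rewrite normr_id; exact: HB.
- exists L => // y z C by_ bz yz x; apply: le_trans (ler_dist_dist _ _) _; exact: HL.
Qed.

Lemma box_functional_lipschitz (h : R -> R) (m Lh : R) f :
  (forall y, box_state l y -> forall x, m <= f y x) -> 0 <= Lh ->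
  (forall u v, m <= u -> m <= v -> `|h u - h v| <= Lh * `|u - v|) ->
  box_functional l f -> box_functional l (fun y x => h (f y x)).
Proof.
move=> mf Lh0 hL [tf [B B0 HB] [L L0 HL]]; split.
- by move=> y by_; apply: (torus_lipschitz (tf y by_) (mf y by_) hL).
- exists (`|h m| + Lh * (B + `|m|)); first by rewrite addr_ge0// mulr_ge0// addr_ge0.
  move=> y by_ x; rewrite -[X in `|X|](subrK (h m)) addrC.
  apply: le_trans (ler_normD _ _) _; rewrite lerD2l.
  apply: le_trans (hL _ _ (mf y by_ x) (lexx _)) _; apply: ler_wpM2l => //.
  by apply: le_trans (ler_normB _ _) _; rewrite lerD2r; exact: HB.
- exists (Lh * L); first exact: mulr_ge0.
  move=> y z C by_ bz yz x; apply: le_trans (hL _ _ (mf y by_ x) (mf z bz x)) _.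
  by rewrite -mulrA; apply: ler_wpM2l => //; exact: HL.
Qed.

Lemma box_functional_convolution A h f : bump A h -> 0 <= A ->
  box_functional l f -> box_functional l (fun y x => convolution (f y) h x).
Proof.
move=> bh A0 [tf [B B0 HB] [L L0 HL]]; have [C C0 HC] := bump_bounded bh; split.
- by move=> y by_; apply: (torus_convolution (tf y by_) bh A0).
- exists (C * (B * (2 * A))); first by rewrite !mulr_ge0.
  move=> y by_ x; exact: (norm_convolution_le_cst x (tf y by_).2 bh A0 (HB y by_) HC).
- exists (C * (L * (2 * A))); first by rewrite !mulr_ge0.
  move=> y z D by_ bz yz x.
  have cy := (tf y by_).2; have cz := (tf z bz).2.
  rewrite (convolutionB _ cy cz bh A0) (_ : _ * D = C * ((L * D) * (2 * A))); last by ring.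
  apply: norm_convolution_le_cst => //; last exact: HL.
  by move=> u; apply: cvgB; [exact: cy|exact: cz].
Qed.

End box_functionals.

Section vector_field.
Variables (R : realType) (K b : 'I_2 -> R) (g : R).
Hypothesis K_gt0 : forall i, 0 < K i.
Hypothesis b_gt0 : 0 < b ord0 - b ord_max.
Variables (phi : R -> R) (beta gamma N : R).
Hypothesis phi_test : test_function phi.
Local Notation state := (bool * 'I_2 * R -> R).

Definition density (y : state) (i : 'I_2) (x : R) : R := y (false, i, x).
Definition momentum (y : state) (i : 'I_2) (x : R) : R := y (true, i, x).

Definition vfield (eps : R) (y : state) : state := fun p =>
  let: (c, i, x) := p in
  let u := velocity (density y i) (momentum y i) in
  if c then upwind eps (momentum y i) u x
            - density y i x * derive1 (Phi K b phi gamma N eps (density y) i) x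
            + g * density y i x
  else upwind eps (density y i) u x + eps `^ beta.

Variables (eps l : R).
Hypothesis eps_gt0 : 0 < eps.
Hypothesis l_gt0 : 0 < l.

Lemma box_gt0 y i x : in_box l y -> 0 < density y i x.
Proof.
by move=> /(_ i x)[/andP[h _] _]; apply: lt_le_trans h; rewrite invr_gt0.
Qed.

(** In the form [rhoE] the only nonlinearity is the square root of the discriminant, which is at
    least [d0] on the box; no bound on [alpha] or [1 - alpha] is required. *)
Lemma box_functional_rho i : box_functional l (fun y x => rho K b (fun j => density y j x) i).
Proof.
pose d0 := 4 * (b ord0 - b ord_max) * (K ord_max * l^-1).
have d00 : 0 < d0 by rewrite !mulr_gt0// invr_gt0.
have dsc : box_functional l (fun y x => disc K b (fun j => density y j x)).
  rewrite /disc; have pr c i := box_functional_proj l_gt0 c i.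
  apply: box_functionalD; last by do 2 apply: box_functionalZ; exact: pr.
  have h : box_functional l (fun y x => K ord0 * density y ord0 x +
      K ord_max * density y ord_max x - (b ord0 - b ord_max)).
    apply: box_functionalB; last exact: box_functional_cst.
    by apply: box_functionalD; apply: box_functionalZ; exact: pr.
  exact: (box_functionalM h h).
have sq : box_functional l (fun y x => Num.sqrt (disc K b (fun j => density y j x))).
  apply: (box_functional_lipschitz (m := d0) (Lh := (Num.sqrt d0)^-1)) dsc.
  - move=> y [_ by_] x; apply: disc_ge => // [j|]; first exact: box_gt0.
    by have [/andP[]] := by_ ord_max x.
  - by rewrite invr_ge0 sqrtr_ge0.
  - by move=> u v; exact: sqrt_lipschitz.
have pr c i := box_functional_proj l_gt0 c i.
have := box_functionalM (box_functionalD (box_functionalD (box_functionalD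
  (box_functionalZ (K ord0) (pr false ord0)) (box_functionalZ (K ord_max) (pr false ord_max)))
  (box_functional_cst l ((if i == ord0 then 1 else -1) * (b ord0 - b ord_max)))) sq)
  (box_functional_cst l (2 * K i)^-1).
apply: box_functional_ext => y [_ by_] x.
by rewrite rhoE// => j; exact: box_gt0.
Qed.

Lemma box_functional_log i : box_functional l (fun y x =>
  ln (rho K b (fun j => density y j x) i + eps `^ N)).
Proof.
have eN : 0 < eps `^ N by exact: powR_gt0.
apply: (box_functional_lipschitz (h := @ln R) (m := eps `^ N) (Lh := (eps `^ N)^-1)).
- move=> y [_ by_] x; rewrite lerDr ltW// rho_gt0// => j; exact: box_gt0.
- by rewrite invr_ge0 ltW.
- by move=> u v; exact: ln_lipschitz.
- by apply: box_functionalD; [exact: box_functional_rho|exact: box_functional_cst].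
Qed.

Lemma mollifier_bump_eps : exists2 A, 0 < A & bump A phi /\
  bump (A * eps `^ gamma) (mollifier phi (eps `^ gamma)).
Proof.
have [A A0 bp] := test_function_bump phi_test; exists A => //; split=> //.
by apply: mollifier_bump => //; exact: powR_gt0.
Qed.

Lemma derive1_Phi y i x : box_state l y -> derive1 (Phi K b phi gamma N eps (density y) i) x =
  K i * convolution (fun x => ln (rho K b (fun j => density y j x) i + eps `^ N))
    (derive1 (mollifier phi (eps `^ gamma))) x.
Proof.
move=> by_; have [A A0 [bp bm]] := mollifier_bump_eps.
have A'0 : 0 <= A * eps `^ gamma by rewrite mulr_ge0 ?powR_ge0// ltW.
have [tl _ _] := box_functional_log i.
have d := is_derive_convolution x (tl y by_) bm A'0.
by rewrite derive1E; apply: derive_val; exact: is_deriveZ d.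
Qed.

Lemma box_functional_dPhi i : box_functional l (fun y x =>
  derive1 (Phi K b phi gamma N eps (density y) i) x).
Proof.
have [A A0 [bp bm]] := mollifier_bump_eps.
have A'0 : 0 <= A * eps `^ gamma by rewrite mulr_ge0 ?powR_ge0// ltW.
have := box_functionalZ (K i) (box_functional_convolution (bump_derive bm) A'0
  (box_functional_log i)).
by apply: box_functional_ext => y by_ x; rewrite derive1_Phi.
Qed.

Lemma box_functional_velocity i : box_functional l (fun y x =>
  velocity (density y i) (momentum y i) x).
Proof.
have pr c i := box_functional_proj l_gt0 c i.
apply: box_functionalM; first exact: pr.
apply: (box_functional_lipschitz (h := fun u : R => u^-1) (m := l^-1) (Lh := l^-1 ^- 2) _ _ _ (pr false i)).
- by move=> y [_ by_] x; have [/andP[]] := by_ i x.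
- by rewrite invr_ge0 exprn_ge0// invr_ge0 ltW.
- by move=> u v; apply: inv_lipschitz; rewrite invr_gt0.
Qed.

Lemma box_functional_upwind f i : box_functional l f -> box_functional l (fun y x =>
  upwind eps (f y) (velocity (density y i) (momentum y i)) x).
Proof.
move=> bf; have bu := box_functional_velocity i; have bn := box_functional_norm bu.
have b2 := box_functional_cst l (2^-1 : R).
have bp := box_functionalM bf (box_functionalM (box_functionalD bn bu) b2).
have bm := box_functionalM bf (box_functionalM (box_functionalB bn bu) b2).
apply: box_functionalZ; apply: box_functionalD; last exact: box_functional_translate bm.
apply: box_functionalB; first exact: (box_functional_translate (- eps) bp).
exact: box_functionalM.
Qed.

Lemma box_functional_vfield c i : box_functional l (fun y x => vfield eps y (c, i, x)).
Proof.
have pr c i := box_functional_proj l_gt0 c i.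
case: c => /=.
  apply: box_functionalD; last by apply: box_functionalZ; exact: pr.
  apply: box_functionalB; first by apply: box_functional_upwind; exact: pr.
  by apply: box_functionalM; [exact: pr|exact: box_functional_dPhi].
apply: box_functionalD; last exact: box_functional_cst.
by apply: box_functional_upwind; exact: pr.
Qed.

Lemma vfield_torus y : box_state l y -> torus_state (vfield eps y).
Proof. by move=> by_ c i; have [t _ _] := box_functional_vfield c i; exact: t. Qed.

Lemma index_bound (P : bool -> 'I_2 -> R -> Prop) :
  (forall c i B B', B <= B' -> P c i B -> P c i B') ->
  (forall c i, exists2 B, 0 <= B & P c i B) -> exists2 B, 0 <= B & forall c i, P c i B.
Proof.
move=> Pm Pe; have [B1 ? H1] := Pe true ord0; have [B2 ? H2] := Pe true ord_max.
have [B3 ? H3] := Pe false ord0; have [B4 ? H4] := Pe false ord_max.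
exists (B1 + B2 + B3 + B4); first by rewrite !addr_ge0.
by case=> i; case: (ord2P i) => ->; [apply: Pm H1|apply: Pm H2|apply: Pm H3|apply: Pm H4]; lra.
Qed.

Lemma vfield_bounded : exists2 B, 0 <= B & forall y, box_state l y ->
  forall p, `|vfield eps y p| <= B.
Proof.
have [||B B0 HB] := @index_bound (fun c i B => forall y, box_state l y ->
    forall x, `|vfield eps y (c, i, x)| <= B).
- by move=> c i B B' BB' H y by_ x; apply: le_trans BB'; exact: H.
- by move=> c i; have [_ t _] := box_functional_vfield c i.
- by exists B => // y by_ [[c i] x]; exact: HB.
Qed.

Lemma vfield_lipschitz : exists2 L, 0 <= L & forall y z C, box_state l y -> box_state l z ->
  (forall p, `|y p - z p| <= C) -> forall p, `|vfield eps y p - vfield eps z p| <= L * C.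
Proof.
have [||L L0 HL] := @index_bound (fun c i L => forall y z C, box_state l y ->
    box_state l z -> (forall p, `|y p - z p| <= C) ->
    forall x, `|vfield eps y (c, i, x) - vfield eps z (c, i, x)| <= L * C).
- move=> c i B B' BB' H y z C by_ bz yz x; apply: le_trans (H y z C by_ bz yz x) _.
  by apply: ler_wpM2r => //; exact: close_ge0 yz.
- by move=> c i; have [_ _ t] := box_functional_vfield c i.
- by exists L => // y z C by_ bz yz [[c i] x]; exact: HL.
Qed.

End vector_field.

(** * A priori estimates *)

Section potential_bounds.
Variables (R : realType) (K b : 'I_2 -> R) (g : R).
Hypothesis K_gt0 : forall i, 0 < K i.
Hypothesis b_gt0 : 0 < b ord0 - b ord_max.
Variables (phi : R -> R) (beta gamma N : R).
Hypothesis phi_test : test_function phi.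
Hypothesis gamma_gt0 : 0 < gamma.
Hypothesis N_ge0 : 0 <= N.
Local Notation state := (bool * 'I_2 * R -> R).
Local Notation period := (2 * pi : R).

Definition mass (y : state) (i : 'I_2) : R := Int (density y i) 0 period.

Lemma mass_ge0 y i : torus_state y -> (forall x, 0 <= density y i x) -> 0 <= mass y i.
Proof.
move=> ty y0; apply: Int_ge0; [exact: (ty false i).2|exact: ltW (period_gt0 R)|].
by move=> x _; exact: y0.
Qed.

Lemma powRN_ge1 (e p : R) : 0 < e <= 1 -> 0 <= p -> 1 <= e `^ (- p).
Proof.
move=> e01 p0; rewrite powRN invf_ge1 ?powR_le1//.
by apply: powR_gt0; case/andP: e01.
Qed.

(** Integrates [ln_shift_le] with the linear upper bound on [rho], the window being covered by [n]
    periods. Masses control only an integral of the logarithm, not its sup. The constant is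
    independent of [eps] and of the box. *)
Lemma log_Int_bound (p D : R) : 0 < p -> 0 <= D -> exists2 C : R, 0 <= C &
  forall (eps l : R) y i x, 0 < eps <= 1 -> 0 < l -> box_state l y ->
  Int (fun x => `|ln (rho K b (fun j => density y j x) i + eps `^ N)|) (x - D) (x + D)
  <= C * eps `^ (- p) * (1 + (mass y ord0 + mass y ord_max)).
Proof.
move=> p0 D0; pose n := Num.bound (2 * D / period).
have nD : 2 * D <= period *+ n.
  rewrite -[leRHS]mulr_natl -ler_pdivrMr ?period_gt0//; apply/ltW/archi_boundP.
  by apply: divr_ge0; [exact: mulr_ge0|exact: ltW (period_gt0 R)].
have [B BE] : exists B, B = b ord0 - b ord_max by exists (b ord0 - b ord_max).
have B0 : 0 <= B by rewrite BE ltW.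
have [M ME] : exists M, M = (K ord0)^-1 + (K ord_max)^-1.
  by exists ((K ord0)^-1 + (K ord_max)^-1).
have k0 := ltW (K_gt0 ord0); have k1 := ltW (K_gt0 ord_max).
have n0 : 0 <= n%:R :> R by [].
have ik0 : 0 < (K ord0)^-1 by rewrite invr_gt0.
have ik1 : 0 < (K ord_max)^-1 by rewrite invr_gt0.
have M0 : 0 <= M by rewrite ME addr_ge0// ltW.
pose C := M * (n%:R * (K ord0 + K ord_max) + 2 * D * B) + 2 * D * (N / p).
have Np : 0 <= N / p by rewrite divr_ge0// ltW.
have K01 : 0 <= K ord0 + K ord_max by exact: addr_ge0.
have DB : 0 <= 2 * D * B by apply: mulr_ge0 => //; exact: mulr_ge0.
have nK : 0 <= n%:R * (K ord0 + K ord_max) by exact: mulr_ge0.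
have C0 : 0 <= C.
  by apply: addr_ge0; apply: mulr_ge0 => //; [exact: addr_ge0|exact: mulr_ge0].
exists C => // eps l y i x e01 l0 by_; have [ty yl] := by_.
have e0 : 0 < eps by case/andP: e01.
have y0 j z : 0 < density y j z by exact: (box_gt0 l0 _ _ yl).
have y0' j z : 0 <= density y j z by exact: ltW.
have m0 := mass_ge0 ty (y0' ord0); have m1 := mass_ge0 ty (y0' ord_max).
have c0 := (ty false ord0).2; have c1 := (ty false ord_max).2.
set e := eps `^ (- p); have e1 : 1 <= e by apply: powRN_ge1 => //; exact: ltW.
have Mi : (K i)^-1 <= M by case: (ord2P i) => ->; rewrite ME; lra.
have ki := K_gt0 i.
have cz (f : R -> R) : continuous f -> forall k : R, continuous (fun x => k * f x).
  by move=> cf k; apply: continuous_mul => //; exact: continuous_const.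
pose F z := M * (K ord0 * density y ord0 z + K ord_max * density y ord_max z) +
  (M * B + N / p * e).
have cF1 : continuous (fun z => K ord0 * density y ord0 z + K ord_max * density y ord_max z).
  by move=> z; apply: cvgD; apply: cz.
have cF2 : continuous (fun z => M * (K ord0 * density y ord0 z + K ord_max * density y ord_max z)).
  exact: cz.
have cF : continuous F by move=> z; apply: cvgD; [exact: cF2|exact: cvg_cst].
have [tl _ _] := box_functional_log K_gt0 b_gt0 N e0 l0 i.
have DD : x - D <= x + D by lra.
apply: (@le_trans _ _ (Int F (x - D) (x + D))).
  apply: le_Int => //; first by apply: continuous_norm; exact: (tl y by_).2.
  move=> z _; have sz j : 0 < density y j z by [].
  have [_ ru] := rho_bounds K_gt0 b_gt0 i sz.
  apply: le_trans (ln_shift_le e01 N_ge0 (rho_gt0 K_gt0 b_gt0 i sz) p0) _.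
  rewrite -/e /F addrA lerD2r -mulrDr.
  rewrite -BE in ru; set X := _ + B in ru *; apply: (@le_trans _ _ ((K i)^-1 * X)).
    by rewrite mulrC ler_pdivlMr// mulrC.
  apply: ler_wpM2r => //; rewrite /X; apply: addr_ge0 => //.
  by apply: addr_ge0; apply: mulr_ge0; rewrite ?ltW.
have -> : Int F (x - D) (x + D) = M * (K ord0 * Int (density y ord0) (x - D) (x + D) +
    K ord_max * Int (density y ord_max) (x - D) (x + D)) + (M * B + N / p * e) * (2 * D).
  rewrite IntD//; last exact: continuous_const.
  rewrite IntZ// IntD; [|exact: cz|exact: cz].
  by rewrite !IntZ// Int_cst; congr (_ + _ * _); ring.
have H j : Int (density y j) (x - D) (x + D) <= n%:R * mass y j.
  by apply: Int_le_periods => //; [exact: (ty false j)|lra].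
have h0 := H ord0; have h1 := H ord_max.
set S := 1 + _.
have S1 : 1 <= S by rewrite /S; lra.
apply: (@le_trans _ _ (M * (n%:R * (K ord0 + K ord_max)) * (e * S) +
   M * (2 * D * B) * (e * S) + 2 * D * (N / p) * (e * S))); last first.
  by rewrite /C le_eqVlt; apply/orP; left; apply/eqP; ring.
have eS : e <= e * S by rewrite ler_peMr//; lra.
have eS1 : 1 <= e * S by apply: le_trans eS.
have mS : mass y ord0 + mass y ord_max <= e * S.
  apply: (@le_trans _ _ S); first by rewrite /S; lra.
  by rewrite ler_peMl//; lra.
have t1 : M * (K ord0 * Int (density y ord0) (x - D) (x + D) +
    K ord_max * Int (density y ord_max) (x - D) (x + D)) <= M * (n%:R * (K ord0 + K ord_max)) * (e * S).
  rewrite -[leRHS]mulrA; apply: ler_wpM2l => //.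
  apply: (@le_trans _ _ (n%:R * (K ord0 + K ord_max) * (mass y ord0 + mass y ord_max))).
    have u1 := ler_wpM2l k0 h0; have u2 := ler_wpM2l k1 h1.
    have u3 : 0 <= n%:R * K ord0 * mass y ord_max by apply: mulr_ge0 => //; exact: mulr_ge0.
    have u4 : 0 <= n%:R * K ord_max * mass y ord0 by apply: mulr_ge0 => //; exact: mulr_ge0.
    have -> : n%:R * (K ord0 + K ord_max) * (mass y ord0 + mass y ord_max) =
      K ord0 * (n%:R * mass y ord0) + K ord_max * (n%:R * mass y ord_max) +
      n%:R * K ord0 * mass y ord_max + n%:R * K ord_max * mass y ord0 by ring.
    lra.
  exact: ler_wpM2l.
have t2 : M * B * (2 * D) <= M * (2 * D * B) * (e * S).
  rewrite (_ : M * B * _ = M * (2 * D * B)); last by ring.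
  by rewrite ler_peMr//; exact: mulr_ge0.
have t3 : N / p * e * (2 * D) <= 2 * D * (N / p) * (e * S).
  rewrite (_ : N / p * e * _ = 2 * D * (N / p) * e); last by ring.
  by apply: ler_wpM2l => //; apply: mulr_ge0 => //; exact: mulr_ge0.
rewrite (mulrDl (M * B)) -[leRHS]addrA; apply: lerD => //; exact: lerD.
Qed.

(** The derivative is put on the mollifier, whose derivative is at most [C2 / eta^2] with
    [eta = eps^gamma]; the integral of the logarithm costs the third factor [eps^(- gamma)]. *)
Lemma dPhi_bound : exists2 C : R, 0 <= C &
  forall (eps l : R) y i x, 0 < eps <= 1 -> 0 < l -> box_state l y ->
  `|derive1 (Phi K b phi gamma N eps (density y) i) x|
  <= C * eps `^ (- (3 * gamma)) * (1 + (mass y ord0 + mass y ord_max)).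
Proof.
have [A A0 bp] := test_function_bump phi_test.
have [C1 C10 HC1] := log_Int_bound gamma_gt0 (ltW A0).
have [C2 C20 HC2] := bump_bounded (bump_derive bp).
pose M := K ord0 + K ord_max; have k0 := K_gt0 ord0; have k1 := K_gt0 ord_max.
exists (M * (C2 * C1)); first by rewrite mulr_ge0 ?addr_ge0 ?mulr_ge0// ltW.
move=> eps l y i x e01 l0 by_; have e0 : 0 < eps by case/andP: e01.
rewrite (derive1_Phi K_gt0 b_gt0 gamma N phi_test e0 l0 _ _ by_).
set eta := eps `^ gamma; have eta0 : 0 < eta by exact: powR_gt0.
have eta1 : eta <= 1 by apply: powR_le1 => //; exact: ltW.
(* Since [eta <= 1], the unscaled radius [A] also works, and the window of integration does not
   depend on [eps]. *)
have bm : bump A (derive1 (mollifier phi eta)).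
  apply: bump_derive; have [d h] := mollifier_bump bp eta0; split=> // z Az; apply: h.
  by apply: le_lt_trans Az; rewrite ler_piMr// ltW.
have hb z : `|derive1 (mollifier phi eta) z| <= eta ^- 2 * C2.
  rewrite (derive1_mollifier _ bp) normrM; apply: ler_pM => //.
  rewrite ger0_norm; first by rewrite expr2 invfM lexx.
  by rewrite divr_ge0 ?invr_ge0 ?ltW.
have [tl _ _] := box_functional_log K_gt0 b_gt0 N e0 l0 i.
have tly := tl y by_.
have := norm_convolution_le x tly.2 bm (ltW A0) hb.
have := HC1 eps l y i x e01 l0 by_.
set J := Int _ _ _; set S := 1 + _ => h1 h2.
have S0 : 0 <= S.
  have m0 j : 0 <= mass y j.
    by apply: (mass_ge0 by_.1) => z; apply/ltW; exact: (box_gt0 l0 _ _ by_.2).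
  by have := m0 ord0; have := m0 ord_max; rewrite /S; lra.
have eE : eps `^ (- (3 * gamma)) = eta ^- 2 * eps `^ (- gamma).
  have e00 : eps != 0 by rewrite gt_eqF.
  rewrite /eta -powR_mulrn ?powR_ge0// -powRrM -powRN -powRD ?e00 ?implybT//.
  by congr (_ `^ _); ring.
rewrite normrM (gtr0_norm (K_gt0 i)) eE.
have kM : K i <= M by rewrite /M; case: (ord2P i) => ->; lra.
rewrite (_ : _ * S = M * (eta ^- 2 * C2 * (C1 * eps `^ (- gamma) * S))); last by ring.
apply: ler_pM => //; first exact: ltW.
apply: le_trans h2 _; apply: ler_wpM2l => //.
by rewrite mulr_ge0// invr_ge0 exprn_ge0// ltW.
Qed.

End potential_bounds.

(** * Mass balance and bounds on a given solution *)

Section apriori_estimates.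
Variables (R : realType) (K b : 'I_2 -> R) (g : R).
Variables (phi : R -> R) (beta gamma N : R).
Hypothesis beta_ge0 : 0 <= beta.
Local Notation state := (bool * 'I_2 * R -> R).
Local Notation period := (2 * pi : R).
Variable eps : R.
Hypothesis eps01 : 0 < eps <= 1.
Local Notation F := (vfield K b g phi beta gamma N eps).

Let eps_gt0 : 0 < eps. Proof. by case/andP: eps01. Qed.

(** As [|u|] is the sum of the two one-sided parts of [u], what leaves a point is what its two
    neighbours receive; integrals over a period are invariant under translation. *)
Lemma Int_upwind w u : continuous_torus w -> continuous_torus u ->
  Int (upwind eps w u) 0 period = 0.
Proof.
move=> tw tu; pose a x := w x * ((`|u x| + u x) / 2).
pose c x := w x * ((`|u x| - u x) / 2).
have tn := torus_norm tu; have t2 := torus_cst (2^-1 : R).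
have ta : continuous_torus a by do 2 apply: torusM => //; exact: torusD.
have tc : continuous_torus c by do 2 apply: torusM => //; exact: torusB.
have E : upwind eps w u =1 (fun x => eps^-1 * (a (x + - eps) - (a x + c x) + c (x + eps))).
  by move=> x; rewrite /upwind /a /c; congr (_ * (_ + _)); congr (_ - _); field.
have ta' := torus_shift (- eps) ta; have tc' := torus_shift eps tc.
rewrite (eq_Int _ _ E) IntZ; last by apply: (torusD (torusB ta' (torusD ta tc)) tc').2.
rewrite IntD; [|exact: (torusB ta' (torusD ta tc)).2|exact: tc'.2].
rewrite IntB; [|exact: ta'.2|exact: (torusD ta tc).2].
rewrite IntD; [|exact: ta.2|exact: tc.2].
by rewrite !Int_torus_shift//; ring.
Qed.

(* The values of Y and dY at negative times are irrelevant. *)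
Definition solution_upto (T : R) (r0 u0 : 'I_2 -> R -> R) (Y dY : R -> state) : Prop :=
  [/\ ucurve Y /\ ucurve dY,
      forall t, torus_state (Y t) /\ torus_state (dY t),
      forall (t : R) p, 0 < t -> is_derive t 1 (Y ^~ p) (dY t p),
      forall t, 0 <= t <= T -> (forall p, dY t p = F (Y t) p) /\
                               (forall i x, 0 < density (Y t) i x) &
      forall i x, Y 0 (false, i, x) = r0 i x /\ Y 0 (true, i, x) = r0 i x * u0 i x].

Lemma solution_upto_le S T r0 u0 Y dY : S <= T -> solution_upto T r0 u0 Y dY ->
  solution_upto S r0 u0 Y dY.
Proof.
move=> ST [uY tY dY_ eqY iY]; split=> // t /andP[t0 tS].
by apply: eqY; rewrite t0 (le_trans tS).
Qed.

Lemma torus_state_bounded (y : state) : torus_state y -> exists C, forall p, `|y p| <= C.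
Proof.
move=> ty; have [||C C0 HC] := @index_bound R (fun c i B => forall x, `|y (c, i, x)| <= B).
- by move=> c i B B' BB' H x; apply: le_trans BB'.
- by move=> c i; exact: torus_bounded.
- by exists C => -[[c i] x]; exact: HC.
Qed.

(** A purely qualitative bound from compactness in time. It starts the self-improvement in
    [upwind_positivity] and supplies Lipschitz constants; the quantitative estimates do not retain
    [l]. *)
Lemma solution_upto_box T r0 u0 Y dY : 0 <= T -> solution_upto T r0 u0 Y dY ->
  exists2 l : R, 0 < l & forall t, 0 <= t <= T -> box_state l (Y t).
Proof.
move=> T0 [[uY _] tY _ eqY _].
have [C HC] := ucurve_bounded T0 uY (fun t _ => torus_state_bounded (tY t).1).
have ur : ucurve (fun t (p : 'I_2 * R) => Y t (false, p.1, p.2)).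
  by move=> t e e0; have [d d0 Hd] := uY t e e0; exists d => // s st p; exact: Hd.
have [|c c0 Hc] := ucurve_lower_bound T0 ur.
  move=> t tT; have [_ y0] := eqY t tT; have [ty _] := tY t.
  have [c1 c10 H1] := torus_gt0 (ty false ord0) (y0 ord0).
  have [c2 c20 H2] := torus_gt0 (ty false ord_max) (y0 ord_max).
  exists (Num.min c1 c2); first by rewrite lt_min c10.
  by move=> [i x] /=; rewrite ge_min; case: (ord2P i) => ->; rewrite ?H1 ?H2 ?orbT.
exists (c^-1 + `|C|); first by rewrite ltr_pwDl// invr_gt0.
move=> t tT; split; first exact: (tY t).1.
have C1 : C <= c^-1 + `|C|.
  by apply: ler_wpDl (ler_norm C); rewrite invr_ge0 ltW.
move=> i x; split; last by apply: le_trans (HC t tT _) C1.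
apply/andP; split.
  apply: le_trans (Hc t tT (i, x)); rewrite -[leRHS]invrK lef_pV2 ?posrE ?invr_gt0//.
    by rewrite lerDl.
  by rewrite ltr_pwDl// invr_gt0.
by apply: le_trans (ler_norm _) _; apply: le_trans (HC t tT _) C1.
Qed.

Lemma box_velocity_bound l (y : state) i x : 0 < l -> box_state l y ->
  `|velocity (density y i) (momentum y i) x| <= l * l.
Proof.
move=> l0 [_ /(_ i x)[/andP[h1 _] h3]]; rewrite /velocity normrM; apply: ler_pM => //.
have r0 : 0 < density y i x by apply: lt_le_trans h1; rewrite invr_gt0.
rewrite ger0_norm; last by rewrite invr_ge0 ltW.
by rewrite -[leRHS]invrK lef_pV2 ?posrE ?invr_gt0.
Qed.

Lemma torus_velocity l (y : state) i : 0 < l -> box_state l y ->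
  continuous_torus (velocity (density y i) (momentum y i)).
Proof. by move=> l0 by_; have [t _ _] := box_functional_velocity l0 i; exact: t. Qed.

Lemma solution_mass T r0 u0 Y dY i : 0 <= T -> solution_upto T r0 u0 Y dY ->
  mass (Y T) i = mass (Y 0) i + period * eps `^ beta * T.
Proof.
move=> T0 sol; have [l l0 Hl] := solution_upto_box T0 sol.
have [[uY udY] tY dY_ eqY _] := sol; have p0 := ltW (period_gt0 R).
pose y t x := Y t (false, i, x); pose dy t x := dY t (false, i, x).
have uy : ucurve y.
  by move=> t e e0; have [d d0 Hd] := uY t e e0; exists d => // s st x; exact: Hd.
have udy : ucurve dy.
  by move=> t e e0; have [d d0 Hd] := udY t e e0; exists d => // s st x; exact: Hd.
have cy t : continuous (y t) by exact: ((tY t).1 false i).2.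
have cdy t : continuous (dy t) by exact: ((tY t).2 false i).2.
pose G t := mass (Y t) i - period * eps `^ beta * t.
have cG : continuous G.
  move=> t; apply: cvgB; first exact: (continuous_Int_ucurve uy cy p0).
  by apply: cvgM; [exact: cvg_cst|exact: cvg_id].
have dG (t : R) : 0 < t < T -> is_derive t 1 G 0.
  move=> /andP[t0 tT]; have tT' : 0 <= t <= T by rewrite !ltW.
  have d : is_derive t 1 (fun s => mass (Y s) i) (Int (dy t) 0 period).
    apply: (is_derive_Int_param uy udy cy cdy t0) => // s x st.
    by apply: dY_; move: st; rewrite ltr_norml => /andP[]; lra.
  have tw := (tY t).1 false i; have tu := torus_velocity i l0 (Hl t tT').
  have E : Int (dy t) 0 period = period * eps `^ beta.
    have -> : Int (dy t) 0 period = Int (fun x => upwind eps (density (Y t) i)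
        (velocity (density (Y t) i) (momentum (Y t) i)) x + eps `^ beta) 0 period.
      by apply: eq_Int => x; rewrite /dy (eqY t tT').1.
    have [tl _ _] := box_functional_upwind eps l0 i (box_functional_proj l0 false i).
    rewrite IntD; [|exact: (tl _ (Hl t tT')).2|exact: continuous_const].
    by rewrite Int_upwind// add0r Int_cst subr0 mulrC.
  have dl : is_derive t 1 (fun s : R => period * eps `^ beta * s) (period * eps `^ beta).
    rewrite (_ : (fun s : R => _) = (period * eps `^ beta) \*: id)//.
    by apply: is_derive_eq; rewrite /GRing.scale /= mulr1.
  by apply: (is_derive_eq (is_deriveB d dl)); rewrite E subrr.
have : `|G T - G 0| <= 0.
  have c0 : continuous (fun _ : R => 0 : R) by exact: continuous_const.
  have := @le_norm_of_derive R G (fun=> 0) (fun=> 0) (fun=> 0) 0 T T0 cG c0 dG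
    (fun x _ => is_derive_cst 0 x 1).
  by rewrite subrr; apply => x _; rewrite normr0.
rewrite normr_le0 subr_eq0 /G mulr0 subr0 subr_eq => /eqP ->; by [].
Qed.

(* Bounds |u| at time T: its slope in T dominates |g| + sup |dPhi/dx|, as the
   masses are at most I + 2 * period * T. *)
Definition speed (P U I T : R) : R := U + (`|g| + P * (1 + (I + 2 * period * T))) * T.

(** Two passes. The crude velocity bound [V], read off the qualitative box, serves only to prove
    positivity of [(U + p t) r + s q] for [s = 1] and [s = -1]; this yields the velocity bound [W],
    which then replaces [V] in the density bounds. *)
Lemma apriori T r0 u0 Y dY (P U : R) : 0 <= T -> solution_upto T r0 u0 Y dY ->
  0 <= P ->
  (forall l y i x, 0 < l -> box_state l y ->
    `|derive1 (Phi K b phi gamma N eps (density y) i) x| <= P * (1 + (mass y ord0 + mass y ord_max))) ->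
  0 < U -> (forall i x, `|u0 i x| <= U) ->
  let W := speed P U (mass (Y 0) ord0 + mass (Y 0) ord_max) T in
  let m := eps `^ beta / (W / eps) in
  [/\ U <= W,
      forall i x, `|momentum (Y T) i x| <= W * density (Y T) i x,
      forall i x, m + (r0 i x - m) * expR (- (W / eps * T)) <= density (Y T) i x &
      forall i M, 1 <= M -> (forall x, r0 i x <= M) -> forall x,
        density (Y T) i x <= M * expR ((2 * (W / eps) + 1) * T)].
Proof.
move=> T0 sol P0 HP U0 HU W m; have [l l0 Hl] := solution_upto_box T0 sol.
have [[uY udY] tY dY_ eqY iY] := sol; have p0 := ltW (period_gt0 R).
have eb1 : eps `^ beta <= 1 by exact: powR_le1.
have eb0 : 0 <= eps `^ beta by exact: powR_ge0.
pose r i t x := density (Y t) i x; pose q i t x := momentum (Y t) i x.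
pose v i t x := velocity (density (Y t) i) (momentum (Y t) i) x.
pose I := mass (Y 0) ord0 + mass (Y 0) ord_max.
pose p := `|g| + P * (1 + (I + 2 * period * T)).
have zT : (0 : R) <= 0 <= T by apply/andP; split.
have I0 : 0 <= I.
  by apply: addr_ge0; apply: mass_ge0; [exact: (tY 0).1|move=> x; apply/ltW; apply: (eqY 0 zT).2|
    exact: (tY 0).1|move=> x; apply/ltW; apply: (eqY 0 zT).2].
have pT0 : 0 <= 2 * period * T by apply: mulr_ge0 => //; exact: mulr_ge0.
have pp : 0 <= P * (1 + (I + 2 * period * T)) by apply: mulr_ge0 => //; lra.
have p_ge0 : 0 <= p by apply: addr_ge0.
have WE : W = U + p * T by [].
have pT : 0 <= p * T by exact: mulr_ge0.
have W0 : 0 < W by rewrite WE; lra.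
have cr i x : continuous (fun t : R => r i t x).
  exact: (@ucurve_continuous R _ Y (false, i, x) uY).
have cq i x : continuous (fun t : R => q i t x).
  exact: (@ucurve_continuous R _ Y (true, i, x) uY).
have dr i (t : R) x : 0 < t < T ->
    is_derive t 1 (fun t => r i t x) (upwind eps (r i t) (v i t) x + eps `^ beta).
  move=> /andP[t0 tT]; have tT' : 0 <= t <= T by rewrite !ltW.
  by have := dY_ t (false, i, x) t0; rewrite (eqY t tT').1.
pose dPhi i t x := derive1 (Phi K b phi gamma N eps (density (Y t)) i) x.
have dq i (t : R) x : 0 < t < T -> is_derive t 1 (fun t => q i t x)
    (upwind eps (q i t) (v i t) x - r i t x * dPhi i t x + g * r i t x).
  move=> /andP[t0 tT]; have tT' : 0 <= t <= T by rewrite !ltW.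
  by have := dY_ t (true, i, x) t0; rewrite (eqY t tT').1.
have r_gt0 i t x : 0 <= t <= T -> 0 < r i t x by move=> tT; apply: (eqY t tT).2.
have HdPhi i t x : 0 <= t <= T -> `|dPhi i t x| <= p - `|g|.
  move=> tT; have t0 : 0 <= t by case/andP: tT.
  apply: le_trans (HP l (Y t) i x l0 (Hl t tT)) _.
  rewrite (_ : p - `|g| = P * (1 + (I + 2 * period * T))); last by rewrite /p; ring.
  apply: ler_wpM2l => //; rewrite lerD2l.
  have tT' : t <= T by case/andP: tT.
  have solt := solution_upto_le tT' sol.
  rewrite !(solution_mass _ t0 solt) /I.
  have : period * eps `^ beta * t <= period * T.
    rewrite -mulrA; apply: ler_wpM2l => //; apply: le_trans tT'.
    by rewrite ler_piMl.
  by rewrite -mulrA; lra.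
pose V := l * l + 1; have V0 : 0 < V by rewrite ltr_wpDl// mulr_ge0// ltW.
have vV i t x : 0 < t < T -> `|v i t x| <= V.
  move=> /andP[t0 tT]; have tT' : 0 <= t <= T by rewrite !ltW.
  by apply: le_trans (box_velocity_bound i x l0 (Hl t tT')) _; rewrite lerDl.
(* (U + p t) r + s q solves the transport equation with a nonnegative source. *)
have signed (s : R) i t x : `|s| = 1 -> 0 <= t <= T -> 0 <= (U + p * t) * r i t x + s * q i t x.
  move=> s1 tT.
  pose z t x := (U + p * t) * r i t x + s * q i t x.
  pose src t x := p * r i t x + (U + p * t) * eps `^ beta - s * (r i t x * dPhi i t x) +
    s * (g * r i t x).
  have cU : continuous (fun t : R => U + p * t).
    by move=> w; apply: cvgD; [exact: cvg_cst|apply: cvgM; [exact: cvg_cst|exact: cvg_id]].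
  have cz x' : continuous (fun t => z t x').
    move=> w; apply: cvgD; first by apply: cvgM; [exact: cU|exact: cr].
    by apply: cvgM; [exact: cvg_cst|exact: cq].
  have dz (t' : R) x' : 0 < t' < T -> is_derive t' 1 (fun t => z t x')
      (upwind eps (z t') (v i t') x' + src t' x').
    move=> tT'; have d1 := dr i t' x' tT'; have d2 := dq i t' x' tT'.
    have dU : is_derive t' 1 (fun t : R => U + p * t) p.
      rewrite (_ : (fun t : R => _) = cst U + (p \*: id))//.
      by apply: is_derive_eq; rewrite add0r /GRing.scale /= mulr1.
    apply: (is_derive_eq (is_deriveD (is_deriveM dU d1) (is_deriveZ s d2))).
    by rewrite /src /z /GRing.scale /= /upwind; ring.
  have src0 t' x' : 0 < t' < T -> 0 <= src t' x'.
    move=> tT'; have tT2 : 0 <= t' <= T by case/andP: tT' => /ltW -> /ltW ->.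
    have r' := r_gt0 i t' x' tT2; have t'0 : 0 <= t' by case/andP: tT2.
    rewrite (_ : src t' x' = (U + p * t') * eps `^ beta +
      r i t' x' * (p - s * dPhi i t' x' + s * g)); last by rewrite /src; ring.
    apply: addr_ge0; first by apply: mulr_ge0 => //; apply: addr_ge0; [exact: ltW|exact: mulr_ge0].
    apply: mulr_ge0; first exact: ltW.
    have h1 : s * dPhi i t' x' <= p - `|g|.
      by apply: le_trans (ler_norm _) _; rewrite normrM s1 mul1r; exact: HdPhi.
    have h2 : - (s * g) <= `|g|.
      by apply: le_trans (ler_norm _) _; rewrite normrN normrM s1 mul1r.
    by lra.
  have z0 x' : 0 <= z 0 x'.
    rewrite /z /r /q /density /momentum mulr0 addr0 (iY i x').1 (iY i x').2.
    have r' := r_gt0 i 0 x' zT; rewrite /r /density (iY i x').1 in r'.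
    rewrite (_ : _ + _ = r0 i x' * (U + s * u0 i x')); last by ring.
    apply: mulr_ge0; first exact: ltW.
    have : - (s * u0 i x') <= U.
      by apply: le_trans (ler_norm _) _; rewrite normrN normrM s1 mul1r.
    by lra.
  have C0 : 0 <= l by exact: ltW.
  have zC t' x' : 0 <= t' <= T -> - l <= z t' x'.
    move=> tT'; have [_ /(_ i x')[_ h]] := Hl t' tT'.
    have r' := r_gt0 i t' x' tT'; have t'0 : 0 <= t' by case/andP: tT'.
    have h1 : 0 <= (U + p * t') * r i t' x'.
      by apply: mulr_ge0; [apply: addr_ge0; [exact: ltW|exact: mulr_ge0]|exact: ltW].
    have h2 : - (s * q i t' x') <= l.
      by apply: le_trans (ler_norm _) _; rewrite normrN normrM s1 mul1r.
    by rewrite /z; lra.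
  exact: (upwind_positivity eps_gt0 T0 V0 C0 cz dz src0 (vV i) z0 zC x tT).
have qW i t x : 0 <= t <= T -> `|q i t x| <= W * r i t x.
  move=> tT; have t0 : 0 <= t by case/andP: tT.
  have h1 := signed 1 i t x (normr1 _) tT; have h2 := signed (-1) i t x (normrN1 _) tT.
  have r' := r_gt0 i t x tT.
  have h3 : (U + p * t) * r i t x <= W * r i t x.
    apply: ler_wpM2r; first exact: ltW.
    by rewrite WE lerD2l; apply: ler_wpM2l => //; case/andP: tT.
  by rewrite mul1r in h1; rewrite mulN1r in h2; rewrite ler_norml; apply/andP; split; lra.
have vW i t x : 0 < t < T -> `|v i t x| <= W.
  move=> tT; have tT2 : 0 <= t <= T by case/andP: tT => /ltW -> /ltW ->.
  have r' := r_gt0 i t x tT2.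
  rewrite /v /velocity normrM normfV (gtr0_norm r') ler_pdivrMr//.
  exact: qW.
have TT : 0 <= T <= T by rewrite T0 lexx.
split.
- by rewrite WE lerDl.
- by move=> i x; exact: qW.
- move=> i x; have -> : r0 i x = r i 0 x by rewrite /r /density (iY i x).1.
  have rn t x' : 0 <= t <= T -> 0 <= r i t x' by move=> tT; apply/ltW; exact: r_gt0.
  exact: (upwind_lower eps_gt0 T0 W0 (cr i x) (fun t tT => dr i t x tT) (vW i) rn).
- move=> i M M1 rM x.
  have r0M x' : r i 0 x' <= M by rewrite /r /density (iY i x').1.
  have rl t x' : 0 <= t <= T -> r i t x' <= l.
    by move=> tT; have [_ /(_ i x')[/andP[]]] := Hl t tT.
  exact: (upwind_upper eps_gt0 T0 W0 eb1 M1 (ltW l0) (cr i) (dr i) (vW i) rl r0M x).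
Qed.

End apriori_estimates.

(** * Existence and uniqueness *)

Section clipping.
Variable R : realType.

Definition clip (a c x : R) : R := Num.max a (Num.min c x).

Lemma clip_lipschitz a c x y : `|clip a c x - clip a c y| <= `|x - y|.
Proof.
have H u v : u <= v -> `|clip a c u - clip a c v| <= `|u - v|.
  move=> uv; have -> : `|u - v| = v - u by rewrite ler0_norm; [ring|rewrite subr_le0].
  rewrite /clip; case: (leP c u) => ?; case: (leP c v) => ?; case: (leP a c) => ?;
    case: (leP a u) => ?; case: (leP a v) => ?; rewrite ler_norml; apply/andP; split; lra.
by have [/H//|/ltW/H] := leP x y; rewrite distrC (distrC y).
Qed.

Lemma clip_bounds_lipschitz a c a' c' x : `|clip a c x - clip a' c' x| <= `|a - a'| + `|c - c'|.
Proof.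
have h1 := ler_norm (a - a'); have h2 := ler_norm (c - c').
have h3 := ler_norm (a' - a); have h4 := ler_norm (c' - c).
have := normr_ge0 (a - a'); have := normr_ge0 (c - c'); rewrite (distrC a') in h3; rewrite (distrC c') in h4.
move: h1 h2 h3 h4; set A := `|a - a'|; set C := `|c - c'| => *.
rewrite /clip; case: (leP c x) => ?; case: (leP c' x) => ?;
 rewrite ler_norml maxEle maxEle; do 2 case: ifPn; rewrite -?ltNge => *; apply/andP; split; lra.
Qed.

Lemma clip_itv a c x : a <= c -> a <= clip a c x <= c.
Proof. by move=> ac; rewrite /clip le_max lexx ge_max ac ge_min lexx. Qed.

Lemma clip_id a c x : a <= x <= c -> clip a c x = x.
Proof. by move=> /andP[ax xc]; rewrite /clip min_r// max_r. Qed.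

End clipping.

(** Continuous induction through the supremum of the times up to which [P] holds. There is no base
    case: the closedness hypothesis at [t = 0] is vacuous in its premise and already gives [P 0]. *)
Lemma real_induction (R : realType) (P : R -> Prop) :
  (forall t, 0 <= t -> (forall s, 0 <= s < t -> P s) -> P t) ->
  (forall t, 0 <= t -> (forall s, 0 <= s <= t -> P s) ->
     exists2 d, 0 < d & forall s, t < s < t + d -> P s) ->
  forall t, 0 <= t -> P t.
Proof.
move=> Pclosed Popen T T0; apply: contrapT => PT.
pose E := [set t | 0 <= t <= T /\ forall s, 0 <= s <= t -> P s].
have E0 : E 0.
  split; first by rewrite lexx.
  move=> s s0; apply: Pclosed; first by case/andP: s0.
  by move=> u us; exfalso; move: s0 us => /andP[? ?] /andP[? ?]; lra.
have sE : has_sup E by split; [exists 0|exists T => t [/andP[]]].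
pose m := sup E.
have m0 : 0 <= m by apply: ub_le_sup => //; exists T => t [/andP[]].
have mT : m <= T by apply: ge_sup; [exists 0|move=> t [/andP[]]].
have Hlt s : 0 <= s < m -> P s.
  move=> /andP[s0 sm]; have [|e [_ He] se] := @sup_adherent R E (m - s) _ sE; first by rewrite subr_gt0.
  by apply: He; rewrite s0 ltW//; move: se; rewrite -/m; lra.
have Pm := Pclosed m m0 Hlt.
have Hle s : 0 <= s <= m -> P s.
  move=> /andP[s0]; rewrite le_eqVlt => /orP[/eqP -> //|sm].
  by apply: Hlt; rewrite s0.
have [d d0 Hd] := Popen m m0 Hle.
have Tm : m < T.
  rewrite lt_neqAle mT andbT; apply/negP => /eqP E1; apply: PT; rewrite -E1; exact: Pm.
pose t := Num.min T (m + d / 2).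
have tm : t <= m.
  apply: ub_le_sup; first by exists T => u [/andP[]].
  have mt : m <= t by rewrite le_min mT lerDl divr_ge0// ltW.
  split; first by rewrite (le_trans m0 mt) ge_min lexx.
  move=> s /andP[s0 st]; have [sm|ms] := leP s m; first by apply: Hle; rewrite s0.
  apply: Hd; rewrite ms/=; apply: le_lt_trans st _.
  by apply: (@le_lt_trans _ _ (m + d / 2)); [rewrite ge_min lexx orbT|lra].
by move: tm; rewrite ge_min => /orP[]; lra.
Qed.

(** * Uniqueness, and solutions of the clipped system *)

Section wellposedness.
Variables (R : realType) (K b : 'I_2 -> R) (g : R).
Hypothesis K_gt0 : forall i, 0 < K i.
Hypothesis b_gt0 : 0 < b ord0 - b ord_max.
Variables (phi : R -> R) (beta gamma N : R).
Hypothesis phi_test : test_function phi.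
Hypothesis beta_ge0 : 0 <= beta.
Local Notation state := (bool * 'I_2 * R -> R).
Local Notation period := (2 * pi : R).
Variable eps : R.
Hypothesis eps01 : 0 < eps <= 1.
Local Notation F := (vfield K b g phi beta gamma N eps).
Local Notation solution_upto := (solution_upto K b g phi beta gamma N eps).

Let eps_gt0 : 0 < eps. Proof. by case/andP: eps01. Qed.

Lemma box_state_le l l' (y : state) : 0 < l -> l <= l' -> box_state l y -> box_state l' y.
Proof.
move=> l0 ll' [ty yl]; split=> // i x; have [/andP[h1 h2] h3] := yl i x.
have l'0 := lt_le_trans l0 ll'.
split; last exact: le_trans ll'.
by rewrite (le_trans h2 ll') (le_trans _ h1)// lef_pV2.
Qed.

(** Both solutions lie in a common box, where the field is [L]-Lipschitz. Starting from the trivial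
    bound [2 * l], each integration under the weight [e^(2 L t)] halves the bound on the
    difference. *)
Lemma solution_unique T r0 u0 Y dY Z dZ : 0 <= T ->
  solution_upto T r0 u0 Y dY -> solution_upto T r0 u0 Z dZ ->
  forall t p, 0 <= t <= T -> Y t p = Z t p.
Proof.
move=> T0 solY solZ; have [l1 l10 H1] := solution_upto_box T0 solY.
have [l2 l20 H2] := solution_upto_box T0 solZ.
pose l := l1 + l2; have l0 : 0 < l by exact: addr_gt0.
have bY t : 0 <= t <= T -> box_state l (Y t).
  by move=> tT; apply: box_state_le l10 _ (H1 t tT); rewrite lerDl ltW.
have bZ t : 0 <= t <= T -> box_state l (Z t).
  by move=> tT; apply: box_state_le l20 _ (H2 t tT); rewrite lerDr ltW.
have [L0 L00 HL0] := vfield_lipschitz g K_gt0 b_gt0 beta gamma N phi_test eps_gt0 l0.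
pose L := L0 + 1; have Lgt0 : 0 < L by rewrite ltr_wpDl.
have HL y z C : box_state l y -> box_state l z -> (forall p, `|y p - z p| <= C) ->
    forall p, `|F y p - F z p| <= L * C.
  move=> by_ bz yz p; apply: le_trans (HL0 y z C by_ bz yz p) _.
  by apply: ler_wpM2r; [exact: close_ge0 yz|rewrite /L lerDl].
have [[uY udY] tY dY_ eqY iY] := solY; have [[uZ udZ] tZ dZ_ eqZ iZ] := solZ.
have b0 (y : state) p : box_state l y -> `|y p| <= l.
  move=> [_ yl]; case: p => [[c i] x]; have [/andP[h1 h2] h3] := yl i x; case: c => //.
  by rewrite ger0_norm// (le_trans _ h1)// invr_ge0 ltW.
have init p : Y 0 p = Z 0 p.
  by case: p => [[[] i] x]; [rewrite (iY i x).2 (iZ i x).2|rewrite (iY i x).1 (iZ i x).1].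
suff H n t p : 0 <= t <= T -> `|Y t p - Z t p| <= 2 * l / 2 ^+ n * expR (2 * L * t).
  move=> t p tT; apply/eqP; rewrite -subr_eq0 -normr_le0.
  apply: (@halving_eq0 _ _ (2 * l * expR (2 * L * t))) => n.
  by rewrite mulrAC; exact: H.
elim: n t p => [|n IHn] t p tT; have /andP[t0 tT'] := tT.
  rewrite expr0 divr1; apply: (@le_trans _ _ (2 * l)).
    by apply: le_trans (ler_normB _ _) _; have := b0 _ p (bY t tT); have := b0 _ p (bZ t tT); lra.
  rewrite ler_peMr//; first by apply: mulr_ge0 => //; exact: ltW.
  rewrite -[leLHS]expR0 ler_expR; apply: mulr_ge0 => //; apply: mulr_ge0 => //; exact: ltW.
pose D s := Y s p - Z s p.
have D0 : D 0 = 0 by rewrite /D init subrr.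
have cD : continuous D.
  have c1 := @ucurve_continuous R _ Y p uY; have c2 := @ucurve_continuous R _ Z p uZ.
  by move=> s; apply: cvgB; [exact: c1|exact: c2].
have dD (s : R) : 0 < s < t -> is_derive s 1 D (F (Y s) p - F (Z s) p).
  move=> /andP[s0 st]; have sT : 0 <= s <= T by rewrite !ltW// (lt_le_trans st).
  have d1 := dY_ s p s0; have d2 := dZ_ s p s0.
  by rewrite (eqY s sT).1 in d1; rewrite (eqZ s sT).1 in d2; exact: is_deriveB.
have bD (s : R) : 0 < s < t -> `|F (Y s) p - F (Z s) p| <=
    (2 * l / 2 ^+ n.+1) * (2 * L) * expR (2 * L * s).
  move=> /andP[s0 st]; have sT : 0 <= s <= T by rewrite !ltW// (lt_le_trans st).
  apply: le_trans (HL _ _ _ (bY s sT) (bZ s sT) (fun q => IHn s q sT) p) _.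
  rewrite exprS le_eqVlt; apply/orP; left; apply/eqP; field.
  by rewrite expf_neq0.
have c0 : 0 <= 2 * l / 2 ^+ n.+1.
  by apply: divr_ge0; [apply: mulr_ge0 => //; exact: ltW|exact: exprn_ge0].
by have := exp_increment_le t0 c0 cD dD bD; rewrite D0 subr0.
Qed.

Definition trunc (l : R) (y : state) : state := fun p =>
  if p.1.1 then clip (- l) l (y p) else clip l^-1 l (y p).

Lemma trunc_box l y : 1 <= l -> torus_state y -> box_state l (trunc l y).
Proof.
move=> l1 ty; have l0 : 0 < l by lra.
have il : l^-1 <= l by rewrite (le_trans _ l1)// invf_le1.
split; last first.
  move=> i x; split; first exact: clip_itv.
  by rewrite ler_norml; apply: clip_itv; lra.
move=> c i; have [C C0 HC] := torus_bounded (ty c i).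
have lb x : - C <= y (c, i, x) by have := HC x; rewrite ler_norml => /andP[].
case: c ty HC lb => ty HC lb.
  by apply: (torus_lipschitz (h := clip (- l) l) (l := - C) (L := 1) (ty true i) lb) => u v _ _;
    rewrite mul1r; exact: clip_lipschitz.
by apply: (torus_lipschitz (h := clip l^-1 l) (l := - C) (L := 1) (ty false i) lb) => u v _ _;
  rewrite mul1r; exact: clip_lipschitz.
Qed.

Lemma trunc_id l y : in_box l y -> trunc l y = y.
Proof.
move=> yl; apply/funext => -[[c i] x]; rewrite /trunc /=.
have [h1 h2] := yl i x; case: c; apply: clip_id => //.
by rewrite -ler_norml.
Qed.

Lemma trunc_lipschitz l y z C : (forall p, `|y p - z p| <= C) ->
  forall p, `|trunc l y p - trunc l z p| <= C.
Proof.
move=> yz p; apply: le_trans (yz p); rewrite /trunc.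
by case: ifP => _; exact: clip_lipschitz.
Qed.

(** The clipping box moves with time, so continuity of the clipped field in time rests on this. Each
    of the two clipping bounds contributes one [|l - l'|]; for [l^-1] this uses that both levels are
    at least 1. *)
Lemma trunc_level_lipschitz l l' y p : 1 <= l -> 1 <= l' ->
  `|trunc l y p - trunc l' y p| <= 2 * `|l - l'|.
Proof.
move=> l1 l'1; rewrite /trunc mulr2n mulrDl !mul1r; case: ifP => _.
  by apply: le_trans (clip_bounds_lipschitz _ _ _ _ _) _; rewrite -opprD normrN lexx.
apply: le_trans (clip_bounds_lipschitz _ _ _ _ _) _; rewrite lerD2r.
have := inv_lipschitz (@ltr01 R) l1 l'1.
by rewrite expr1n invr1 mul1r.
Qed.

Section truncated_existence.
Variables (lam : R -> R) (y0 : state).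
Hypothesis lam_ge1 : forall t, 0 <= t -> 1 <= lam t.
Hypothesis lam_homo : forall s t, 0 <= s -> s <= t -> lam s <= lam t.
Hypothesis lam_continuous : continuous lam.
Hypothesis y0_torus : torus_state y0.

Let G t y := F (trunc (lam t) y).

(** Monotonicity of [lam] puts every state clipped before time [T] in the box of size [lam T], so
    the bounds of the field there are uniform on [[0, T]], as [picard] asks. *)
Lemma truncated_solution : exists Y dY : R -> state,
  [/\ ucurve Y /\ ucurve dY, forall t, torus_state (Y t) /\ torus_state (dY t),
      forall (t : R) p, is_derive t 1 (Y ^~ p) (dY t p),
      forall t p, 0 <= t -> dY t p = F (trunc (lam t) (Y t)) p &
      forall p, Y 0 p = y0 p].
Proof.
have tb t y : 0 <= t -> torus_state y -> box_state (lam t) (trunc (lam t) y).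
  by move=> t0 ty; apply: trunc_box => //; exact: lam_ge1.
have lam0 t : 0 <= t -> 0 < lam t by move=> /lam_ge1; exact: lt_le_trans.
have tbT t T y : 0 <= t <= T -> torus_state y -> box_state (lam T) (trunc (lam t) y).
  move=> /andP[t0 tT] ty; apply: box_state_le (lam0 t t0) (lam_homo t0 tT) (tb t y t0 ty).
have S_closed (y : state) : (forall e : R, 0 < e -> exists2 u : state, torus_state u &
    forall p, `|u p - y p| <= e) -> torus_state y.
  move=> H c i; split=> [x|].
    apply/eqP; rewrite -subr_eq0 -normr_le0; apply/ler_addgt0Pr => e e0; rewrite add0r.
    have [|u tu uy] := H (e / 2); first by rewrite divr_gt0.
    have := uy (c, i, x); have := uy (c, i, x + period); rewrite (tu c i).1.
    by rewrite !ler_norml => /andP[? ?] /andP[? ?]; apply/andP; split; lra.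
  apply/continuousP_eps => x e e0; have e3 : 0 < e / 3 by rewrite divr_gt0.
  have [u tu uy] := H _ e3.
  have [d d0 Hd] := (continuousP_eps _).1 (tu c i).2 x _ e3.
  exists d => // z /Hd; have := uy (c, i, x); have := uy (c, i, z).
  by rewrite !ler_norml => /andP[? ?] /andP[? ?] /andP[? ?]; apply/andP; split; lra.
have S_Int (h : R -> state) y t : ucurve h -> (forall s, torus_state (h s)) -> torus_state y ->
    torus_state (fun p => y p + Int (h ^~ p) 0 t).
  move=> uh th ty c i; apply: torusD; first exact: ty.
  split=> [x|].
    by apply: eq_Int => s; rewrite (th s c i).1.
  apply: (@continuous_Int_param R (fun s x => h s (c, i, x))).
    by move=> s e e0; have [d d0 Hd] := uh s e e0; exists d => // s' s's x; exact: Hd.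
  by move=> s; exact: (th s c i).2.
have S_G (t : R) y : 0 <= t -> torus_state y -> torus_state (G t y).
  move=> t0 ty; exact: (vfield_torus g K_gt0 b_gt0 beta gamma N phi_test eps_gt0 (lam0 t t0) (tb t y t0 ty)).
have G_lip (T : R) : 0 <= T -> exists2 L : R, 0 < L & forall (t : R) y z C, 0 <= t <= T ->
    torus_state y -> torus_state z -> (forall p, `|y p - z p| <= C) ->
    forall p, `|G t y p - G t z p| <= L * C.
  move=> T0; have [L L0 HL] := vfield_lipschitz g K_gt0 b_gt0 beta gamma N phi_test eps_gt0 (lam0 T T0).
  exists (L + 1); first by rewrite ltr_wpDl.
  move=> t y z C tT ty tz yz p.
  apply: le_trans (HL _ _ C (tbT t T y tT ty) (tbT t T z tT tz) (trunc_lipschitz (lam t) yz) p) _.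
  by apply: ler_wpM2r; [exact: close_ge0 yz|rewrite lerDl].
have G_bnd (T : R) : 0 <= T -> exists2 C : R, 0 <= C & forall (t : R) y, 0 <= t <= T ->
    torus_state y -> forall p, `|G t y p| <= C.
  move=> T0; have [C C0 HC] := vfield_bounded g K_gt0 b_gt0 beta gamma N phi_test eps_gt0 (lam0 T T0).
  by exists C => // t y tT ty p; apply: HC; exact: tbT.
have G_cont (t : R) y (e : R) : 0 <= t -> torus_state y -> 0 < e -> exists2 d : R, 0 < d &
    forall s : R, 0 <= s -> `|s - t| < d -> forall p, `|G s y p - G t y p| <= e.
  move=> t0 ty e0; have T0 : 0 <= t + 1 by rewrite addr_ge0.
  have [L L0 HL] := vfield_lipschitz g K_gt0 b_gt0 beta gamma N phi_test eps_gt0 (lam0 _ T0).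
  have L1 : 0 < 2 * (L + 1) by rewrite mulr_gt0// ltr_wpDl.
  have [d d0 Hd] := (continuousP_eps _).1 lam_continuous t _ (divr_gt0 e0 L1).
  exists (Num.min 1 d); first by rewrite lt_min ltr01.
  move=> s s0; rewrite lt_min => /andP[s1 sd] p.
  have sT : 0 <= s <= t + 1.
    by rewrite s0/=; move: s1; rewrite ltr_norml => /andP[_]; lra.
  have tT : 0 <= t <= t + 1 by rewrite t0/=; lra.
  have h q := trunc_level_lipschitz y q (lam_ge1 s0) (lam_ge1 t0).
  apply: le_trans (HL _ _ _ (tbT s _ y sT ty) (tbT t _ y tT ty) h p) _.
  have := Hd s sd; rewrite ler_pdivlMr// => h2; apply: le_trans h2.
  rewrite (_ : _ * (2 * (L + 1)) = L * (2 * `|lam s - lam t|) + 2 * `|lam s - lam t|); last by ring.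
  by rewrite lerDl mulr_ge0.
have [Y [uY tY Y0 dY]] := picard S_closed S_Int S_G G_lip G_bnd G_cont y0_torus.
exists Y, (fun t => G (Num.max 0 t) (Y (Num.max 0 t))); split=> //.
- by split=> //; exact: (ucurve_vector_field G_lip G_cont uY tY).
- by move=> t; split=> //; apply: S_G => //; rewrite le_max lexx.
- by move=> t p t0; rewrite max_r.
Qed.

End truncated_existence.

End wellposedness.

(** * Confinement in the moving box and global solutions *)

Section global_existence.
Variables (R : realType) (K b : 'I_2 -> R) (g : R).
Hypothesis K_gt0 : forall i, 0 < K i.
Hypothesis b_gt0 : 0 < b ord0 - b ord_max.
Variables (phi : R -> R) (beta gamma N : R).
Hypothesis phi_test : test_function phi.
Hypothesis beta_ge0 : 0 <= beta.
Local Notation state := (bool * 'I_2 * R -> R).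
Variable eps : R.
Hypothesis eps01 : 0 < eps <= 1.
Local Notation F := (vfield K b g phi beta gamma N eps).
Local Notation solution_upto := (solution_upto K b g phi beta gamma N eps).
Variable P : R.
Hypothesis P_ge0 : 0 <= P.
Hypothesis HP : forall l (y : state) i x, 0 < l -> box_state l y ->
    `|derive1 (Phi K b phi gamma N eps (density y) i) x| <= P * (1 + (mass y ord0 + mass y ord_max)).
Variables (r0 u0 : 'I_2 -> R -> R).
Hypothesis r0_torus : forall i, continuous_torus (r0 i).
Hypothesis u0_torus : forall i, continuous_torus (u0 i).
Hypothesis r0_gt0 : forall i x, 0 < r0 i x.

Lemma uniform_bound (f : 'I_2 -> R -> R) : (forall i, continuous_torus (f i)) ->
  exists2 C, 1 <= C & forall i x, `|f i x| <= C.
Proof.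
move=> tf; have [C0 C00 H0] := torus_bounded (tf ord0).
have [C1 C10 H1] := torus_bounded (tf ord_max).
exists (1 + (C0 + C1)) => [|i x]; first by rewrite lerDl addr_ge0.
by case: (ord2P i) => ->; [apply: le_trans (H0 x) _|apply: le_trans (H1 x) _]; lra.
Qed.

Lemma uniform_lower_bound (f : 'I_2 -> R -> R) : (forall i, continuous_torus (f i)) ->
  (forall i x, 0 < f i x) -> exists2 c, 0 < c & forall i x, c <= f i x.
Proof.
move=> tf f0; have [c0 c00 H0] := torus_gt0 (tf ord0) (f0 ord0).
have [c1 c10 H1] := torus_gt0 (tf ord_max) (f0 ord_max).
exists (Num.min c0 c1) => [|i x]; first by rewrite lt_min c00.
by rewrite ge_min; case: (ord2P i) => ->; rewrite ?H0 ?H1 ?orbT.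
Qed.

Lemma speed_continuous U I : continuous (speed g P U I).
Proof.
have cc := @continuous_const R; have ci : continuous (@id R) by move=> x; exact: cvg_id.
move=> t; apply: cvgD; first exact: cc.
apply: cvgM; last exact: ci.
apply: cvgD; first exact: cc.
apply: cvgM; first exact: cc.
apply: cvgD; first exact: cc.
apply: cvgD; first exact: cc.
by apply: cvgM; [exact: cc|exact: ci].
Qed.

Lemma speed_homo U I s t : 0 <= I -> 0 <= s -> s <= t -> speed g P U I s <= speed g P U I t.
Proof.
move=> I0 s0 st; rewrite /speed lerD2l.
have p0 := ltW (period_gt0 R).
have h : 0 <= 2 * (2 * pi : R) * s by apply: mulr_ge0 => //; exact: mulr_ge0.
apply: ler_pM => //.
  by apply: addr_ge0 => //; apply: mulr_ge0 => //; lra.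
rewrite lerD2l; apply: ler_wpM2l => //; rewrite !lerD2l.
by apply: ler_wpM2l => //; exact: mulr_ge0.
Qed.

Theorem global_solution : exists Y dY : R -> state,
  (forall (t : R) p, is_derive t 1 (Y ^~ p) (dY t p)) /\
  forall T, 0 <= T -> solution_upto T r0 u0 Y dY.
Proof.
have e0 : 0 < eps by case/andP: eps01.
have [U U1 HU] := uniform_bound u0_torus.
have [M M1 HM] := uniform_bound r0_torus.
have [m m0 Hm] := uniform_lower_bound r0_torus r0_gt0.
have U0 : 0 < U by lra.
have M0 : 0 < M by lra.
have rM i x : r0 i x <= M by apply: le_trans (ler_norm _) (HM i x).
pose y0 : state := fun p => let: (c, i, x) := p in if c then r0 i x * u0 i x else r0 i x.
have ty0 : torus_state y0 by case=> i; [exact: (torusM (r0_torus i) (u0_torus i))|exact: r0_torus].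
pose I := mass y0 ord0 + mass y0 ord_max.
have I0 : 0 <= I by apply: addr_ge0; apply: mass_ge0 => // x; exact: ltW.
pose W t := speed g P U I t.
have UW t : 0 <= t -> U <= W t.
  move=> t0; rewrite /W -[leLHS](_ : speed g P U I 0 = U); first exact: speed_homo.
  by rewrite /speed mulr0 addr0.
pose k t := (2 * (W t / eps) + 1) * t.
(* One quantity dominating all three bounds of [apriori]: [M * e^k] for the density, [W * M * e^k]
   for the momentum and [e^k / m] for the inverse of the density. The rate in [k], chosen for
   growth, also exceeds the decay rate [W / eps]. *)
pose B t := (M + m^-1) * ((1 + W t) * expR (k t)).
(* B t bounds any solution at time t, which therefore cannot leave the box of size 2 B t. *)
pose lam t := 2 * B t.
have Wh s t : 0 <= s -> s <= t -> W s <= W t by exact: speed_homo.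
have W0 t : 0 <= t -> 0 < W t by move=> /UW; exact: lt_le_trans.
have k0 t : 0 <= t -> 0 <= k t.
  move=> t0; apply: mulr_ge0 => //; apply: addr_ge0 => //; apply: mulr_ge0 => //.
  by apply: divr_ge0; apply: ltW => //; exact: W0.
have kh s t : 0 <= s -> s <= t -> k s <= k t.
  move=> s0 st; apply: ler_pM => //.
    apply: addr_ge0 => //; apply: mulr_ge0 => //.
    by apply: divr_ge0; apply: ltW => //; exact: W0.
  rewrite lerD2r; apply: ler_wpM2l => //; apply: ler_wpM2r; last exact: Wh.
  by rewrite invr_ge0 ltW.
have im0 : 0 < m^-1 by rewrite invr_gt0.
have B1 t : 0 <= t -> 1 <= B t.
  move=> t0; have h1 : 1 <= expR (k t) by rewrite -[leLHS]expR0 ler_expR k0.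
  have h2 : 1 <= 1 + W t by rewrite lerDl ltW// W0.
  have h3 : 1 <= M + m^-1 by lra.
  have h4 : 1 <= (1 + W t) * expR (k t) by apply: (le_trans h2); rewrite ler_peMr//; lra.
  by apply: (le_trans h3); rewrite ler_peMr//; lra.
have Bh s t : 0 <= s -> s <= t -> B s <= B t.
  move=> s0 st; apply: ler_wpM2l; first by lra.
  apply: ler_pM; [by have := W0 s s0; lra|exact: expR_ge0| |by rewrite ler_expR kh].
  by rewrite lerD2l Wh.
have lam1 t : 0 <= t -> 1 <= lam t by move=> /B1; rewrite /lam; lra.
have lamh s t : 0 <= s -> s <= t -> lam s <= lam t.
  by move=> s0 st; have := Bh s t s0 st; rewrite /lam; lra.
have lamc : continuous lam.
  have cc := @continuous_const R; have ci : continuous (@id R) by move=> x; exact: cvg_id.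
  have cW : continuous W by exact: speed_continuous.
  have cW1 : continuous (fun t => 1 + W t) by move=> t; apply: cvgD; [exact: cc|exact: cW].
  have ck : continuous k.
    apply: continuous_mul => //.
    move=> t; apply: cvgD; last exact: cc.
    by apply: cvgM; [exact: cc|apply: cvgM; [exact: cW|exact: cc]].
  have ce : continuous (fun t => expR (k t)).
    by move=> t; apply: (@continuous_comp R R R k expR); [exact: ck|exact: continuous_expR].
  apply: continuous_mul; first exact: cc.
  apply: continuous_mul; first exact: cc.
  exact: continuous_mul.
have [Y [dY [uYd tY dY_ eqY iY]]] := truncated_solution g K_gt0 b_gt0 beta gamma N phi_test eps01 lam1 lamh lamc ty0.
have [uY _] := uYd.
have sol T : 0 <= T -> (forall t, 0 <= t <= T -> in_box (lam t) (Y t)) ->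
    solution_upto T r0 u0 Y dY.
  move=> T0 H; split=> //.
  move=> t tT; have t0 : 0 <= t by case/andP: tT.
  split=> [p|i x]; first by rewrite eqY// trunc_id//; exact: H.
  by apply: (box_gt0 _ i x (H t tT)); apply: lt_le_trans (lam1 t t0).
exists Y, dY; split=> // T T0; apply: (sol T T0) => t /andP[t0 _].
(* Induction on the confinement of [Y t] in the box [lam t]. It passes to limits from the left
   because boxes are closed and [lam] is nondecreasing; at [t = 0] it is read off the initial
   data. *)
move: t t0; apply: real_induction => t t0 Ht.
  have [E|tn0] := eqVneq t 0.
    have Y0 : Y 0 = y0 by apply/funext => p; rewrite iY.
    have hW := W0 0 (lexx 0); have hU := UW 0 (lexx 0).
    have l0E : lam 0 = 2 * ((M + m^-1) * (1 + W 0)) by rewrite /lam /B /k mulr0 expR0 mulr1.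
    have q1 : (M + m^-1) <= (M + m^-1) * (1 + W 0) by rewrite ler_peMr//; lra.
    have q2 : M * W 0 <= (M + m^-1) * (1 + W 0) by apply: ler_pM; lra.
    rewrite E => i x; rewrite Y0 /y0; split.
      apply/andP; split; last by apply: le_trans (rM i x) _; rewrite l0E; lra.
      apply: le_trans (Hm i x); rewrite -[leRHS]invrK lef_pV2 ?posrE ?invr_gt0//.
        by rewrite l0E; lra.
      by rewrite l0E; lra.
    apply: (@le_trans _ _ (M * W 0)); last by rewrite l0E; have : 0 <= M * W 0 by [apply: mulr_ge0; apply: ltW]; lra.
    rewrite normrM; apply: ler_pM => //; exact: le_trans (HU i x) hU.
  have t1 : 0 < t by rewrite lt_neqAle eq_sym tn0.
  have near (e : R) : 0 < e -> exists s, [/\ 0 <= s < t, in_box (lam t) (Y s) &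
      forall p, `|Y s p - Y t p| <= e].
    move=> ee0; have [d d0 Hd] := uY t e ee0; pose s := Num.max 0 (t - d / 2).
    have s0 : 0 <= s by rewrite le_max lexx.
    have st : s < t by rewrite gt_max t1/=; lra.
    have sd : t - d / 2 <= s by rewrite le_max lexx orbT.
    exists s; split; first by rewrite s0.
      have ls : 0 < lam s by apply: lt_le_trans (lam1 s s0).
      have lst := lamh s t s0 (ltW st); have s0t : 0 <= s < t by rewrite s0.
      move=> i x; have [/andP[h1 h2] h3] := Ht s s0t i x; split; last exact: le_trans lst.
      rewrite (le_trans h2 lst) andbT (le_trans _ h1)// lef_pV2//.
      by rewrite posrE; apply: lt_le_trans lst.
    by apply: Hd; rewrite ltr_norml; apply/andP; split; lra.
  move=> i x; split; [apply/andP; split|]; apply/ler_addgt0Pr => e ee0;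
    have [s [s0t bs Hs]] := near e ee0; have [/andP[h1 h2] h3] := bs i x;
    have := Hs (true, i, x); have := Hs (false, i, x);
    rewrite !ler_norml => /andP[? ?] /andP[? ?]; try lra.
  by move: h3; rewrite ler_norml => /andP[? ?]; apply/andP; split; lra.
(* Up to time [t] the clipping is inactive, so [Y] solves the true system there and the a priori
   bounds hold at [t] itself. *)
have solt := sol t t0 Ht.
have [_ a1 a2 a3] := apriori beta_ge0 eps01 t0 solt P_ge0 HP U0 HU.
have Y0 : Y 0 = y0 by apply/funext => p; rewrite iY.
rewrite Y0 -/I in a1 a2 a3; rewrite -/(W t) in a1 a2 a3.
have hW := W0 t t0; have Wp : 0 < W t / eps by exact: divr_gt0.
have hB := B1 t t0; have B0 : 0 < B t by lra.
have hk := k0 t t0; have ek : 0 < expR (k t) by exact: expR_gt0.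
have bB i x : [/\ (B t)^-1 <= Y t (false, i, x), Y t (false, i, x) <= B t & `|Y t (true, i, x)| <= B t].
  have r1 := a3 i M M1 (rM i) x; rewrite -/(k t) in r1.
  have Me : 0 <= M * expR (k t) by apply: mulr_ge0; exact: ltW.
  have r2 : M * expR (k t) <= B t.
    rewrite /B mulrA; apply: ler_wpM2r; first exact: ltW.
    apply: (@le_trans _ _ (M * 1)); first by rewrite mulr1.
    by apply: ler_pM; lra.
  have r3 : W t * (M * expR (k t)) <= B t.
    rewrite /B mulrCA mulrA mulrA; apply: ler_wpM2r; first exact: ltW.
    by apply: ler_pM; lra.
  split; last 2 first.
  - exact: le_trans r1 r2.
  - apply: le_trans (a1 i x) _; apply: le_trans r3; apply: ler_wpM2l => //.
    exact: ltW.
  apply: le_trans (a2 i x).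
  set c := eps `^ beta / (W t / eps); set E := expR (- (W t / eps * t)).
  have c0 : 0 <= c by apply: divr_ge0; [exact: powR_ge0|exact: ltW].
  have E0 : 0 < E by exact: expR_gt0.
  have E1 : E <= 1.
    by rewrite -[leRHS]expR0 ler_expR oppr_le0; apply: mulr_ge0 => //; exact: ltW.
  have Ek : (expR (k t))^-1 <= E.
    rewrite -expRN ler_expR lerN2 /k; apply: ler_wpM2r => //; lra.
  apply: (@le_trans _ _ (m * (expR (k t))^-1)).
    rewrite -[leRHS](_ : (m^-1 * expR (k t))^-1 = _); last first.
      by rewrite invfM invrK.
    rewrite lef_pV2 ?posrE//; last exact: mulr_gt0.
    rewrite /B mulrA; apply: ler_wpM2r; first exact: ltW.
    apply: (@le_trans _ _ (m^-1 * 1)); first by rewrite mulr1.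
    by apply: ler_pM; lra.
  (* Here [eps] is fixed, so the initial density provides the lower bound and the nonnegative source
     term [c * (1 - E)] is dropped. The estimate uniform in [eps] will do the opposite. *)
  apply: (@le_trans _ _ (r0 i x * E)).
    by apply: ler_pM => //; rewrite ?invr_ge0; exact: ltW.
  have : 0 <= c * (1 - E) by apply: mulr_ge0 => //; lra.
  by lra.
(* The factor 2 in [lam] leaves this margin: at time [t] the density is at least
   [(B t)^-1 = 2 / lam t], and [B t + 1 / lam t <= lam t] because [1 / lam t <= 1 <= B t]. *)
have d0 : 0 < (lam t)^-1 by rewrite invr_gt0 /lam; lra.
have [d dd0 Hd] := uY t _ d0; exists d => // s /andP[ts sd] i x.
have st : `|s - t| < d by rewrite ltr_norml; apply/andP; split; lra.
have lts : lam t <= lam s by apply: lamh => //; exact: ltW.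
have lt0 : 0 < lam t by rewrite -invr_gt0.
have ls0 := lt_le_trans lt0 lts.
have li : (lam s)^-1 <= (lam t)^-1 by rewrite lef_pV2.
have lB : (B t)^-1 = 2 * (lam t)^-1 by rewrite /lam; field; rewrite gt_eqF.
have l1 : (lam t)^-1 <= 1 by rewrite invf_le1//; exact: lam1.
have [b1 b2 b3] := bB i x.
have := Hd s st (false, i, x); have := Hd s st (true, i, x); move: b3.
rewrite !ler_norml => /andP[? ?] /andP[? ?] /andP[? ?].
have lE : lam t = 2 * B t by [].
by split; apply/andP; split; lra.
Qed.

End global_existence.

(** * Uniform convergence in epsilon form *)

Section uniform_convergence.
Variable R : realType.

Lemma uniform_cvg_epsP (F : set_system R) (FF : Filter F) (f : R -> R -> R) (g : R -> R) :
  {uniform, f @ F --> g} <->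
  (forall e : R, 0 < e -> \forall h \near F, forall x, `|f h x - g x| <= e).
Proof.
split=> [H e e0|H P /uniform_nbhs [E [entE subP]]].
  have : nbhs (g : {uniform R -> R}) [set h : {uniform R -> R} | forall x, `|h x - g x| <= e].
    apply/uniform_nbhs; exists [set xy | ball xy.1 e xy.2]; split.
      by rewrite -entourage_from_ballE; exists e.
    by move=> h hg x; rewrite distrC ltW//; exact: hg.
  by move=> /H.
move: entE; rewrite -entourage_from_ballE => -[e /= e0 eE].
have e20 : 0 < e / 2 by rewrite divr_gt0.
apply: filterS (H _ e20) => h hg; apply: subP => x _; apply: eE => /=.
rewrite /ball /= distrC; apply: le_lt_trans (hg x) _; lra.
Qed.

Lemma within_near_epsP (A : set R) (t : R) (P : R -> Prop) :
  (\forall s \near within A (nbhs t), P s) <->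
  (exists2 d : R, 0 < d & forall s, A s -> `|s - t| < d -> P s).
Proof.
split=> [|[d d0 H]].
  rewrite near_withinE => /nbhs_normP[d /= d0 H]; exists d => // s As st.
  by apply: H => //=; rewrite /ball_ /= distrC.
rewrite near_withinE; apply/nbhs_normP; exists d => //= s; rewrite /ball_ /= distrC => st As.
exact: H.
Qed.

Lemma within_dnbhs_epsP (A : set R) (P : R -> Prop) :
  (\forall s \near within A (0^'), P s) <->
  (exists2 d : R, 0 < d & forall s, A s -> s != 0 -> `|s| < d -> P s).
Proof.
split=> [|[d d0 H]].
  rewrite near_withinE near_withinE => /nbhs_normP[d /= d0 H]; exists d => // s As s0 sd.
  by apply: H => //=; rewrite /ball_ /= sub0r normrN.
rewrite near_withinE near_withinE; apply/nbhs_normP; exists d => //= s.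
by rewrite /ball_ /= sub0r normrN => sd s0 As; exact: H.
Qed.

Lemma C1_torusP (F dF : R -> R -> R) : C1_torus F dF <-> forall t : R, 0 <= t ->
  [/\ continuous_torus (F t), continuous_torus (dF t),
      forall e : R, 0 < e -> exists2 d : R, 0 < d & forall h, 0 <= t + h -> h != 0 -> `|h| < d ->
         forall x, `|h^-1 * (F (t + h) x - F t x) - dF t x| <= e &
      forall e : R, 0 < e -> exists2 d : R, 0 < d & forall s, 0 <= s -> `|s - t| < d ->
         forall x, `|dF s x - dF t x| <= e].
Proof.
split=> H t t0; have [h1 h2 h3 h4] := H t t0; split=> //.
- by move=> e e0; apply/within_dnbhs_epsP; move/uniform_cvg_epsP: h3; exact.
- by move=> e e0; apply/within_near_epsP; move/uniform_cvg_epsP: h4; exact.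
- apply/uniform_cvg_epsP => e e0; apply/within_dnbhs_epsP; exact: h3.
- apply/uniform_cvg_epsP => e e0; apply/within_near_epsP; exact: h4.
Qed.

End uniform_convergence.

(** * Norms on the torus of continuous functions *)

Section torus_norms.
Variable R : realType.
Local Notation period := (2 * pi : R).

Lemma Int_le_norm_torus1 (f : R -> R) (M : R) : continuous f ->
  (norm_torus 1 f <= M%:E)%E -> Int (fun x => `|f x|) 0 period <= M.
Proof.
move=> cf; rewrite /norm_torus Lnorm1 => H.
have cn := continuous_norm cf; have p0 := ltW (period_gt0 R).
have /measurable_EFinP mf := continuous_measurable_fun cn.
have E : (\int[lebesgue_measure]_(x in `[0%R, period]) (`|f x|)%:E =
    \int[torus_measure R]_(x in `[0%R, period[) (`|f x|)%:E)%E.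
  rewrite -integral_itv_bndo_bndc; last exact: measurable_funTS.
  by apply: eq_measure_integral => A mA AD; rewrite /torus_measure /= /mrestr setIidl.
rewrite Int_itv// -lee_fin /Rintegral fineK; last first.
  by apply: integrable_fin_num => //; exact: (continuous_integrable_itv 0 period cn).
rewrite E; apply: le_trans H.
by apply: ge0_subset_integral => //; exact: measurable_itv.
Qed.

(** An essential bound on a continuous function is a bound everywhere: a single violation would
    persist on an interval of positive measure. *)
Lemma le_norm_torus_infty (f : R -> R) (M : R) : continuous_torus f ->
  (norm_torus +oo f <= M%:E)%E -> forall x, `|f x| <= M.
Proof.
move=> [pf cf] H x; rewrite leNgt; apply/negP => Mx.
have [y /andP[y0 yp] E] := period_reduce x; rewrite (E f pf) in Mx.
have dM : 0 < `|f y| - M by rewrite subr_gt0.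
have e0 : 0 < (`|f y| - M) / 2 by rewrite divr_gt0.
have [d d0 Hd] := (continuousP_eps _).1 (continuous_norm cf) y _ e0.
(* [y] may be an endpoint of the period, so the neighbourhood is cut to the interval carrying the
   measure; what is left is still nondegenerate. *)
pose a := Num.max 0 (y - d); pose c := Num.min (y + d) period.
have p0 := period_gt0 R.
have ac : a < c by rewrite /a /c lt_min !gt_max; apply/andP; split; apply/andP; split; lra.
have a0 : 0 <= a by rewrite le_max lexx.
have cp : c <= period by rewrite ge_min lexx orbT.
have ya : y - d <= a by rewrite le_max lexx orbT.
have cy : c <= y + d by rewrite ge_min lexx.
have sub : `]a, c[ `<=` `[0, period[.
  by move=> z /=; rewrite !in_itv/= => /andP[az zc]; apply/andP; split; lra.
have muT : (0 < torus_measure R [set: R])%E.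
  by rewrite /torus_measure /= /mrestr setTI lebesgue_measure_itv/= lte_fin p0 oppr0 adde0 lte_fin.
move: H; rewrite /norm_torus unlock muT => /ess_supP[A [mA A0 HA]].
have : (lebesgue_measure `]a, c[ <= 0)%E.
  rewrite -A0 /torus_measure /= /mrestr; apply: le_measure.
  - by rewrite inE; exact: measurable_itv.
  - by rewrite inE; apply: measurableI => //; exact: measurable_itv.
  move=> z acz; split; last exact: sub.
  apply: HA => /=; apply/negP; rewrite -ltNge lte_fin.
  move: acz; rewrite /= in_itv/= => /andP[az zc].
  have : `|z - y| < d by rewrite ltr_norml; apply/andP; split; lra.
  by move=> /Hd; rewrite ler_norml => /andP[+ _]; lra.
by rewrite lebesgue_measure_itv/= lte_fin ac -EFinB lee_fin leNgt subr_gt0 ac.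
Qed.

End torus_norms.

(** * Solutions in the sense of the statement *)

Section ode_solutions.
Variable R : realType.
Local Notation state := (bool * 'I_2 * R -> R).

Lemma ucurve_index (Y : R -> state) :
  (forall c i, ucurve (fun t x => Y t (c, i, x))) -> ucurve Y.
Proof.
move=> H t e e0.
have [d1 p1 H1] := H true ord0 t e e0; have [d2 p2 H2] := H true ord_max t e e0.
have [d3 p3 H3] := H false ord0 t e e0; have [d4 p4 H4] := H false ord_max t e e0.
exists (Num.min (Num.min d1 d2) (Num.min d3 d4)); first by rewrite !lt_min p1 p2 p3.
move=> s; rewrite !lt_min => /andP[/andP[s1 s2] /andP[s3 s4]] [[c i] x].
by case: c; case: (ord2P i) => ->; [exact: H1|exact: H2|exact: H3|exact: H4].
Qed.

(** Clamping time discards the unspecified values at negative times. Continuity comes from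
    difference quotients bounded near each time by [C + 1]; two-sided derivatives survive at
    positive times only. *)
Lemma C1_torus_ucurve (F dF : R -> R -> R) : C1_torus F dF ->
  [/\ ucurve (fun t => F (Num.max 0 t)), ucurve (fun t => dF (Num.max 0 t)) &
   forall (t : R) x, 0 < t -> is_derive t 1 (fun s => F (Num.max 0 s) x) (dF (Num.max 0 t) x)].
Proof.
move/C1_torusP => H.
have p0 t : 0 <= Num.max 0 t :> R by rewrite le_max lexx.
split.
- move=> t e e0; have [_ tdF H3 _] := H _ (p0 t).
  have [C C0 HC] := torus_bounded tdF; have [d d0 Hd] := H3 1 ltr01.
  have C1 : 0 < C + 1 by rewrite ltr_wpDl.
  exists (Num.min d (e / (C + 1))); first by rewrite lt_min d0 divr_gt0.
  move=> s; rewrite lt_min => /andP[sd se] x.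
  have ps := max0_lipschitz s t; set a := Num.max 0 s; set c := Num.max 0 t.
  have [E|ac] := eqVneq (a - c) 0.
    by move/eqP: E; rewrite subr_eq0 => /eqP ->; rewrite subrr normr0 ltW.
  have h1 : 0 <= c + (a - c) by rewrite addrCA subrr addr0 p0.
  have := Hd (a - c) h1 ac (le_lt_trans ps sd) x; rewrite addrCA subrr addr0.
  set D := F a x - F c x => h2.
  have h3 : `|(a - c)^-1 * D| <= C + 1.
    rewrite -[X in `|X|](subrK (dF c x)); apply: le_trans (ler_normD _ _) _.
    by rewrite addrC lerD.
  have -> : D = (a - c) * ((a - c)^-1 * D) by rewrite mulrA divff// mul1r.
  rewrite normrM; apply: le_trans (ler_pM _ _ ps h3) _ => //.
  by rewrite -ler_pdivlMr// ltW.
- move=> t e e0; have [_ _ _ H4] := H _ (p0 t); have [d d0 Hd] := H4 e e0.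
  exists d => // s sd x; apply: Hd => //; exact: le_lt_trans (max0_lipschitz s t) sd.
- move=> t x t0; apply/is_derive_epsP => e e0.
  have [_ _ H3 _] := H t (ltW t0); have [d d0 Hd] := H3 e e0.
  exists (Num.min d t); first by rewrite lt_min d0.
  move=> k; rewrite lt_min => /andP[kd kt].
  have tk : 0 < t + k by move: kt; rewrite ltr_norml => /andP[]; lra.
  rewrite !max_r ?(ltW tk) ?(ltW t0)//.
  have [->|k0] := eqVneq k 0; first by rewrite addr0 subrr mul0r subrr normr0 mulr0.
  have := Hd k (ltW tk) k0 kd x; set D := F _ x - F t x => h.
  rewrite (_ : D - _ = (k^-1 * D - dF t x) * k); last by rewrite mulrBl mulrAC mulVf// mul1r mulrC.
  by rewrite normrM ler_wpM2r.
Qed.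

Variables (K b : 'I_2 -> R) (g : R) (phi : R -> R) (beta gamma N eps : R).
Variables r0 u0 : 'I_2 -> R -> R.

Lemma ode_solution_solution_upto r q dr dq T :
  ode_solution K b g phi beta gamma N eps r0 u0 r q dr dq ->
  solution_upto K b g phi beta gamma N eps T r0 u0
    (fun t p => let: (c, i, x) := p in
       if c then q i (Num.max 0 t) x else r i (Num.max 0 t) x)
    (fun t p => let: (c, i, x) := p in
       if c then dq i (Num.max 0 t) x else dr i (Num.max 0 t) x).
Proof.
move=> [H1 H2 H3 H4 H5].
have p0 t : 0 <= Num.max 0 t :> R by rewrite le_max lexx.
split.
- split; apply: ucurve_index => -[] i.
  + by have [_ /C1_torus_ucurve[]] := H1 i.
  + by have [/C1_torus_ucurve[]] := H1 i.
  + by have [_ /C1_torus_ucurve[]] := H1 i.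
  + by have [/C1_torus_ucurve[]] := H1 i.
- move=> t; split=> -[] i; have [h1 h2] := H1 i.
  + by have [] := h2 _ (p0 t).
  + by have [] := h1 _ (p0 t).
  + by have [] := h2 _ (p0 t).
  + by have [] := h1 _ (p0 t).
- move=> t [[[] i] x] t0; have [h1 h2] := H1 i.
  + by have [_ _] := C1_torus_ucurve h2; apply.
  + by have [_ _] := C1_torus_ucurve h1; apply.
- move=> t /andP[t0 _]; split.
    by move=> [[[] i] x]; rewrite /vfield /density /momentum max_r//; [rewrite H4|rewrite H3].
  by move=> i x; rewrite /density max_r//; exact: H2.
- by move=> i x; rewrite maxxx; exact: H5.
Qed.

(** The uniform difference quotients required by [C1_torus] come from [ucurve_taylor]; the
    derivatives at every real time cover [t = 0]. *)
Lemma solution_upto_ode_solution (Y dY : R -> state) :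
  (forall (t : R) p, is_derive t 1 (Y ^~ p) (dY t p)) ->
  (forall T, 0 <= T -> solution_upto K b g phi beta gamma N eps T r0 u0 Y dY) ->
  ode_solution K b g phi beta gamma N eps r0 u0
    (fun i t x => Y t (false, i, x)) (fun i t x => Y t (true, i, x))
    (fun i t x => dY t (false, i, x)) (fun i t x => dY t (true, i, x)).
Proof.
move=> dY_ sol.
have [[uY udY] tY _ _ iY] := sol 0 (lexx 0).
have eqY t : 0 <= t -> (forall p, dY t p = vfield K b g phi beta gamma N eps (Y t) p) /\
    forall i x, 0 < density (Y t) i x.
  by move=> t0; have [_ _ _ E _] := sol t t0; apply: E; rewrite t0 lexx.
have C1 c i : C1_torus (fun t x => Y t (c, i, x)) (fun t x => dY t (c, i, x)).
  apply/C1_torusP => t t0; split.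
  - exact: (tY t).1.
  - exact: (tY t).2.
  - move=> e e0.
    have [d d0 Hd] := ucurve_taylor uY udY ltr01 (fun s p (_ : `|s - t| < 1) => dY_ s p) e0.
    exists d => // h _ h0 hd x; have := Hd h hd (c, i, x).
    set D := Y _ _ - Y t _ => H.
    rewrite -(@ler_pM2r _ `|h|) ?normr_gt0//; apply: le_trans H.
    by rewrite -normrM mulrBl mulrAC mulVf// mul1r (mulrC _ h).
  - move=> e e0; have [d d0 Hd] := udY t e e0.
    by exists d => // s _ st x; exact: Hd.
split=> //.
- by move=> i t x t0; exact: (eqY t t0).2.
- by move=> i t x t0; rewrite (eqY t t0).1.
- by move=> i t x t0; rewrite (eqY t t0).1.
Qed.

End ode_solutions.

(** * Consistency *)

Section weak_estimates.
Variable R : realType.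
Local Notation period := (2 * pi : R).

Lemma Int_subset (f : R -> R) a b c d : continuous f -> (forall x, 0 <= f x) ->
  c <= a -> a <= b -> b <= d -> Int f a b <= Int f c d.
Proof.
move=> cf f0 ca ab bd; rewrite -(Int_chasles f c a d) -(Int_chasles f a b d).
have h1 : 0 <= Int f c a by apply: Int_ge0.
have h2 : 0 <= Int f b d by apply: Int_ge0.
lra.
Qed.

(** Discrete integration by parts: translations move the differences onto [psi]. First-order terms
    add up to [w u psi'] since the two parts of [u] differ by [u]; the remainders are of order
    [eps^2], divided by [eps]. *)
Lemma upwind_weak (eps A C V : R) (w u psi : R -> R) : 0 < eps <= 1 -> 0 <= A -> bump A psi ->
  (forall x k, `|psi (x + k) - psi x - k * derive1 psi x| <= C * k ^+ 2) -> 0 <= C ->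
  continuous_torus w -> continuous_torus u -> (forall x, `|u x| <= V) ->
  `|Int (fun x => upwind eps w u x * psi x) (- (A + 1)) (A + 1) -
    Int (fun x => w x * u x * derive1 psi x) (- (A + 1)) (A + 1)|
  <= eps * C * V * Int (fun x => `|w x|) (- (A + 1)) (A + 1).
Proof.
move=> /andP[e0 e1] A0 bp HC C0 tw tu Hu.
(* The extra unit keeps [psi], translated by [eps] or [- eps], supported in the window, as
   [eps <= 1]. *)
set B := A + 1; have AB : A <= B by rewrite /B; lra.
have BB : - B <= B by rewrite /B; lra.
pose a x := w x * ((`|u x| + u x) / 2).
pose c x := w x * ((`|u x| - u x) / 2).
have tn := torus_norm tu; have t2 := torus_cst (2^-1 : R).
have ta : continuous_torus a by do 2 apply: torusM => //; exact: torusD.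
have tc : continuous_torus c by do 2 apply: torusM => //; exact: torusB.
have ca := ta.2; have cc := tc.2.
have cp := bump_continuous bp; have cp' := bump_continuous (bump_derive bp).
have shift (f : R -> R) (s : R) : continuous f -> `|s| <= 1 ->
    Int (fun x => f (x + s) * psi x) (- B) B = Int (fun x => f x * psi (x - s)) (- B) B.
  move=> cf s1; pose f' x := f x * psi (x - s).
  have cf' : continuous f' by apply: continuous_mul => //; exact: continuous_translate.
  have -> : Int (fun x => f (x + s) * psi x) (- B) B = Int (fun x => f' (x + s)) (- B) B.
    by apply: eq_Int => x; rewrite /f' addrK.
  have [s1' s1''] : - 1 <= s /\ s <= 1 by move: s1; rewrite ler_norml => /andP[].
  rewrite Int_shift//; apply: Int_support => //; first by lra.
    move=> x xB; rewrite /f' (bump_itv bp AB) ?mulr0//; apply: contra xB => /andP[? ?].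
    by apply/andP; split; lra.
  move=> x xB; rewrite /f' bp.2 ?mulr0//; rewrite ltNge; apply: contra xB.
  by rewrite ler_norml /B => /andP[? ?]; apply/andP; split; lra.
have cD (f h : R -> R) : continuous f -> continuous h -> continuous (fun x => f x + h x).
  by move=> cf ch x; apply: cvgD; [exact: cf|exact: ch].
have cB (f h : R -> R) : continuous f -> continuous h -> continuous (fun x => f x - h x).
  by move=> cf ch x; apply: cvgB; [exact: cf|exact: ch].
have c1 : continuous (fun x => a x * psi (x - - eps)).
  by apply: continuous_mul => //; exact: continuous_translate.
have c2 : continuous (fun x => (a x + c x) * psi x).
  by apply: continuous_mul => //; exact: cD.
have c3 : continuous (fun x => c x * psi (x - eps)).
  by apply: continuous_mul => //; exact: continuous_translate.
have c12 := cB _ _ c1 c2; have c123 := cD _ _ c12 c3.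
have E : Int (fun x => upwind eps w u x * psi x) (- B) B =
  Int (fun x => eps^-1 * (a x * psi (x - - eps) - (a x + c x) * psi x + c x * psi (x - eps)))
    (- B) B.
  rewrite IntZ// IntD// IntB// -!shift//; last 2 first.
  - by rewrite gtr0_norm.
  - by rewrite normrN gtr0_norm.
  have d1 : continuous (fun x => a (x + - eps) * psi x).
    by apply: continuous_mul => //; exact: continuous_translate.
  have d3 : continuous (fun x => c (x + eps) * psi x).
    by apply: continuous_mul => //; exact: continuous_translate.
  have d12 := cB _ _ d1 c2; have d123 := cD _ _ d12 d3.
  rewrite -IntB// -IntD// -IntZ//; apply: eq_Int => x.
  by rewrite /upwind /a /c; field; rewrite gt_eqF.
have c4 := continuous_mul (@continuous_const R eps^-1) c123.
have c5 : continuous (fun x => w x * u x * derive1 psi x).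
  by apply: continuous_mul => //; apply: continuous_mul; [exact: tw.2|exact: tu.2].
have cn : continuous (fun x => `|w x|) by apply: continuous_norm; exact: tw.2.
rewrite E -IntB// -IntZ//; apply: le_norm_Int => //.
- exact: cB c4 c5.
- by apply: continuous_mul => //; exact: continuous_const.
move=> x _.
rewrite (_ : _ - _ = eps^-1 * (a x * (psi (x + eps) - psi x - eps * derive1 psi x) +
   c x * (psi (x + - eps) - psi x - - eps * derive1 psi x))); last first.
  by rewrite opprK /a /c; field; rewrite gt_eqF.
have h1 := HC x eps; have h2 := HC x (- eps); rewrite sqrrN in h2.
have [u1 _ u2 _] := upwind_parts (lexx `|u x|).
have ac : `|a x| + `|c x| = `|w x| * `|u x|.
  rewrite /a /c !(normrM (w x)) (ger0_norm u1) (ger0_norm u2) -mulrDr.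
  by congr (_ * _); field.
rewrite normrM gtr0_norm ?invr_gt0//.
apply: (@le_trans _ _ (eps^-1 * ((`|a x| + `|c x|) * (C * eps ^+ 2)))).
  apply: ler_wpM2l; first by rewrite invr_ge0 ltW.
  apply: le_trans (ler_normD _ _) _; rewrite [leRHS]mulrDl.
  by apply: lerD; rewrite normrM; apply: ler_pM.
rewrite ac (_ : eps^-1 * _ = eps * C * (`|u x| * `|w x|)); last by field; rewrite gt_eqF.
rewrite -[leRHS]mulrA; apply: ler_wpM2l; first by apply: mulr_ge0 => //; exact: ltW.
by apply: ler_wpM2r.
Qed.

Variables (K b : 'I_2 -> R) (g : R).
Hypothesis K_gt0 : forall i, 0 < K i.
Hypothesis b_gt0 : 0 < b ord0 - b ord_max.
Variables (phi : R -> R) (beta gamma N : R).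
Hypothesis phi_test : test_function phi.
Local Notation state := (bool * 'I_2 * R -> R).
Variable eps : R.
Hypothesis eps01 : 0 < eps <= 1.
Variables (l : R) (y dy : state).
Hypothesis l_gt0 : 0 < l.
Hypothesis y_box : box_state l y.
Hypothesis dy_torus : torus_state dy.
Hypothesis dyE : forall p, dy p = vfield K b g phi beta gamma N eps y p.
Variables (A : R) (psi : R -> R).
Hypothesis A_ge0 : 0 <= A.
Hypothesis psi_bump : bump A psi.

Let eps_gt0 : 0 < eps. Proof. by case/andP: eps01. Qed.

Let y_gt0 i x : 0 < y (false, i, x).
Proof. exact: (box_gt0 l_gt0 i x y_box.2). Qed.

Let B := A + 1.

Lemma Rintegral_bump (f h : R -> R) : continuous f -> bump A h ->
  (\int[lebesgue_measure]_x (f x * h x))%R = Int (fun x => f x * h x) (- B) B.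
Proof.
move=> cf bh; apply: Rintegral_support.
- by apply: continuous_mul => //; exact: bump_continuous bh.
- by have := A_ge0; rewrite /B; lra.
- by move=> x xB; rewrite (bump_itv bh _ xB) ?mulr0// /B lerDl.
Qed.

Lemma weak_mass_le (C V : R) i :
  (forall x k, `|psi (x + k) - psi x - k * derive1 psi x| <= C * k ^+ 2) -> 0 <= C ->
  (forall x, `|y (true, i, x)| <= V * y (false, i, x)) ->
  `|(\int[lebesgue_measure]_x (dy (false, i, x) * psi x) -
     \int[lebesgue_measure]_x (y (true, i, x) * derive1 psi x))%R|
  <= eps * C * V * Int (fun x => y (false, i, x)) (- B) B + eps `^ beta * `|Int psi (- B) B|.
Proof.
move=> HC C0 HV; have ty := y_box.1; have tu := torus_velocity i l_gt0 y_box.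
have bp' := bump_derive psi_bump.
rewrite Rintegral_bump ?Rintegral_bump//; [|exact: (ty true i).2|exact: (dy_torus false i).2].
set u := velocity (density y i) (momentum y i) in tu.
have cp := bump_continuous psi_bump.
have tU := (box_functional_upwind eps l_gt0 i (box_functional_proj l_gt0 false i)).
have cU : continuous (fun x => upwind eps (density y i) u x).
  by have [h _ _] := tU; exact: (h y y_box).2.
have E1 : Int (fun x => dy (false, i, x) * psi x) (- B) B =
    Int (fun x => upwind eps (density y i) u x * psi x) (- B) B + eps `^ beta * Int psi (- B) B.
  rewrite -IntZ// -IntD; [|exact: continuous_mul|by apply: continuous_mul => //; exact: continuous_const].
  by apply: eq_Int => x; rewrite dyE /= mulrDl.
have E2 : Int (fun x => y (true, i, x) * derive1 psi x) (- B) B =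
    Int (fun x => density y i x * u x * derive1 psi x) (- B) B.
  apply: eq_Int => x; congr (_ * _); rewrite /u /velocity /density /momentum.
  by rewrite mulrC mulfVK// gt_eqF.
have uV x : `|u x| <= V.
  rewrite /u /velocity normrM normfV (gtr0_norm (y_gt0 i x)) ler_pdivrMr//; exact: HV.
rewrite E1 E2 addrAC; apply: le_trans (ler_normD _ _) _; apply: lerD; last first.
  by rewrite normrM ger0_norm// powR_ge0.
apply: le_trans (upwind_weak eps01 A_ge0 psi_bump HC C0 (ty false i) tu uV) _.
rewrite le_eqVlt; apply/orP; left; apply/eqP; congr (_ * _); apply: eq_Int => x.
by rewrite gtr0_norm.
Qed.

(** Force and gravity cancel exactly through the ODE, so only the transport error of [q] is left. A
    second factor [V] appears because [|q| <= V r]. *)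
Lemma weak_momentum_le (C V : R) i :
  (forall x k, `|psi (x + k) - psi x - k * derive1 psi x| <= C * k ^+ 2) -> 0 <= C -> 0 <= V ->
  (forall x, `|y (true, i, x)| <= V * y (false, i, x)) ->
  `|(\int[lebesgue_measure]_x (dy (true, i, x) * psi x)
     - \int[lebesgue_measure]_x (y (false, i, x) *
          velocity (density y i) (momentum y i) x ^+ 2 * derive1 psi x)
     + \int[lebesgue_measure]_x (y (false, i, x) *
          derive1 (Phi K b phi gamma N eps (density y) i) x * psi x)
     - g * \int[lebesgue_measure]_x (y (false, i, x) * psi x))%R|
  <= eps * C * V ^+ 2 * Int (fun x => y (false, i, x)) (- B) B.
Proof.
move=> HC C0 V0 HV; have ty := y_box.1; have tu := torus_velocity i l_gt0 y_box.
have bp' := bump_derive psi_bump; have cp := bump_continuous psi_bump.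
set u := velocity (density y i) (momentum y i) in tu *.
have cr := (ty false i).2; have cq := (ty true i).2; have cu := tu.2.
have cdP : continuous (fun x => derive1 (Phi K b phi gamma N eps (density y) i) x).
  have [h _ _] := box_functional_dPhi K_gt0 b_gt0 gamma N phi_test eps_gt0 l_gt0 i.
  exact: (h y y_box).2.
have cdq := (dy_torus true i).2.
rewrite (Rintegral_bump cdq psi_bump).
rewrite (@Rintegral_bump (fun x => y (false, i, x) * u x ^+ 2) _ _ bp'); last first.
  by apply: continuous_mul => //; apply: continuous_mul.
rewrite (@Rintegral_bump (fun x => y (false, i, x) *
  derive1 (Phi K b phi gamma N eps (density y) i) x) _ _ psi_bump); last exact: continuous_mul.
rewrite (Rintegral_bump cr psi_bump).
have cU : continuous (fun x => upwind eps (momentum y i) u x).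
  have [h _ _] := box_functional_upwind eps l_gt0 i (box_functional_proj l_gt0 true i).
  exact: (h y y_box).2.
have E1 : Int (fun x => dy (true, i, x) * psi x) (- B) B +
   Int (fun x => y (false, i, x) * derive1 (Phi K b phi gamma N eps (density y) i) x * psi x) (- B) B
   - g * Int (fun x => y (false, i, x) * psi x) (- B) B =
   Int (fun x => upwind eps (momentum y i) u x * psi x) (- B) B.
  have k1 : continuous (fun x => dy (true, i, x) * psi x) by exact: continuous_mul.
  have k2 : continuous (fun x => y (false, i, x) *
    derive1 (Phi K b phi gamma N eps (density y) i) x * psi x) by apply: continuous_mul => //; exact: continuous_mul.
  have k3 : continuous (fun x => y (false, i, x) * psi x) by exact: continuous_mul.
  have k4 : continuous (fun x => g * (y (false, i, x) * psi x)).
    by apply: continuous_mul => //; exact: continuous_const.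
  have k12 : continuous (fun x => dy (true, i, x) * psi x + y (false, i, x) *
    derive1 (Phi K b phi gamma N eps (density y) i) x * psi x).
    by move=> x; apply: cvgD; [exact: k1|exact: k2].
  rewrite -IntD// -IntZ// -IntB//; apply: eq_Int => x.
  by rewrite dyE /= -/u /density; ring.
have E2 : Int (fun x => y (false, i, x) * u x ^+ 2 * derive1 psi x) (- B) B =
    Int (fun x => momentum y i x * u x * derive1 psi x) (- B) B.
  apply: eq_Int => x; congr (_ * _); rewrite /u /velocity /density /momentum.
  by field; rewrite gt_eqF.
have uV x : `|u x| <= V.
  rewrite /u /velocity normrM normfV (gtr0_norm (y_gt0 i x)) ler_pdivrMr//; exact: HV.
rewrite E2; move: E1.
set I1 := Int (fun x => dy _ * _) _ _; set I2 := Int (fun x => _ * derive1 (Phi _ _ _ _ _ _ _ _) x * _) _ _.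
set I3 := Int _ _ _; set I4 := Int _ _ _; set I5 := Int _ _ _ => E1.
rewrite (_ : _ - _ = I4 - I5); last by rewrite -E1; ring.
apply: le_trans (upwind_weak eps01 A_ge0 psi_bump HC C0 (ty true i) tu uV) _.
rewrite expr2 !mulrA -[leRHS]mulrA; apply: ler_wpM2l.
  by apply: mulr_ge0 => //; apply: mulr_ge0 => //; exact: ltW.
rewrite -IntZ//; apply: le_Int => //.
- exact: continuous_norm.
- by apply: continuous_mul => //; exact: continuous_const.
- by have := A_ge0; rewrite /B; lra.
Qed.

(** Two errors: mollification, passed to the test function by [convolution_weak], and the shift, for
    which [0 <= ln (rho + eps^N) - ln rho <= eps^N / rho] and [rho] is at least the density. *)
Lemma weak_potential_le (Aphi C M delta : R) i : 0 <= Aphi -> bump Aphi phi ->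
  (forall x, 0 <= phi x) -> Int phi (- Aphi) Aphi = 1 ->
  (forall x z, `|psi z - psi x| <= C * `|z - x|) -> 0 <= C -> (forall x, `|psi x| <= M) ->
  (forall x, eps `^ N / y (false, i, x) <= delta) -> 0 <= gamma ->
  `|(\int[lebesgue_measure]_x (Phi K b phi gamma N eps (density y) i x * psi x)
     - K i * \int[lebesgue_measure]_x (ln (rho K b (fun j => y (false, j, x)) i) * psi x))%R|
  <= K i * (C * (Aphi * eps `^ gamma) *
      Int (fun x => `|ln (rho K b (fun j => density y j x) i + eps `^ N)|) (- (Aphi + B)) (Aphi + B)
      + delta * M * (2 * B)).
Proof.
move=> Ap0 bphi phi0 phi1 HC C0 HM Hd g0; have cp := bump_continuous psi_bump.
have eN : 0 < eps `^ N by exact: powR_gt0.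
set L := fun x => ln (rho K b (fun j => density y j x) i + eps `^ N).
have eg0 : 0 < eps `^ gamma by exact: powR_gt0.
have eg1 : eps `^ gamma <= 1 by exact: powR_le1.
have Ae0 : 0 <= Aphi * eps `^ gamma by apply: mulr_ge0 => //; exact: ltW.
have tL : continuous_torus L.
  by have [h _ _] := box_functional_log K_gt0 b_gt0 N eps_gt0 l_gt0 i; exact: (h y y_box).
have bm := mollifier_bump bphi eg0.
have tc := torus_convolution tL bm Ae0.
have rho_pos x : 0 < rho K b (fun j => density y j x) i.
  by apply: rho_gt0 => // j; exact: y_gt0.
have rho_ge x : y (false, i, x) <= rho K b (fun j => density y j x) i.
  by have [] := rho_bounds K_gt0 b_gt0 i (fun j => y_gt0 j x).
have cl : continuous (fun x => ln (rho K b (fun j => density y j x) i)).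
  have [h _ _] := box_functional_rho K_gt0 b_gt0 l_gt0 i; have [_ cr] := h y y_box.
  move=> x; apply: (@continuous_comp R R R (fun x => rho K b (fun j => density y j x) i) (@ln R)); first exact: cr.
  exact: continuous_ln.
have E1 : (\int[lebesgue_measure]_x (Phi K b phi gamma N eps (density y) i x * psi x))%R =
    K i * Int (fun x => convolution L (mollifier phi (eps `^ gamma)) x * psi x) (- B) B.
  rewrite Rintegral_bump//; last by apply: continuous_mul; [exact: continuous_const|exact: tc.2].
  rewrite -IntZ; last by apply: continuous_mul => //; exact: tc.2.
  by apply: eq_Int => x; rewrite /Phi -mulrA.
rewrite E1 (Rintegral_bump cl psi_bump) -mulrBr normrM (gtr0_norm (K_gt0 i)).
apply: ler_wpM2l; first exact: ltW.
set I1 := Int _ _ _; set I2 := Int _ _ _.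
pose I3 := Int (fun x => L x * psi x) (- B) B.
have -> : I1 - I2 = (I1 - I3) + (I3 - I2) by ring.
have BB : - B <= B by have := A_ge0; rewrite /B; lra.
have B0 : 0 <= B by have := A_ge0; rewrite /B; lra.
apply: le_trans (ler_normD _ _) _; apply: lerD.
  have bpB : bump B psi.
    have [d h] := psi_bump; split=> // x Bx; apply: h; apply: le_lt_trans Bx.
    by rewrite /B lerDl.
  have m0 x : 0 <= mollifier phi (eps `^ gamma) x.
    by apply: mulr_ge0 => //; rewrite invr_ge0 ltW.
  have m1 : Int (mollifier phi (eps `^ gamma)) (- (Aphi * eps `^ gamma)) (Aphi * eps `^ gamma) = 1.
    by rewrite -mulNr Int_scale//; exact: bump_continuous bphi.
  apply: le_trans (convolution_weak tL bm Ae0 m0 m1 bpB B0 HC C0) _.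
  apply: ler_wpM2l; first exact: mulr_ge0.
  have AA : Aphi * eps `^ gamma <= Aphi by rewrite ler_piMr.
  apply: Int_subset; [by apply: continuous_norm; exact: tL.2|by []|lra|lra|lra].
have c1 : continuous (fun x => L x * psi x) by apply: continuous_mul => //; exact: tL.2.
have c2 : continuous (fun x => ln (rho K b (fun j => density y j x) i) * psi x).
  exact: continuous_mul.
rewrite /I3 /I2 -IntB// (_ : 2 * B = B - - B); last by ring.
apply: le_norm_Int_cst => //; first by move=> x; apply: cvgB; [exact: c1|exact: c2].
move=> x _; rewrite -mulrBl normrM; apply: ler_pM => //.
have rp := rho_pos x; have rN : 0 < rho K b (fun j => density y j x) i + eps `^ N by exact: addr_gt0.
rewrite /L -ln_div ?posrE// ger0_norm; last first.
  by apply: ln_ge0; rewrite ler_pdivlMr// mul1r lerDl ltW.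
apply: le_trans (ln_le_sub1 _) _; first by rewrite divr_gt0.
rewrite mulrDl divff ?gt_eqF// addrAC subrr add0r; apply: le_trans (Hd x).
by apply: ler_wpM2l; [exact: ltW|rewrite lef_pV2 ?posrE].
Qed.

End weak_estimates.

(** * Rates in eps and the limit *)

Section asymptotics.
Variable R : realType.

Lemma powR_add (e p q : R) : 0 < e -> e `^ p * e `^ q = e `^ (p + q).
Proof. by move=> e0; rewrite powRD//; apply/implyP => _; rewrite gt_eqF. Qed.

Lemma powR_small (C p e : R) : 0 < p -> 0 < e ->
  exists2 d : R, 0 < d & forall x, 0 < x < d -> C * x `^ p <= e.
Proof.
move=> p0 e0; have C0 : 0 < `|C| + 1 by rewrite ltr_wpDl.
have q0 : 0 < e / (`|C| + 1) by rewrite divr_gt0.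
exists ((e / (`|C| + 1)) `^ p^-1); first exact: powR_gt0.
move=> x /andP[x0 xd]; have xp : 0 <= x `^ p by exact: powR_ge0.
have h : x `^ p <= e / (`|C| + 1).
  have pn0 : p != 0 by rewrite gt_eqF.
  rewrite -[leRHS]powRr1 ?(ltW q0)// -[X in _ <= _ `^ X](mulVf pn0).
  by rewrite powRrM; apply: ge0_ler_powR; rewrite ?nnegrE ?powR_ge0 ?ltW.
apply: (@le_trans _ _ ((`|C| + 1) * x `^ p)).
  by apply: ler_wpM2r => //; apply: le_trans (ler_norm C) _; rewrite lerDl.
by rewrite mulrC -ler_pdivlMr.
Qed.

Lemma cvg_at_right0_powR (f : R -> R) (C1 p1 C2 p2 : R) : 0 < p1 -> 0 < p2 ->
  (forall e, 0 < e <= 1 -> `|f e| <= C1 * e `^ p1 + C2 * e `^ p2) ->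
  f e @[e --> 0^'+] --> 0.
Proof.
move=> p10 p20 H; apply/cvgrPdist_le => e e0; have e20 : 0 < e / 2 by rewrite divr_gt0.
have [d1 d10 H1] := powR_small C1 p10 e20; have [d2 d20 H2] := powR_small C2 p20 e20.
apply/(within_near_epsP (fun u : R => 0 < u) 0 (fun x => `|0 - f x| <= e)).
exists (Num.min 1 (Num.min d1 d2)); first by rewrite !lt_min ltr01 d10.
move=> x x0; rewrite subr0 gtr0_norm// !lt_min => /and3P[x1 xd1 xd2].
rewrite sub0r normrN; apply: le_trans (H x _) _; first by rewrite x0 ltW.
by rewrite (splitr e); apply: lerD; [apply: H1; rewrite x0|apply: H2; rewrite x0].
Qed.

Variables (K b : 'I_2 -> R) (g : R).
Hypothesis K_gt0 : forall i, 0 < K i.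
Hypothesis b_gt0 : 0 < b ord0 - b ord_max.
Variables (phi : R -> R) (beta gamma N : R).
Hypothesis phi_test : test_function phi.
Hypothesis beta_ge0 : 0 <= beta.
Hypothesis gamma_gt0 : 0 < gamma.
Hypothesis N_ge0 : 0 <= N.
Local Notation state := (bool * 'I_2 * R -> R).
Local Notation period := (2 * pi : R).
Variables r0eps u0eps : R -> 'I_2 -> R -> R.
Variables U I0 : R.
Hypothesis U_gt0 : 0 < U.
Hypothesis u0eps_le : forall eps i x, 0 < eps <= 1 -> `|u0eps eps i x| <= U.
Hypothesis r0eps_cont : forall eps i, 0 < eps <= 1 -> continuous (r0eps eps i).
Hypothesis r0eps_le : forall eps i, 0 < eps <= 1 -> Int (r0eps eps i) 0 period <= I0.
Hypothesis r0eps_gt0 : forall eps i x, 0 < eps <= 1 -> 0 < r0eps eps i x.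

(** The constants depend on [t] and the data but not on [eps]. The initial density has no lower
    bound uniform in [eps], so its contribution is discarded and the source alone gives the last
    estimate; hence the role of [t > 0]. *)
Lemma uniform_estimates (t : R) : 0 < t -> exists Wb Mb c : R,
  [/\ 0 <= Wb, 0 <= Mb, 0 < c &
   forall eps Y dY, 0 < eps <= 1 ->
     solution_upto K b g phi beta gamma N eps t (r0eps eps) (u0eps eps) Y dY ->
     exists l W : R, [/\ 0 < l /\ box_state l (Y t), 0 <= W <= Wb * eps `^ (- (3 * gamma)),
       forall i x, `|Y t (true, i, x)| <= W * Y t (false, i, x),
       forall i, mass (Y t) i <= Mb &
       forall i x, c * eps `^ (1 + beta + 3 * gamma) <= Y t (false, i, x)]].
Proof.
move=> t0; have [C C0 HC] := dPhi_bound K_gt0 b_gt0 phi_test gamma_gt0 N_ge0.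
have p0 := ltW (period_gt0 R); have t0' := ltW t0.
have I00 : 0 <= I0.
  have h : (0 : R) < (1 : R) <= (1 : R) by apply/andP; split.
  apply: le_trans (r0eps_le ord0 h); apply: Int_ge0 => //; first exact: r0eps_cont.
  by move=> x _; apply/ltW; exact: r0eps_gt0.
pose J := 1 + (I0 + I0 + 2 * period * t).
have J0 : 0 <= J.
  have : 0 <= 2 * period * t by apply: mulr_ge0 => //; exact: mulr_ge0.
  by rewrite /J; lra.
pose Wb := U + (`|g| + C * J) * t.
have CJ : 0 <= C * J by exact: mulr_ge0.
have Wb0 : 0 <= Wb.
  by apply: addr_ge0; [exact: ltW|apply: mulr_ge0 => //; exact: addr_ge0].
have D0 : 0 < 1 + Wb * t by rewrite ltr_pwDl// mulr_ge0.
exists Wb, (I0 + period * t), (t / (1 + Wb * t)); split => //.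
- by apply: addr_ge0 => //; exact: mulr_ge0.
- by rewrite divr_gt0.
move=> eps Y dY e01 sol; have e0 : 0 < eps by case/andP: e01.
have [l l0 Hl] := solution_upto_box t0' sol.
set e3 := eps `^ (- (3 * gamma)).
have e31 : 1 <= e3 by apply: powRN_ge1 => //; apply: mulr_ge0 => //; exact: ltW.
have P0 : 0 <= C * e3 by apply: mulr_ge0 => //; lra.
have HP l' (y : state) i x : 0 < l' -> box_state l' y ->
    `|derive1 (Phi K b phi gamma N eps (density y) i) x| <=
    C * e3 * (1 + (mass y ord0 + mass y ord_max)) by move=> l'0 by_; exact: (HC eps l').
have [UW a1 a2 _] := apriori beta_ge0 e01 t0' sol P0 HP U_gt0 (fun i x => u0eps_le i x e01).
move: UW a1 a2; set I := mass (Y 0) ord0 + mass (Y 0) ord_max.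
set W := speed _ _ _ _ _ => UW a1 a2.
have W0 : 0 < W by apply: lt_le_trans UW.
have [_ tY _ _ iY] := sol.
have massE i : mass (Y 0) i = Int (r0eps eps i) 0 period.
  by apply: eq_Int => x; rewrite /density (iY i x).1.
have IJ : 1 + (I + 2 * period * t) <= J.
  by rewrite /I !massE /J; have := r0eps_le ord0 e01; have := r0eps_le ord_max e01; lra.
have WW : W <= Wb * e3.
  rewrite /W /speed /Wb [leRHS]mulrDl; apply: lerD; first by rewrite ler_peMr// ltW.
  rewrite [leRHS]mulrAC; apply: ler_wpM2r => //; rewrite [leRHS]mulrDl.
  apply: lerD; first by rewrite ler_peMr.
  by rewrite [leRHS]mulrAC; apply: ler_wpM2l.
exists l, W; split.
- by split=> //; apply: Hl; rewrite t0' lexx.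
- by rewrite ltW.
- exact: a1.
- move=> i; rewrite (solution_mass i t0' sol) massE; apply: lerD; first exact: r0eps_le.
  rewrite -mulrA; apply: ler_wpM2l => //; rewrite ler_piMl//; exact: powR_le1.
move=> i x; apply: le_trans (a2 i x).
set m := eps `^ beta / (W / eps); set E := expR (- (W / eps * t)).
have m0 : 0 <= m by apply: divr_ge0; [exact: powR_ge0|rewrite divr_ge0// ltW].
have E0 : 0 < E by exact: expR_gt0.
have z0 : 0 <= W / eps * t by apply: mulr_ge0 => //; rewrite divr_ge0// ltW.
have z1 : 0 < 1 + W / eps * t by lra.
(* From [e^z >= 1 + z]. The source contribution [m * (1 - E)] is then at least
   [eps^beta * eps * t / (eps + W * t)], and [W <= Wb * e3] with [eps <= 1 <= e3] gives the constant
   [t / (1 + Wb * t)]. *)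
have E1 : E <= (1 + W / eps * t)^-1.
  rewrite /E expRN lef_pV2 ?posrE ?expR_gt0//; exact: expR_ge1Dx.
apply: (@le_trans _ _ (m * (1 - (1 + W / eps * t)^-1))); last first.
  have h1 : 0 <= r0eps eps i x * E by apply: mulr_ge0; apply/ltW => //; exact: r0eps_gt0.
  have h2 : 0 <= m * ((1 + W / eps * t)^-1 - E) by apply: mulr_ge0 => //; rewrite subr_ge0.
  by lra.
have -> : m * (1 - (1 + W / eps * t)^-1) = eps `^ beta * eps * t / (eps + W * t).
  have n1 : eps != 0 by rewrite gt_eqF.
  have n2 : W != 0 by rewrite gt_eqF.
  have n3 : eps + W * t != 0 by rewrite gt_eqF// addr_gt0// mulr_gt0.
  by rewrite /m; field; rewrite n1 n2 n3.
have ee : eps `^ (1 + beta + 3 * gamma) = eps `^ beta * eps / e3.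
  rewrite /e3 powRN invrK -[X in _ * X * _](powRr1 (ltW e0)) !powR_add//.
  by congr (_ `^ _); ring.
rewrite ee (_ : _ * (_ / e3) = eps `^ beta * eps * t / ((1 + Wb * t) * e3)); last first.
  by field; rewrite !gt_eqF//; lra.
apply: ler_wpM2l; first by rewrite mulr_ge0// mulr_ge0 ?powR_ge0// ltW.
have dW : 0 < eps + W * t by rewrite addr_gt0// mulr_gt0.
have d3 : 0 < (1 + Wb * t) * e3 by rewrite mulr_gt0//; lra.
rewrite lef_pV2 ?posrE//.
have h1 : W * t <= Wb * e3 * t by apply: ler_wpM2r.
have : eps <= 1 by case/andP: e01.
by lra.
Qed.

End asymptotics.

Theorem mainTheorem1 (R : realType) (K b : 'I_2 -> R) (g : R)
    (K_gt0 : forall i, 0 < K i) (b_gt0 : 0 < b ord0 - b ord_max)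
    (phi : R -> R) (phi_test : test_function phi)
    (phi_ge0 : forall x, 0 <= phi x)
    (phi_int1 : (\int[lebesgue_measure]_x phi x)%R = 1)
    (r0 u0 : 'I_2 -> R -> R)
    (r0_L1 : forall i, Lp_torus 1%E (r0 i))
    (u0_Linfty : forall i, Lp_torus +oo%E (u0 i))
    (r0eps u0eps : R -> 'I_2 -> R -> R)
    (r0eps_cont : forall (eps : R) i, 0 < eps <= 1 -> continuous_torus (r0eps eps i))
    (u0eps_cont : forall (eps : R) i, 0 < eps <= 1 -> continuous_torus (u0eps eps i))
    (r0eps_cvg : forall i,
      norm_torus 1%E (r0eps eps i \- r0 i) @[eps --> 0^'+] --> 0%E)
    (u0eps_cvg : forall i,
      norm_torus 1%E (u0eps eps i \- u0 i) @[eps --> 0^'+] --> 0%E)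
    (r0eps_bnd : forall i, exists M : R, forall eps : R, 0 < eps <= 1 ->
      (norm_torus 1 (r0eps eps i) <= M%:E)%E)
    (u0eps_bnd : forall i, exists M : R, forall eps : R, 0 < eps <= 1 ->
      (norm_torus +oo (u0eps eps i) <= M%:E)%E)
    (r0eps_gt0 : forall (eps : R) i (x : R), 0 < eps <= 1 -> 0 < r0eps eps i x)
    (beta gamma N : R) (beta_gt0 : 0 < beta) (gamma_gt0 : 0 < gamma)
    (gamma_lt : gamma < 1 / 6) (N_gt : 0 < N - 1 - beta - 3 * gamma) :
  exists r q dr dq : R -> 'I_2 -> R -> R -> R,
    (forall eps : R, 0 < eps <= 1 ->
      ode_solution K b g phi beta gamma N eps (r0eps eps) (u0eps eps)
        (r eps) (q eps) (dr eps) (dq eps) /\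
      (forall r' q' dr' dq' : 'I_2 -> R -> R -> R,
        ode_solution K b g phi beta gamma N eps (r0eps eps) (u0eps eps)
          r' q' dr' dq' ->
        forall i (t x : R), 0 <= t ->
          r' i t x = r eps i t x /\ q' i t x = q eps i t x)) /\
    (forall (psi : R -> R) (t : R) (i : 'I_2), test_function psi -> 0 < t ->
      [/\ (\int[lebesgue_measure]_x (dr eps i t x * psi x)
           - \int[lebesgue_measure]_x (q eps i t x * derive1 psi x))%R
            @[eps --> 0^'+] --> 0,
          (\int[lebesgue_measure]_x (dq eps i t x * psi x)
           - \int[lebesgue_measure]_x
               (r eps i t x * velocity (r eps i t) (q eps i t) x ^+ 2
                * derive1 psi x)
           + \int[lebesgue_measure]_x
               (r eps i t x
                * derive1 (Phi K b phi gamma N eps (r eps ^~ t) i) x * psi x)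
           - g * \int[lebesgue_measure]_x (r eps i t x * psi x))%R
            @[eps --> 0^'+] --> 0 &
          (\int[lebesgue_measure]_x
               (Phi K b phi gamma N eps (r eps ^~ t) i x * psi x)
           - K i * \int[lebesgue_measure]_x
               (ln (rho K b (fun j => r eps j t x) i) * psi x))%R
            @[eps --> 0^'+] --> 0]).
Proof.
have N0 : 0 <= N by lra.
have be0 : 0 <= beta by exact: ltW.
have p0 := ltW (period_gt0 R).
have [C C0 HC] := dPhi_bound K_gt0 b_gt0 phi_test gamma_gt0 N0.
have [M0 HM0] := r0eps_bnd ord0; have [M1 HM1] := r0eps_bnd ord_max.
have [U0 HU0] := u0eps_bnd ord0; have [U1 HU1] := u0eps_bnd ord_max.
pose I0 := `|M0| + `|M1|; pose U := 1 + (`|U0| + `|U1|).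
have U_gt0 : 0 < U by rewrite ltr_pwDl// addr_ge0.
have mass0 eps i : 0 < eps <= 1 -> Int (r0eps eps i) 0 (2 * pi) <= I0.
  move=> e01; have ci := (r0eps_cont eps i e01).2.
  have -> : Int (r0eps eps i) 0 (2 * pi) = Int (fun x => `|r0eps eps i x|) 0 (2 * pi).
    by apply: eq_Int => x; rewrite gtr0_norm// r0eps_gt0.
  have [i0|i1] := ord2P i.
    subst i; apply: le_trans (Int_le_norm_torus1 ci (HM0 _ e01)) _.
    by apply: le_trans (ler_norm M0) _; rewrite lerDl.
  subst i; apply: le_trans (Int_le_norm_torus1 ci (HM1 _ e01)) _.
  by apply: le_trans (ler_norm M1) _; rewrite lerDr.
have u0_le eps i x : 0 < eps <= 1 -> `|u0eps eps i x| <= U.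
  move=> e01; have ci := u0eps_cont eps i e01.
  have h0 := ler_norm U0; have h1 := ler_norm U1.
  have n0 := normr_ge0 U0; have n1 := normr_ge0 U1.
  have [i0|i1] := ord2P i; subst i.
    by apply: le_trans (le_norm_torus_infty ci (HU0 _ e01) x) _; rewrite /U; lra.
  by apply: le_trans (le_norm_torus_infty ci (HU1 _ e01) x) _; rewrite /U; lra.
(* One solution is selected for each [eps], with a dummy zero pair outside [(0, 1]], where nothing
   is claimed. *)
have /choice[S HS] : forall eps : R, exists S : (R -> bool * 'I_2 * R -> R) * (R -> bool * 'I_2 * R -> R),
    0 < eps <= 1 -> (forall (t : R) p, is_derive t 1 (S.1 ^~ p) (S.2 t p)) /\
    forall T, 0 <= T -> solution_upto K b g phi beta gamma N eps T (r0eps eps) (u0eps eps)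
      S.1 S.2.
  move=> eps.
  have [e01|ne] := pselect (0 < eps <= 1); last by exists (fun _ _ => 0, fun _ _ => 0).
  have P0 : 0 <= C * eps `^ (- (3 * gamma)) by rewrite mulr_ge0// powR_ge0.
  have HP l (y : bool * 'I_2 * R -> R) i x (l0 : 0 < l) (by_ : box_state l y) :=
    HC eps l y i x e01 l0 by_.
  have [Y [dY [dYE sol]]] := global_solution g K_gt0 b_gt0 phi_test be0 e01 P0 HP
    (fun i => r0eps_cont eps i e01) (fun i => u0eps_cont eps i e01)
    (fun i x => r0eps_gt0 eps i x e01).
  by exists (Y, dY).
exists (fun eps i t x => (S eps).1 t (false, i, x)), (fun eps i t x => (S eps).1 t (true, i, x)),
  (fun eps i t x => (S eps).2 t (false, i, x)), (fun eps i t x => (S eps).2 t (true, i, x)).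
split.
  move=> eps e01; have [dS solS] := HS eps e01; split.
    exact: solution_upto_ode_solution.
  move=> r' q' dr' dq' ode' i t x t0.
  have sol' := ode_solution_solution_upto t ode'.
  have tt : 0 <= t <= t by rewrite t0 lexx.
  have uniq p := solution_unique K_gt0 b_gt0 phi_test e01 t0 sol' (solS t t0) p tt.
  by have := uniq (false, i, x); have := uniq (true, i, x); rewrite max_r.
move=> psi t i psi_test t0; have t0' := ltW t0.
have [A A0 bp] := test_function_bump psi_test; have A0' := ltW A0.
have [C2 C20 HC2] := bump_taylor bp; have [C1 C10 HC1] := bump_lipschitz bp.
have [M M_ge0 HM] := bump_bounded bp.
have [Ap Ap0 bphi] := test_function_bump phi_test; have Ap0' := ltW Ap0.
have phi1 : Int phi (- Ap) Ap = 1.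
  rewrite -phi_int1; apply/esym/Rintegral_support; first exact: bump_continuous bphi.
    by lra.
  by move=> x; exact: (bump_itv bphi (lexx Ap)).
have [Wb [Mb [c [Wb0 Mb0 c0 HE]]]] := uniform_estimates g K_gt0 b_gt0 phi_test be0 gamma_gt0 N0
  U_gt0 u0_le (fun eps i e01 => (r0eps_cont eps i e01).2) mass0 r0eps_gt0 t0.
pose B := A + 1; pose n := Num.bound (2 * B / (2 * pi)).
(* A number of periods covering the window, independent of [eps], turns the mass bound into a bound
   on the integral over [[-B, B]]. *)
have nB : B <= - B + (2 * pi) *+ n.
  have h : 2 * B / (2 * pi) < n%:R.
    by apply: archi_boundP; apply: divr_ge0 => //; rewrite mulr_ge0// /B addr_ge0.
  rewrite -mulr_natl; move: h; rewrite ltr_pdivrMr ?period_gt0//; lra.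
(* The logarithm is charged [eps^(- gamma / 2)] only, so that the mollification error, of order
   [eps^gamma] times this, still tends to 0. *)
have [D1 D10 HD1] := log_Int_bound K_gt0 b_gt0 N0 (divr_gt0 gamma_gt0 (ltr0n R 2))
  (addr_ge0 Ap0' (addr_ge0 A0' ler01)).
have data eps : 0 < eps <= 1 -> exists l W : R,
    [/\ [/\ 0 < l, box_state l ((S eps).1 t), torus_state ((S eps).2 t) &
         forall p, (S eps).2 t p = vfield K b g phi beta gamma N eps ((S eps).1 t) p],
     0 <= W <= Wb * eps `^ (- (3 * gamma)),
     forall i x, `|(S eps).1 t (true, i, x)| <= W * (S eps).1 t (false, i, x),
     Int (fun x => (S eps).1 t (false, i, x)) (- B) B <= n%:R * Mb &
     (forall i, mass ((S eps).1 t) i <= Mb) /\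
     forall i x, c * eps `^ (1 + beta + 3 * gamma) <= (S eps).1 t (false, i, x)].
  move=> e01; have [_ solS] := HS eps e01; have sol := solS t t0'.
  have [l [W [[l0 bl] WW qW mM rc]]] := HE eps _ _ e01 sol.
  have [_ tY _ eqY _] := sol; have tt : 0 <= t <= t by rewrite t0' lexx.
  exists l, W; split=> //.
    by split=> //; [exact: (tY t).2|exact: (eqY t tt).1].
  apply: le_trans (Int_le_periods (bl.1 false i) _ nB) _.
    by move=> x; apply/ltW; exact: (eqY t tt).2.
  by apply: ler_wpM2l => //; exact: mM.
split.
- apply: (@cvg_at_right0_powR _ _ (C2 * Wb * (n%:R * Mb)) (1 - 3 * gamma)
    `|Int psi (- B) B| beta) => //; first by lra.
  move=> eps e01; have e0 : 0 < eps by case/andP: e01.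
  have [l [W [[l0 bl tdY eqY] /andP[W0 WW] qW IB _]]] := data eps e01.
  apply: le_trans (weak_mass_le e01 l0 bl tdY eqY A0' bp HC2 C20 (qW i)) _.
  rewrite (mulrC (eps `^ beta)) lerD2r.
  have -> : eps `^ (1 - 3 * gamma) = eps * eps `^ (- (3 * gamma)).
    by rewrite -{2}(powRr1 (ltW e0)) powR_add.
  rewrite (_ : C2 * _ * _ * _ = eps * C2 * (Wb * eps `^ (- (3 * gamma))) * (n%:R * Mb)); last by ring.
  have eC : 0 <= eps * C2 by rewrite mulr_ge0// ltW.
  have I00 : 0 <= Int (fun x => (S eps).1 t (false, i, x)) (- B) B.
    apply: Int_ge0; [exact: (bl.1 false i).2|by rewrite /B; lra|].
    by move=> x _; apply/ltW; exact: (box_gt0 l0 i x bl.2).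
  by apply: ler_pM => //; [exact: mulr_ge0|apply: ler_wpM2l].
(* The error [eps * W^2] has exponent [1 - 2 * (3 * gamma)], positive by [gamma < 1 / 6]. The pair
   [0 1] fills the second power, absent here. *)
- apply: (@cvg_at_right0_powR _ _ (C2 * Wb ^+ 2 * (n%:R * Mb)) (1 - 6 * gamma) 0 1) => //; first by lra.
  move=> eps e01; have e0 : 0 < eps by case/andP: e01.
  have [l [W [[l0 bl tdY eqY] /andP[W0 WW] qW IB _]]] := data eps e01.
  rewrite mul0r addr0.
  apply: le_trans (weak_momentum_le K_gt0 b_gt0 phi_test e01 l0 bl tdY eqY A0' bp HC2 C20 W0 (qW i)) _.
  have -> : eps `^ (1 - 6 * gamma) = eps * eps `^ (- (3 * gamma)) ^+ 2.
    rewrite expr2 powR_add// -{2}(powRr1 (ltW e0)) powR_add//.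
    by congr (_ `^ _); ring.
  rewrite (_ : C2 * _ * _ * _ = eps * C2 * (Wb * eps `^ (- (3 * gamma))) ^+ 2 * (n%:R * Mb)); last by ring.
  have eC : 0 <= eps * C2 by rewrite mulr_ge0// ltW.
  have I00 : 0 <= Int (fun x => (S eps).1 t (false, i, x)) (- B) B.
    apply: Int_ge0; [exact: (bl.1 false i).2|by rewrite /B; lra|].
    by move=> x _; apply/ltW; exact: (box_gt0 l0 i x bl.2).
  apply: ler_pM => //; first by apply: mulr_ge0 => //; exact: exprn_ge0.
  by apply: ler_wpM2l => //; apply: lerXn2r => //; rewrite nnegrE// (le_trans W0).
(* The exponent of [eps^N] divided by the lower bound [c * eps^(1 + beta + 3 gamma)] on the
   density. *)
- pose p3 := N - 1 - beta - 3 * gamma.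
  apply: (@cvg_at_right0_powR _ _ (K i * (C1 * Ap * (D1 * (1 + (Mb + Mb))))) (gamma / 2)
    (K i * (c^-1 * M * (2 * B))) p3) => //; first by rewrite divr_gt0.
  move=> eps e01; have e0 : 0 < eps by case/andP: e01.
  have [l [W [[l0 bl tdY eqY] /andP[W0 WW] qW IB [mM rc]]]] := data eps e01.
  have Hd x : eps `^ N / (S eps).1 t (false, i, x) <= c^-1 * eps `^ p3.
    have ec : 0 < c * eps `^ (1 + beta + 3 * gamma) by rewrite mulr_gt0// powR_gt0.
    apply: (@le_trans _ _ (eps `^ N / (c * eps `^ (1 + beta + 3 * gamma)))).
      apply: ler_wpM2l; first exact: powR_ge0.
      by rewrite lef_pV2 ?posrE//; exact: lt_le_trans (rc i x).
    rewrite invfM mulrCA -powRN powR_add//.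
    by rewrite (_ : N + - (1 + beta + 3 * gamma) = p3)//; rewrite /p3; ring.
  have H := weak_potential_le K_gt0 b_gt0 e01 l0 bl A0' bp Ap0' bphi phi_ge0 phi1
    HC1 C10 HM Hd (ltW gamma_gt0).
  apply: (le_trans H).
  have k0 := K_gt0 i; rewrite -!(mulrA (K i)) -mulrDr; apply: ler_wpM2l; first exact: ltW.
  apply: lerD; last by rewrite le_eqVlt; apply/orP; left; apply/eqP; rewrite /B; ring.
  have := HD1 eps l _ i 0 e01 l0 bl; rewrite sub0r add0r => h.
  have -> : eps `^ (gamma / 2) = eps `^ gamma * eps `^ (- (gamma / 2)).
    by rewrite powR_add//; congr (_ `^ _); field.
  rewrite (_ : C1 * Ap * _ * _ = C1 * (Ap * eps `^ gamma) * (D1 * eps `^ (- (gamma / 2)) *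
    (1 + (Mb + Mb)))); last by ring.
  have h1 : 0 <= C1 * (Ap * eps `^ gamma) by rewrite mulr_ge0// mulr_ge0// powR_ge0.
  apply: ler_wpM2l => //; apply: le_trans h _; apply: ler_wpM2l.
    by rewrite mulr_ge0// powR_ge0.
  by rewrite lerD2l; apply: lerD.
Qed.
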